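(* There is an algorithm which, given a positive integer $t$ and an $n$-vertex $K_t$-minor-free graph $G$, lists all maximal cliques of $G$ in time at most $n\cdot 4^{2t/5+o(t)}$. Furthermore, this bound is asymptotically sharp up to the $o(t)$ term in the exponent when $n\ge 8t/5$: for all sufficiently large $t$ and all $n\ge 8t/5$ there exists an $n$-vertex $K_t$-minor-free graph with at least $n\cdot 4^{2t/5-o(t)}$ maximal cliques.
   Context: Graphs are finite, simple and undirected. $K_t$ is the complete graph on $t$ vertices. A graph $H$ is a minor of $G$ if $H$ can be obtained from $G$ by a sequence of vertex deletions, edge deletions and edge contractions; $G$ is $K_t$-minor-free if $K_t$ is not a minor of $G$. A clique of $G$ is a set of pairwise adjacent vertices; it is a maximal clique if it is not properly contained in another clique. To list all maximal cliques means to output exactly the maximal cliques of $G$, each of them once. Running time is worst-case time of a deterministic algorithm in the standard RAM model, with the graph given by adjacency lists. The notation $o(t)$ stands for a function of $t$ alone (independent of $n$ and $G$) whose quotient by $t$ tends to $0$ as $t\to\infty$ (the two occurrences may be different functions). *)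

(* Defs.v *)
From mathcomp Require Import all_boot all_order all_algebra.
From mathcomp Require Import all_classical all_reals all_analysis.
Import numFieldNormedType.Exports.
Set Implicit Arguments.
Unset Strict Implicit.
Unset Printing Implicit Defensive.

Local Open Scope nat_scope.

(** * Graphs, minors, cliques *)

Record sgraph (V : finType) := SGraph {
  edge :> rel V;
  edge_sym : symmetric edge;
  edge_irr : irreflexive edge }.

Definition complete_rel (t : nat) : rel 'I_t := fun x y => x != y.

Lemma complete_sym t : symmetric (@complete_rel t).
Proof. by move=> x y; rewrite /complete_rel eq_sym. Qed.

Lemma complete_irr t : irreflexive (@complete_rel t).
Proof. by move=> x; rewrite /complete_rel eqxx. Qed.

Definition complete (t : nat) : sgraph 'I_t :=
  SGraph (@complete_sym t) (@complete_irr t).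

Section MinorOperations.
Variables (V : finType) (G : sgraph V).

Definition del_vertex_rel (x : V) : rel {z : V | z != x} :=
  fun u v => G (val u) (val v).

Lemma del_vertex_sym x : symmetric (@del_vertex_rel x).
Proof. by move=> u v; rewrite /del_vertex_rel edge_sym. Qed.

Lemma del_vertex_irr x : irreflexive (@del_vertex_rel x).
Proof. by move=> u; rewrite /del_vertex_rel edge_irr. Qed.

Definition del_vertex (x : V) : sgraph {z : V | z != x} :=
  SGraph (@del_vertex_sym x) (@del_vertex_irr x).

Definition del_edge_rel (x y : V) : rel V :=
  fun u v => G u v && ([set u; v] != [set x; y]).

Lemma del_edge_sym x y : symmetric (del_edge_rel x y).
Proof. by move=> u v; rewrite /del_edge_rel edge_sym finset.setUC. Qed.

Lemma del_edge_irr x y : irreflexive (del_edge_rel x y).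
Proof. by move=> u; rewrite /del_edge_rel edge_irr. Qed.

Definition del_edge (x y : V) : sgraph V :=
  SGraph (@del_edge_sym x y) (@del_edge_irr x y).

(* The vertex resulting from the contraction of the edge xy is called x; loops
   and parallel edges are discarded. *)
Definition contract_rel (x y : V) : rel {z : V | z != y} :=
  fun u v => (u != v) &&
    [|| G (val u) (val v),
        (val u == x) && G y (val v) |
        (val v == x) && G y (val u)].

Lemma contract_sym x y : symmetric (@contract_rel x y).
Proof.
move=> u v; rewrite /contract_rel eq_sym edge_sym.
by congr (_ && (_ || _)); rewrite orbC.
Qed.

Lemma contract_irr x y : irreflexive (@contract_rel x y).
Proof. by move=> u; rewrite /contract_rel eqxx. Qed.

Definition contract (x y : V) : sgraph {z : V | z != y} :=
  SGraph (@contract_sym x y) (@contract_irr x y).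

End MinorOperations.

Definition isomorphic (V W : finType) (G : sgraph V) (H : sgraph W) : Prop :=
  exists2 f : V -> W, bijective f & forall x y, H (f x) (f y) = G x y.

Inductive minor (W : finType) (H : sgraph W) :
    forall V : finType, sgraph V -> Prop :=
| minor_iso (V : finType) (G : sgraph V) :
    isomorphic G H -> minor H G
| minor_del_vertex (V : finType) (G : sgraph V) (x : V) :
    minor H (del_vertex G x) -> minor H G
| minor_del_edge (V : finType) (G : sgraph V) (x y : V) :
    G x y -> minor H (del_edge G x y) -> minor H G
| minor_contract (V : finType) (G : sgraph V) (x y : V) :
    G x y -> minor H (contract G x y) -> minor H G.

Definition K_minor_free (t : nat) (V : finType) (G : sgraph V) : Prop :=
  ~ minor (complete t) G.

Definition clique (V : finType) (G : sgraph V) (A : {set V}) : bool :=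
  [forall x in A, forall y in A, (x != y) ==> G x y].

Definition max_cliques (V : finType) (G : sgraph V) : {set {set V}} :=
  [set A | maxset (clique G) A].

(** * Random access machines

    Unit-cost word RAM: finitely many registers are named by the program, and
    there is a memory addressed by naturals, zero outside of the input.  Words
    are the naturals below a bound [w]; a computation that produces a value
    not fitting in a word gets stuck, so it does not halt. *)

Inductive arith := Add | Sub | Mul | Div | Mod.

(* Natural-number conventions: subtraction is truncated, m / 0 = 0 and
   m mod 0 = m. *)
Definition eval_arith (o : arith) : nat -> nat -> nat :=
  match o with
  | Add => addn | Sub => subn | Mul => muln | Div => divn | Mod => modn
  end.

Inductive instr :=
| Const (d k : nat)               (* r_d := k *)
| Arith (o : arith) (d a b : nat) (* r_d := r_a o r_b *)
| LoadMem (d a : nat)             (* r_d := memory[r_a] *)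
| StoreMem (a b : nat)            (* memory[r_a] := r_b *)
| Jump (l : nat)
| JumpLt (a b l : nat)            (* if r_a < r_b then goto l *)
| Output (a : nat)                (* append r_a to the output *)
| Halt.

Definition program := seq instr.

Record config := Config {
  pc : nat;
  reg : nat -> nat;
  memory : nat -> nat;
  out : seq nat }.

Definition upd (f : nat -> nat) (a v : nat) : nat -> nat :=
  fun x => if x == a then v else f x.

(* A program counter beyond the end of the program means [Halt]. *)
Definition current (P : program) (c : config) : instr := nth Halt P (pc c).

Section Semantics.
Variables (w : nat) (P : program).

Definition set_reg (c : config) (d v : nat) : option config :=
  if v < w then Some (Config (pc c).+1 (upd (reg c) d v) (memory c) (out c))
  else None.

Definition step (c : config) : option config :=
  match current P c with
  | Const d k => set_reg c d k
  | Arith o d a b => set_reg c d (eval_arith o (reg c a) (reg c b))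
  | LoadMem d a => set_reg c d (memory c (reg c a))
  | StoreMem a b =>
      Some (Config (pc c).+1 (reg c) (upd (memory c) (reg c a) (reg c b)) (out c))
  | Jump l => Some (Config l (reg c) (memory c) (out c))
  | JumpLt a b l =>
      Some (Config (if reg c a < reg c b then l else (pc c).+1)
                   (reg c) (memory c) (out c))
  | Output a =>
      Some (Config (pc c).+1 (reg c) (memory c) (rcons (out c) (reg c a)))
  | Halt => None
  end.

Definition exec (T : nat) (c : config) : option config :=
  iter T (obind step) (Some c).

(* From [c], the machine executes exactly [T] instructions before reaching
   [Halt], and has then written [o]. *)
Definition halts_in (c : config) (T : nat) (o : seq nat) : Prop :=
  exists c', [/\ exec T c = Some c', current P c' = Halt & out c' = o].

End Semantics.

(** * The clique listing problem *)

Definition adjacency_lists n (G : sgraph 'I_n) (L : 'I_n -> seq 'I_n) : Prop :=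
  forall v, uniq (L v) /\ forall u, (u \in L v) = G v u.

Definition encode_list n (s : seq 'I_n) : seq nat := size s :: map val s.

(* Cell v < n holds the address of the adjacency list of v; the lists, each
   preceded by its length, are stored consecutively from address n on. *)
Definition encode_graph n (L : 'I_n -> seq 'I_n) : seq nat :=
  [seq n + \sum_(u < n | u < v) size (encode_list (L u)) | v : 'I_n] ++
  flatten [seq encode_list (L v) | v : 'I_n].

(* Register 0 holds t and register 1 holds n. *)
Definition init_config t n (L : 'I_n -> seq 'I_n) : config :=
  Config 0 (nth 0 [:: t; n]) (nth 0 (encode_graph L)) [::].

Definition lists_max_cliques n (G : sgraph 'I_n) (o : seq nat) : Prop :=
  exists cs : seq (seq 'I_n),
    let As := [seq [set x in c] | c <- cs] in
    [/\ o = flatten [seq encode_list c | c <- cs],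
        all uniq cs,
        uniq As
      & As =i max_cliques G].

(* Words have O(log (n + t)) bits. *)
Definition word_bound (k t n : nat) : nat := (n + t + 2) ^ k.

Local Open Scope classical_set_scope.
Local Open Scope ring_scope.

Definition little_o_id (R : realType) (f : nat -> R) : Prop :=
  f t / t%:R @[t --> \oo] --> (0 : R).

(* Main.v *)
(** Lower bound: disjoint copies of the complete [m]-partite graph with parts of
    size four, where [5 m < 2 t].  Each has [4 ^ m] maximal cliques on [4 m]
    vertices, and no [K_t] minor because at most [m] branch sets are singletons.

    Upper bound.  A dense graph has a [K_t] minor, so a [K_t]-minor-free graph is
    [D]-degenerate with [D] polynomial in [t].  In a degeneracy order every maximal
    clique consists of its first vertex [v] and a maximal clique of the graph
    induced by the at most [D] later neighbours of [v]; the maximal cliques of this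
    graph are enumerated by adding its vertices one at a time, and those that some
    vertex before [v] extends are discarded.  It remains to bound the number
    [mc P] of maximal cliques of an induced subgraph with [#|P| <= D].  While some
    vertex [u] of [P] has more than [d] non-neighbours in [P], branch:
    [mc P <= mc (P - u) + mc (P & N u)].  As long as [#|P|] is much larger than
    [t log t], minor-freeness provides a [u] with [2/5 #|P|] non-neighbours, so the
    second branch can be taken only [O(log t)] times; afterwards it can be taken
    [#|P| / d] times.  When no [u] is left, branching on the non-neighbours of a
    vertex gives [mc P ^ 5 <= 4 ^ (#|P| + w)] for the clique number [w], and
    [#|P| + w <= 2 t + d ^ 2]: otherwise a maximum clique together with pairs of
    jointly dominating adjacent vertices is a [K_t] model.  Take [d] of order
    [t ^ (1/3)].

    The enumeration spends time polynomial in [t] on each node of its tree, hence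
    [n * max_P mc P * poly t] in total, and the polynomial is absorbed by [o(t)]. *)
Require Import Defs.
From mathcomp Require Import all_boot.
From mathcomp Require Import zify.
Set Implicit Arguments.
Unset Strict Implicit.
Unset Printing Implicit Defensive.

(** * Minors as models *)

(** The exponent 2/5 comes from one trade-off. Passing from [P] to the neighbours of a vertex with
    [k] non-neighbours, itself included, removes [k] vertices and lowers the clique number by one,
    while the pivot has at most [k] branches; [k ^ 5 <= 4 ^ (k + 1)] is an equality at [k = 4], the
    part size of the extremal graph. The degree bound is of order [t ^ 2], so [#|P| / d] neighbour
    branches from the start would cost far more than [o(t)]. Hence the earlier stage: keeping less
    than 3/5 of [P] more than halves [#|P| ^ 2]. With about [t log t] vertices left, the losses are
    [d ^ 2] and [t log ^ 2 t / d], balanced near [d = t ^ (1/3)]. The degree bound may be crude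
    because it enters the time polynomially and the exponent only through its logarithm. On the
    machine an overflow blocks execution, so time and size of values are tracked together through a
    small structured language. *)

Definition connected_set (V : finType) (G : sgraph V) (B : {set V}) : Prop :=
  forall S : {set V}, S \subset B -> S != set0 -> S != B ->
    exists x y, [/\ x \in S, y \in B :\: S & G x y].

(** Connectedness is phrased through cuts rather than paths, because an edge across a cut can be
    pushed along a map or lifted from a contraction directly. The empty set satisfies
    [connected_set], so non-emptiness of the bags is a separate clause. *)
Definition model (t : nat) (V : finType) (G : sgraph V)
    (B : 'I_t -> {set V}) : Prop :=
  [/\ forall i, B i != set0,
      forall i, connected_set G (B i),
      forall i j, i != j -> [disjoint B i & B j]
    & forall i j, i != j -> exists x y, [/\ x \in B i, y \in B j & G x y]].

Definition has_model (t : nat) (V : finType) (G : sgraph V) : Prop :=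
  exists B : 'I_t -> {set V}, model G B.

Lemma connected_set1 (V : finType) (G : sgraph V) (x : V) :
  connected_set G [set x].
Proof.
move=> S; rewrite subset1 => /orP[/eqP->|/eqP->]; first by rewrite eqxx.
by rewrite eqxx.
Qed.

(** A cut of an image bag pulls back to a cut of the bag, whose crossing edge is mapped forward.
    Since [r] may identify vertices of one bag only, deletions, contractions inside a bag and
    inclusions of induced subgraphs are all instances. *)
Lemma model_push (t : nat) (V V' : finType) (G : sgraph V) (G' : sgraph V')
    (r : V -> V') (B : 'I_t -> {set V}) :
    (forall i j x y, x \in B i -> y \in B j -> r x = r y -> i = j) ->
    (forall i j x y, x \in B i -> y \in B j -> G x y -> r x != r y ->
       G' (r x) (r y)) ->
  model G B -> model G' (fun i => r @: B i).
Proof.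
move=> rB rG [B0 Bc Bd Ba]; split.
- move=> i; have /set0Pn[x xB] := B0 i.
  by apply/set0Pn; exists (r x); apply: imset_f.
- move=> i S SB S0 SneB.
  pose S1 := [set x in B i | r x \in S].
  have [|||x [y [xS yS xy]]] := Bc i S1.
  + by apply/subsetP=> x; rewrite inE => /andP[].
  + have /set0Pn[z zS] := S0; have /imsetP[x xB zE] := subsetP SB _ zS.
    by apply/set0Pn; exists x; rewrite inE xB -zE.
  + apply: contraNneq SneB => S1E; rewrite eqEsubset SB /=.
    by apply/subsetP=> _ /imsetP[x xB ->]; move: xB; rewrite -S1E inE => /andP[].
  move: xS yS; rewrite !inE => /andP[xB xS] /andP[yS yB].
  move: yS; rewrite yB /= => yS.
  exists (r x), (r y); split=> //.
    by rewrite inE yS imset_f.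
  apply: (rG i i) => //; apply: contraNneq yS => <-.
  exact: xS.
- move=> i j ij; rewrite disjoints_subset; apply/subsetP=> _ /imsetP[x xB ->].
  rewrite inE; apply/negP=> /imsetP[y yB xy].
  by have := rB _ _ _ _ xB yB xy; apply/eqP.
- move=> i j ij; have [x [y [xB yB xy]]] := Ba _ _ ij.
  exists (r x), (r y); split; [exact: imset_f|exact: imset_f|].
  apply: (rG i j) => //; apply: contraNneq ij => rxy.
  by apply/eqP; apply: rB rxy.
Qed.

(** Induction on the number of vertices: contract an edge inside a bag with two or more vertices,
    otherwise delete a vertex in no bag. If neither applies, the bags are singletons partitioning
    [V] and [G] is already complete. *)
Lemma minor_of_model (t : nat) (V : finType) (G : sgraph V) :
  has_model t G -> minor (complete t) G.
Proof.
move En: #|V| => n; elim: n V G En => [|n IH] V G En [B Bm].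
  apply: minor_iso; have t0 : t = 0%N.
    case: t B Bm => // t B [B0 _ _ _]; have /set0Pn[x _] := B0 ord0.
    by have := fintype0 x En.
  subst t; exists (fun x => False_rect _ (fintype0 x En)).
    exists (fun i : 'I_0 => False_rect V (notF (ltn_ord i))) => [x|[] //].
    by case: (fintype0 x En).
  by move=> x; case: (fintype0 x En).
have card' y : #|{: {z : V | z != y}}| = n.
  by rewrite card_sig -[n]/(n.+1.-1) -En -(cardC1 y); apply: eq_card => z; rewrite !inE.
case: (pickP (fun p : V * 'I_t => (p.1 \in B p.2) && (#|B p.2| != 1)%N))
    => [[x0 i] /= /andP[x0B cB]|small].
  have [B0 Bc Bd Ba] := Bm.
  (* The cut of the bag into [x0] and the rest yields the edge to contract. *)
  have [|||x [y [xS yS xy]]] := Bc i [set x0].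
  + by rewrite sub1set.
  + by apply/set0Pn; exists x0; rewrite inE.
  + by apply: contraNneq cB => <-; rewrite cards1.
  move: xS yS; rewrite !inE => /eqP ? /andP[yx yB]; subst x0.
  apply: (minor_contract xy); apply: IH; first exact: card'.
  have xy' : x != y by rewrite eq_sym.
  pose x' : {z : V | z != y} := Sub x xy'.
  pose r z : {z : V | z != y} := insubd x' z.
  have valr z : val (r z) = if z == y then x else z.
    by rewrite val_insubd; case: (z =P y).
  have uniqB k l z : z \in B k -> z \in B l -> k = l.
    move=> zk zl; apply/eqP; apply: contraTT isT => kl.
    by have := Bd _ _ kl; rewrite disjoints_subset => /subsetP/(_ _ zk); rewrite inE zl.
  exists (fun i => r @: B i); apply: (model_push _ _ Bm) => k l u v uB vB.
    move=> /(congr1 val); rewrite !valr.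
    case: eqP => [uy|uy]; case: eqP => [vy|vy].
    * by rewrite uy vy in uB vB => _; apply: uniqB uB vB.
    * by move=> xv; rewrite uy -xv in uB vB; rewrite (uniqB _ _ _ uB yB) (uniqB _ _ _ vB x0B).
    * by move=> xu; rewrite vy xu in uB vB; rewrite (uniqB _ _ _ vB yB) (uniqB _ _ _ uB x0B).
    * by move=> uv; rewrite uv in uB; apply: uniqB uB vB.
  move=> uv ruv; rewrite /= /contract_rel ruv /= !valr.
  case: (u =P y) => [uy|_]; case: (v =P y) => [vy|_].
  * by rewrite uy vy edge_irr in uv.
  * by rewrite uy in uv; rewrite uv eqxx orbT.
  * by rewrite vy edge_sym in uv; rewrite uv eqxx !orbT.
  * by rewrite uv.
have [B0 Bc Bd Ba] := Bm.
have B1 i : exists x, B i = [set x].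
  have /set0Pn[x xB] := B0 i; apply/cards1P.
  by have := small (x, i); rewrite /= xB /= => /negbFE.
case: (pickP (fun x : V => [forall i, x \notin B i])) => [x0 /forallP x0B|cov].
  apply: (minor_del_vertex (x := x0)); apply: IH; first exact: card'.
  (* With [t = 0] there are no bags; otherwise the vertex of bag 0 survives the deletion and serves
     as the default value of [insubd]. *)
  case: t B Bm B0 Bc Bd Ba B1 small x0B => [|t] B Bm B0 Bc Bd Ba B1 small x0B.
    by exists (fun i => set0); split; case.
  have [y0 y0B] := B1 ord0.
  have y0x : y0 != x0.
    by apply: contraTneq (x0B ord0) => <-; rewrite y0B inE eqxx.
  pose y' : {z : V | z != x0} := Sub y0 y0x.
  pose r z : {z : V | z != x0} := insubd y' z.
  have valr i z : z \in B i -> val (r z) = z.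
    move=> zB; rewrite val_insubd; case: eqP => // zx.
    by rewrite zx (negbTE (x0B i)) in zB.
  exists (fun i => r @: B i); apply: (model_push _ _ Bm) => k l u v uB vB.
    move=> /(congr1 val); rewrite (valr _ _ uB) (valr _ _ vB) => uv.
    apply/eqP; apply: contraTT isT => kl.
    by have := Bd _ _ kl; rewrite disjoints_subset => /subsetP/(_ _ uB); rewrite inE uv vB.
  by move=> uv _; rewrite /= /del_vertex_rel (valr _ _ uB) (valr _ _ vB).
apply: minor_iso.
have ex x : exists i, x \in B i.
  by have /negbT := cov x; rewrite negb_forall => /existsP[i]; rewrite negbK; exists i.
have [b bE] : exists b : 'I_t -> V, forall i, B i = [set b i].
  have [b bP] := fin_all_exists (fun i => B1 i).
  by exists b.
have binj : injective b.
  move=> i j bij; apply/eqP; apply: contraTT isT => ij.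
  by have := Bd _ _ ij; rewrite !bE disjoints_subset bij => /subsetP/(_ (b j)); rewrite !inE eqxx => /(_ isT).
have [f fE] : exists f : V -> 'I_t, forall x, x \in B (f x).
  by have [f fP] := fin_all_exists ex; exists f.
have fK : cancel f b by move=> x; have := fE x; rewrite bE inE => /eqP.
exists f; first by exists b => // i; apply: binj; rewrite fK.
move=> x y; rewrite /= /complete_rel; case: (x =P y) => [->|xy].
  by rewrite eqxx edge_irr.
have fxy : f x != f y by apply: contra_notN xy => /eqP fxy; rewrite -[x]fK fxy fK.
rewrite fxy; have [u [v [uB vB uv]]] := Ba _ _ fxy.
by move: uB vB uv; rewrite !bE !inE !fK => /eqP-> /eqP->.
Qed.

(** Induction on the derivation: bags are included along deletions, and for a contraction they are
    replaced by preimages, so [y] joins the bag of [x]. *)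
Lemma model_of_minor (t : nat) (V : finType) (G : sgraph V) :
  minor (complete t) G -> has_model t G.
Proof.
move=> m; elim: {V G} m => [V G [f [g fK gK] fE]|V G x _ [B Bm]|V G x y xy _ [B Bm]|V G x y xy _ [B Bm]].
- exists (fun i => [set g i]); split.
  + by move=> i; apply/set0Pn; exists (g i); rewrite inE.
  + by move=> i; apply: connected_set1.
  + move=> i j ij; rewrite disjoints_subset sub1set !inE.
    by apply: contraNneq ij => /(can_inj gK)->.
  + move=> i j ij; exists (g i), (g j); rewrite !inE; split=> //.
    by rewrite -fE !gK.
- have [B0 Bc Bd Ba] := Bm.
  exists (fun i => val @: B i); apply: (model_push _ _ Bm) => // k l u v uB vB.
  move=> /val_inj uv; apply/eqP; apply: contraTT isT => kl.
  by have := Bd _ _ kl; rewrite disjoints_subset => /subsetP/(_ _ uB); rewrite inE uv vB.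
- have [B0 Bc Bd Ba] := Bm.
  exists (fun i => id @: B i); apply: (model_push _ _ Bm) => [k l u v uB vB uv|k l u v uB vB].
    apply/eqP; apply: contraTT isT => kl.
    by have := Bd _ _ kl; rewrite disjoints_subset => /subsetP/(_ _ uB); rewrite inE uv vB.
  by move=> /andP[].
- have [B0 Bc Bd Ba] := Bm.
  have xy' : x != y by apply: contraTneq xy => ->; rewrite edge_irr.
  pose x' : {z : V | z != y} := Sub x xy'.
  pose r z : {z : V | z != y} := insubd x' z.
  have rK z : r (val z) = z by rewrite /r valKd.
  have rx : r x = x' by rewrite -[x]/(val x') rK.
  have ry : r y = x' by rewrite /r /insubd insubF // eqxx.
  (* an edge of the contraction lifts to an edge between the preimages *)
  have lift u v : contract G x y u v -> exists u1 v1, [/\ r u1 = u, r v1 = v & G u1 v1].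
    move=> /andP[_ /or3P[uv|/andP[/eqP ux yv]|/andP[/eqP vx yu]]].
    + by exists (val u), (val v); rewrite !rK.
    + exists y, (val v); rewrite rK ry; split=> //.
      by apply: val_inj; rewrite /= -ux.
    + exists (val u), y; rewrite rK ry edge_sym; split=> //.
      by apply: val_inj; rewrite /= -vx.
  exists (fun i => [set z | r z \in B i]); split.
  + move=> i; have /set0Pn[u uB] := B0 i.
    by apply/set0Pn; exists (val u); rewrite inE rK.
  + move=> i S SB S0 SneB.
    (* A cut separating [x] from [y] is crossed by the edge [xy] itself. Otherwise [S] is a union of
       fibres of [r], so it gives a cut in the contraction, whose crossing edge lifts. *)
    case: (boolP ((x \in S) == (y \in S))) => [/eqP xyS|]; last first.
      case xS: (x \in S); case yS: (y \in S) => // _.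
        exists x, y; split=> //; rewrite !inE yS /= ry -rx.
        by have := subsetP SB x xS; rewrite inE.
      exists y, x; split=> //; last by rewrite edge_sym.
      rewrite !inE xS /= rx -ry.
      by have := subsetP SB y yS; rewrite inE.
    have memS z : (val (r z) \in S) = (z \in S).
      by rewrite val_insubd; case: eqP => //= ->.
    have [|||u [v [uS vS uv]]] := Bc i (r @: S).
    * apply/subsetP=> _ /imsetP[z zS ->].
      by have := subsetP SB z zS; rewrite inE.
    * by have /set0Pn[z zS] := S0; apply/set0Pn; exists (r z); apply: imset_f.
    * apply: contraNneq SneB => rSB; rewrite eqEsubset SB /=.
      apply/subsetP=> z; rewrite inE -rSB => /imsetP[z' z'S zz'].
      by rewrite -memS zz' memS.
    have [u1 [v1 [u1E v1E uv1]]] := lift _ _ uv.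
    exists u1, v1; split=> //.
      by have /imsetP[z zS uz] := uS; rewrite -memS u1E uz memS.
    move: vS; rewrite !inE v1E => /andP[vS ->]; rewrite andbT.
    by apply: contraNN vS => v1S; rewrite -v1E imset_f.
  + move=> i j ij; rewrite disjoints_subset; apply/subsetP=> z; rewrite !inE => zB.
    by have := Bd _ _ ij; rewrite disjoints_subset => /subsetP/(_ _ zB); rewrite inE.
  + move=> i j ij; have [u [v [uB vB uv]]] := Ba _ _ ij.
    have [u1 [v1 [u1E v1E uv1]]] := lift _ _ uv.
    by exists u1, v1; rewrite !inE u1E v1E.
Qed.

Lemma K_minor_freeP (t : nat) (V : finType) (G : sgraph V) :
  K_minor_free t G <-> ~ has_model t G.
Proof. by split=> h m; apply: h; [apply: minor_of_model|apply: model_of_minor]. Qed.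

Definition induced_rel (V : finType) (G : sgraph V) (S : {set V}) :
  rel {z : V | z \in S} := fun u v => G (val u) (val v).

Lemma induced_sym (V : finType) (G : sgraph V) S : symmetric (@induced_rel V G S).
Proof. by move=> u v; rewrite /induced_rel edge_sym. Qed.

Lemma induced_irr (V : finType) (G : sgraph V) S : irreflexive (@induced_rel V G S).
Proof. by move=> u; rewrite /induced_rel edge_irr. Qed.

Definition induced (V : finType) (G : sgraph V) (S : {set V}) :
    sgraph {z : V | z \in S} :=
  SGraph (@induced_sym V G S) (@induced_irr V G S).

Lemma has_model_induced (t : nat) (V : finType) (G : sgraph V) (S : {set V}) :
  has_model t (induced G S) -> has_model t G.
Proof.
move=> [B Bm]; have [B0 Bc Bd Ba] := Bm.
exists (fun i => val @: B i); apply: (model_push _ _ Bm) => // k l u v uB vB.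
move=> /val_inj uv; apply/eqP; apply: contraTT isT => kl.
by have := Bd _ _ kl; rewrite disjoints_subset => /subsetP/(_ _ uB); rewrite inE uv vB.
Qed.

(** * The lower bound *)

Section Blocks.
Variables (n m' : nat).
Local Notation m := m'.+1.

(* Disjoint copies of the complete [m]-partite graph with parts of size four;
   the last copy may be incomplete. *)
Definition blocks_rel : rel 'I_n :=
  fun x y => (x %/ (4 * m) == y %/ (4 * m)) && (x %% m != y %% m).

Lemma blocks_sym : symmetric blocks_rel.
Proof. by move=> x y; rewrite /blocks_rel eq_sym [_ %% _ == _]eq_sym. Qed.

Lemma blocks_irr : irreflexive blocks_rel.
Proof. by move=> x; rewrite /blocks_rel !eqxx. Qed.

Definition blocks : sgraph 'I_n := SGraph blocks_sym blocks_irr.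

(** No edge leaves a block, so the part of [B] in the block of [x] would be a cut without crossing
    edge. *)
Lemma block_bag (B : {set 'I_n}) (x y : 'I_n) :
  connected_set blocks B -> x \in B -> y \in B -> x %/ (4 * m) = y %/ (4 * m).
Proof.
move=> Bc xB yB; pose S := [set z in B | z %/ (4 * m) == x %/ (4 * m)].
have [SB|SB] := eqVneq S B.
  by move: yB; rewrite -SB inE => /andP[_ /eqP].
have [||u [v []]] := Bc S _ _ SB.
- by apply/subsetP=> z; rewrite inE => /andP[].
- by apply/set0Pn; exists x; rewrite !inE xB eqxx.
rewrite !inE => /andP[uB /eqP ux] /andP[+ vB] /andP[/eqP uv _].
by rewrite vB -uv ux eqxx.
Qed.

Lemma card_block (c : nat) : #|[set z : 'I_n | z %/ (4 * m) == c]| <= 4 * m.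
Proof.
pose f (z : 'I_n) : 'I_(4 * m).-1.+1 := inord (z %% (4 * m)).
have finj : {in [set z : 'I_n | z %/ (4 * m) == c] &, injective f}.
  move=> z z'; rewrite !inE => /eqP zc /eqP zc' /(congr1 val).
  rewrite /= !inordK ?prednK ?ltn_mod // => zz'; apply: val_inj.
  by rewrite /= (divn_eq z (4 * m)) (divn_eq z' (4 * m)) zc zc' zz'.
by rewrite -(card_in_imset finj) -[X in _ <= X](card_ord (4 * m).-1.+1) max_card.
Qed.

(** Pairwise adjacent connected bags lie in a single block, which has at most [4 * m] vertices.
    Singleton bags have distinct residues modulo [m] and every other bag has at least two vertices,
    so [2 * t <= 4 * m + m]. *)
Lemma blocks_minor_free (t : nat) : 5 * m < 2 * t -> K_minor_free t blocks.
Proof.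
move=> mt; apply/K_minor_freeP=> -[B [B0 Bc Bd Ba]].
have ex i : exists x, x \in B i by apply/set0Pn.
have [rep repB] := fin_all_exists ex => {ex}.
case: t mt B B0 Bc Bd Ba rep repB => [|t] mt B B0 Bc Bd Ba rep repB; first by lia.
pose c := rep ord0 %/ (4 * m).
have inblock : \bigcup_i B i \subset [set z : 'I_n | z %/ (4 * m) == c].
  apply/bigcupsP=> i _; apply/subsetP=> z zB; rewrite inE; apply/eqP.
  have [i0|i0] := eqVneq i ord0.
    by rewrite i0 in zB; apply: (block_bag (Bc ord0)).
  have [u [v [uB vB /andP[/eqP uv _]]]] := Ba _ _ i0.
  by rewrite (block_bag (Bc i) zB uB) uv (block_bag (Bc ord0) vB (repB ord0)).
have total : \sum_i #|B i| <= 4 * m.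
  apply: leq_trans (card_block c); apply: leq_trans (subset_leq_card inblock).
  rewrite -[X in _ <= X]sum1_card partition_disjoint_bigcup //.
  by apply: leq_sum => i _; rewrite sum1_card.
have singles : #|[set i | #|B i| == 1]| <= m.
  pose f i : 'I_m := inord (rep i %% m).
  have finj : {in [set i | #|B i| == 1] &, injective f}.
    move=> i j; rewrite !inE => /cards1P[x Bi] /cards1P[y Bj] /(congr1 val).
    rewrite /= !inordK ?ltn_mod // => ij; apply/eqP; apply: contraTT isT => inej.
    have [u [v [uB vB /andP[_ /eqP[]]]]] := Ba _ _ inej.
    have := repB i; have := repB j; move: uB vB.
    by rewrite Bi Bj !inE => /eqP-> /eqP-> /eqP <- /eqP <-.
  by rewrite -(card_in_imset finj) -[X in _ <= X]card_ord max_card.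
have : \sum_(i < t.+1) 2 <= \sum_i #|B i| + #|[set i | #|B i| == 1]|.
  rewrite -sum1_card [X in _ + X]big_mkcond -big_split /=; apply: leq_sum => i _.
  rewrite inE; have : 0 < #|B i| by rewrite card_gt0.
  by case: #|B i| => [|[|k]].
rewrite sum_nat_const card_ord; lia.
Qed.

(** A vertex [z] is read as the triple of its block, its part [z %% m] and its place among the four
    vertices of that part. [bf] picks a complete block and one place in each part; an incomplete
    last block is left out by [n %/ (4 * m)]. *)
Definition transversal_clique (bf : 'I_(n %/ (4 * m)) * {ffun 'I_m -> 'I_4}) : {set 'I_n} :=
  [set z : 'I_n | (z %/ (4 * m) == bf.1) &&
                  (z %% (4 * m) %/ m == bf.2 (inord (z %% m)))].

Lemma transversal_vertex bf (i : 'I_m) :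
  exists z : 'I_n, [/\ z \in transversal_clique bf, z %% m = i, z %/ (4 * m) = bf.1 &
                       z %% (4 * m) %/ m = bf.2 i].
Proof.
case: bf => b f /=; pose z := b * (4 * m) + (f i * m + i).
have small : f i * m + i < 4 * m by have := ltn_ord (f i); have := ltn_ord i; nia.
have zn : z < n.
  apply: leq_trans (leq_trunc_div n (4 * m)); have := ltn_ord b; rewrite /z; nia.
have z1 : z %/ (4 * m) = b by rewrite /z divnMDl // (divn_small small) addn0.
have z2 : z %% m = i by rewrite /z mulnA modnMDl modnMDl (modn_small (ltn_ord i)).
have z3 : z %% (4 * m) %/ m = f i.
  by rewrite /z modnMDl (modn_small small) divnMDl // (divn_small (ltn_ord i)) addn0.
by exists (Ordinal zn); rewrite inE /= z1 z2 z3 inord_val !eqxx.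
Qed.

Lemma transversal_clique_max bf : transversal_clique bf \in max_cliques blocks.
Proof.
rewrite inE; apply/maxsetP; split.
  apply/forall_inP=> x xS; apply/forall_inP=> y yS; apply/implyP=> xy.
  move: xS yS; rewrite !inE => /andP[/eqP xb /eqP xf] /andP[/eqP yb /eqP yf].
  rewrite /= /blocks_rel xb yb eqxx /=; apply: contraNneq xy => r.
  have rows : x %% (4 * m) = y %% (4 * m).
    rewrite (divn_eq (x %% (4 * m)) m) (divn_eq (y %% (4 * m)) m) xf yf.
    by rewrite !modn_dvdm ?dvdn_mull // r.
  by apply/eqP/val_inj; rewrite /= (divn_eq x (4 * m)) (divn_eq y (4 * m)) xb yb rows.
move=> B Bc SB; apply/eqP; rewrite eq_sym eqEsubset SB /=; apply/subsetP=> w wB.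
(* Any [w] has the residue of some member [z] of the transversal, and equal residues are never
   adjacent. *)
have [z [zS zw _ _]] := transversal_vertex bf (inord (w %% m)).
rewrite inordK ?ltn_mod // in zw.
apply: contraTT isT => wS; have wz : w != z by apply: contraNneq wS => ->.
have /forall_inP/(_ w wB)/forall_inP/(_ z (subsetP SB z zS))/implyP/(_ wz) := Bc.
by rewrite /= /blocks_rel zw eqxx andbF.
Qed.

Lemma transversal_clique_inj : injective transversal_clique.
Proof.
move=> [b f] [b' f'] E.
have bE : b = b'.
  have [z [+ _ zb _]] := transversal_vertex (b, f) ord0.
  by rewrite E inE zb => /andP[/eqP/val_inj].
rewrite -bE; congr (_, _); apply/ffunP=> i.
have [z [+ zi _ zf]] := transversal_vertex (b, f) i.
by rewrite E inE zf zi inord_val => /andP[_ /eqP/val_inj].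
Qed.

Lemma card_blocks_max_cliques : n %/ (4 * m) * 4 ^ m <= #|max_cliques blocks|.
Proof.
have -> : n %/ (4 * m) * 4 ^ m = #|transversal_clique @: setT|.
  rewrite card_imset; last exact: transversal_clique_inj.
  by rewrite cardsT card_prod card_ffun !card_ord.
by apply/subset_leq_card/subsetP=> _ /imsetP[bf _ ->]; apply: transversal_clique_max.
Qed.

End Blocks.

(** * Complete minors in dense graphs *)

Section Dense.
Variables (V : finType) (G : sgraph V) (A : {set V}).

(** As [G] is irreflexive, [x] counts among its own non-neighbours whenever it lies in [A]; the
    later counts rely on this. *)
Definition nonadj (x : V) : {set V} := [set y in A | ~~ G x y].

Hypothesis codeg : forall x, x \in A -> 5 * #|nonadj x| <= 2 * #|A|.

Lemma connected_star (x : V) (D : {set V}) :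
  {in D, forall y, G x y} -> connected_set G (x |: D).
Proof.
move=> xD S SD S0 SneD.
have [xS|xS] := boolP (x \in S).
  have /set0Pn[y] : (x |: D) :\: S != set0.
    by rewrite setD_eq0; apply: contraNN SneD => DS; rewrite eqEsubset SD.
  rewrite !inE => /andP[yS /orP[/eqP yx|yD]]; first by rewrite yx xS in yS.
  by exists x, y; rewrite !inE yS yD orbT xD.
have /set0Pn[y yS] := S0.
have := subsetP SD y yS; rewrite !inE => /orP[/eqP yx|yD].
  by rewrite -yx yS in xS.
by exists y, x; rewrite !inE eqxx xS edge_sym xD.
Qed.

(* Double counting: every vertex of [X] misses at most [2/5 #|A|] vertices, so
   an average member of [C] misses at most [4/5] of [X]. *)
Lemma good_dominator (C X : {set V}) :
  C \subset A -> X \subset A -> #|A| <= 2 * #|C| -> 0 < #|A| ->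
  exists2 s, s \in C & 5 * #|[set x in X | ~~ G s x]| <= 4 * #|X|.
Proof.
move=> CA XA AC A0.
case: (pickP [pred s in C | 5 * #|[set x in X | ~~ G s x]| <= 4 * #|X|]).
  by move=> s /andP[sC sX]; exists s.
move=> none; exfalso.
have lo : #|C| * (4 * #|X|).+1 <= 5 * \sum_(s in C) #|[set x in X | ~~ G s x]|.
  rewrite big_distrr /= -sum_nat_const; apply: leq_sum => s sC.
  by have := none s; rewrite inE /= sC /= ltnNge => ->.
have up : 5 * \sum_(s in C) #|[set x in X | ~~ G s x]| <= #|X| * (2 * #|A|).
  have -> : \sum_(s in C) #|[set x in X | ~~ G s x]|
          = \sum_(x in X) #|[set s in C | ~~ G x s]|.
    under eq_bigr do rewrite -sum1_card.
    under [RHS]eq_bigr do rewrite -sum1_card.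
    rewrite (exchange_big_dep (mem X)) /=; last by move=> s x _; rewrite inE => /andP[].
    apply: eq_bigr => x xX; apply: eq_bigl => s.
    by rewrite !inE xX edge_sym.
  rewrite big_distrr /= -sum_nat_const; apply: leq_sum => x xX.
  apply: leq_trans (codeg (subsetP XA x xX)); rewrite leq_mul2l /=.
  by apply/subset_leq_card/subsetP=> y; rewrite !inE => /andP[/(subsetP CA)->].
nia.
Qed.

(** Greedy choice: [good_dominator], applied to the vertices not yet dominated, shrinks that set by
    the factor 4/5 in each round. *)
Lemma dominating_subset (C : {set V}) (r : nat) :
  C \subset A -> #|A| <= 2 * #|C| -> 0 < #|A| ->
  exists2 D : {set V}, D \subset C &
    #|D| <= r /\
    5 ^ r * #|[set y in A | [forall x in D, ~~ G x y]]| <= 4 ^ r * #|A|.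
Proof.
move=> CA AC A0; elim: r => [|r [D DC [Dr Db]]].
  exists set0; first by rewrite sub0set.
  rewrite cards0 !expn0 !mul1n; split=> //.
  by apply/subset_leq_card/subsetP=> y; rewrite inE => /andP[].
set X := [set y in A | _] in Db.
have XA : X \subset A by apply/subsetP=> y; rewrite inE => /andP[].
have [s sC sX] := good_dominator CA XA AC A0.
exists (s |: D); first by rewrite subUset sub1set sC.
split; first by rewrite (leq_trans (leq_card_setU _ _)) // cards1.
apply: (@leq_trans (5 ^ r.+1 * #|[set x in X | ~~ G s x]|)).
  rewrite leq_mul2l; apply/orP; right; apply/subset_leq_card/subsetP=> y.
  rewrite !inE => /andP[-> /forallP yD] /=; apply/andP; split.
    apply/forallP=> x; apply/implyP=> xD.
    by have := yD x; rewrite !inE xD orbT.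
  by have := yD s; rewrite !inE eqxx.
rewrite !expnS; nia.
Qed.

(** The centre [s] avoids [F], and its neighbours outside [F] form at least half of [A], since [F]
    takes at most 1/10 and the non-neighbours at most 2/5. After [4 * L] greedy rounds less than one
    vertex is undominated. *)
Lemma dominating_star (F : {set V}) (L : nat) :
  #|A| < 2 ^ L -> 0 < #|A| -> 10 * #|F| <= #|A| ->
  exists D : {set V},
    [/\ D \subset A :\: F, D != set0, connected_set G D, #|D| <= 4 * L + 2 &
        forall y, y \in A -> exists2 x, x \in D & G x y].
Proof.
move=> AL A0 FA.
have cardD (X Y : {set V}) : #|X| - #|Y| <= #|X :\: Y|.
  by rewrite cardsD leq_sub2l // subset_leq_card // subsetIr.
have /set0Pn[s] : A :\: F != set0.
  by rewrite -card_gt0; have := cardD A F; lia.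
rewrite inE => /andP[sF sA].
pose C := (A :\: F) :\: nonadj s.
have CA : C \subset A by apply/subsetP=> y; rewrite !inE => /and3P[].
have AC : #|A| <= 2 * #|C|.
  by have := cardD A F; have := cardD (A :\: F) (nonadj s); have := codeg sA; rewrite -/C; lia.
have [D DC [Dr Db]] := dominating_subset (4 * L) CA AC A0.
have sC y : y \in C -> G s y.
  by rewrite !inE => /and3P[+ _ yA]; rewrite yA /= negbK.
exists (s |: D); split.
- rewrite subUset sub1set inE sF sA /=; apply: subset_trans DC _.
  by apply/subsetP=> y; rewrite !inE => /and3P[_ -> ->].
- by apply/set0Pn; exists s; rewrite !inE eqxx.
- by apply: connected_star => y yD; apply/sC/(subsetP DC).
- by rewrite (leq_trans (leq_card_setU _ _)) // cards1; lia.
move=> y yA.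
have : y \notin [set y in A | [forall x in D, ~~ G x y]].
  apply/negP=> yX; move: Db; set X := [set y in A | _] in yX *.
  have X0 : 0 < #|X| by rewrite card_gt0; apply/set0Pn; exists y.
  (* [(5 / 4) ^ 4 = 625 / 256] exceeds 2, so [4 * L] rounds divide by at least [2 ^ L > #|A|]. *)
  have : 512 ^ L <= 625 ^ L by case: (posnP L) => [->|L0] //; rewrite leq_exp2r.
  rewrite !expnM -[5 ^ 4]/625 -[4 ^ 4]/256 -[512]/(256 * 2) expnMn.
  have : 0 < 256 ^ L by rewrite expn_gt0.
  nia.
rewrite inE yA /= negb_forall => /existsP[x]; rewrite negb_imply negbK => /andP[xD xy].
by exists x; rewrite // !inE xD orbT.
Qed.

(** Disjoint dominating stars chosen one after the other are pairwise adjacent bags. Together they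
    use at most [t * (4 * L + 2)] vertices, the tenth of [A] that [dominating_star] tolerates as
    forbidden. *)
Lemma dense_has_model (t L : nat) :
  #|A| < 2 ^ L -> 0 < #|A| -> 10 * (t * (4 * L + 2)) <= #|A| -> has_model t G.
Proof.
move=> AL A0 At.
suff [B [BA B0 Bc Bs [Bd Bdom]]] : exists B : nat -> {set V},
    [/\ forall i, i < t -> B i \subset A, forall i, i < t -> B i != set0,
        forall i, i < t -> connected_set G (B i),
        forall i, i < t -> #|B i| <= 4 * L + 2 &
        (forall i j, i < j < t -> [disjoint B i & B j]) /\
        (forall i, i < t -> forall y, y \in A -> exists2 x, x \in B i & G x y)].
  exists (fun i : 'I_t => B i); split=> // [i|i|i j ij|i j ij].
  - exact: B0.
  - exact: Bc.
  - have [lt|lt|eq] := ltngtP i j; first by apply: Bd; rewrite lt /=.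
      by rewrite disjoint_sym; apply: Bd; rewrite lt /=.
    by case/eqP: ij; apply: val_inj.
  - have /set0Pn[y yB] := B0 j (ltn_ord j).
    have [x xB xy] := Bdom i (ltn_ord i) y (subsetP (BA j (ltn_ord j)) y yB).
    by exists x, y.
have : t <= t by [].
(* The induction is on the number of stars only; the upper bound in [jt] and the size hypothesis on
   [A] keep the full [t]. *)
elim: {1 3 4 5 6 7 8}t => [|j IH] jt.
  by exists (fun=> set0); split=> //; split=> // i j; rewrite ltn0 andbF.
have [B [BA B0 Bc Bs [Bd Bdom]]] := IH (ltnW jt).
pose F := \bigcup_(i < j) B i.
have Fs : #|F| <= j * (4 * L + 2).
  apply: leq_trans (_ : \sum_(i < j) #|B i| <= _).
    rewrite /F; elim/big_ind2: _ => [|X m Y p Xm Yp|//]; first by rewrite cards0.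
    by apply: leq_trans (leq_card_setU _ _) _; apply: leq_add.
  have -> : j * (4 * L + 2) = \sum_(i < j) (4 * L + 2) by rewrite sum_nat_const card_ord.
  apply: leq_sum => i _.
  by apply: Bs.
have FA : 10 * #|F| <= #|A| by nia.
have [D [DF D0 Dc Ds Ddom]] := dominating_star AL A0 FA.
exists (fun i => if i == j then D else B i).
have lt i : i < j.+1 -> i != j -> i < j by rewrite ltnS ltn_neqAle => -> ->.
split=> [i ij|i ij|i ij|i ij|]; [case: (eqVneq i j) => [_|ne].. | split] .
- by apply: subset_trans DF _; apply: subsetDl.
- by apply: BA; apply: lt.
- by [].
- by apply: B0; apply: lt.
- by [].
- by apply: Bc; apply: lt.
- by [].
- by apply: Bs; apply: lt.
- move=> i k /andP[ik kj]; have nei : i != j by lia.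
  rewrite (negbTE nei); case: (eqVneq k j) => [kE|ne]; last first.
    by apply: Bd; rewrite ik lt.
  rewrite disjoints_subset; apply/subsetP=> y yB; rewrite inE.
  apply/negP=> yD; have := subsetP DF y yD; rewrite inE => /andP[/negP yF _].
  apply: yF; apply/bigcupP; have ij : i < j by lia.
  by exists (Ordinal ij).
- by move=> i ij y yA; case: (eqVneq i j) => [_|ne]; [apply: Ddom|apply: Bdom; rewrite ?lt].
Qed.

End Dense.

(** * Complete minors from dominating edges and a clique *)

Section DominatingEdges.
Variables (V : finType) (G : sgraph V) (P : {set V}) (d : nat).
Hypothesis codeg : forall x, x \in P -> #|nonadj G P x| <= d.

(* Any [b] outside the [d ^ 2] vertices at distance at most two from [a] in the
   complement forms with [a] an edge dominating [P]. *)
Lemma dominating_edge (U : {set V}) :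
  U \subset P -> d ^ 2 < #|U| ->
  exists a b, [/\ a \in U, b \in U, a != b, G a b &
                  forall x, x \in P -> G a x || G b x].
Proof.
move=> UP dU.
have /set0Pn[a aU] : U != set0 by rewrite -card_gt0; lia.
have aP := subsetP UP a aU.
pose bad := \bigcup_(c in nonadj G P a) nonadj G P c.
have cbad : #|bad| <= d ^ 2.
  apply: leq_trans (_ : \sum_(c in nonadj G P a) #|nonadj G P c| <= _).
    rewrite /bad; elim/big_ind2: _ => [|X m Y p Xm Yp|//]; first by rewrite cards0.
    by apply: leq_trans (leq_card_setU _ _) _; apply: leq_add.
  apply: leq_trans (_ : \sum_(c in nonadj G P a) d <= _).
    by apply: leq_sum => c; rewrite inE => /andP[/codeg].
  by rewrite sum_nat_const -mulnn leq_mul2r codeg // orbT.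
have /subsetPn[b bU bbad] : ~~ (U \subset bad).
  by apply: contraTN dU => /subset_leq_card; rewrite -leqNgt => /leq_trans; apply.
have bP := subsetP UP b bU.
have adj c : c \in P -> ~~ G a c -> G c b.
  move=> cP ac; apply: contraNT bbad => cb; apply/bigcupP; exists c; by rewrite !inE ?cP ?bP.
have ab : G a b by apply: adj => //; rewrite edge_irr.
exists a, b; split=> // [|x xP]; first by apply: contraTneq ab => ->; rewrite edge_irr.
by case: (boolP (G a x)) => //= /(adj _ xP); rewrite edge_sym.
Qed.

Definition ends (e : V * V) : seq V := [:: e.1; e.2].

Lemma dominating_matching (W : {set V}) (p : nat) :
  W \subset P -> (0 < p -> 2 * p + d ^ 2 <= #|P| - #|W|) ->
  exists s : seq (V * V),
    [/\ size s = p, uniq (flatten (map ends s)),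
        {in flatten (map ends s), forall x, x \in P :\: W} &
        {in s, forall e, G e.1 e.2 /\ forall x, x \in P -> G e.1 x || G e.2 x}].
Proof.
move=> WP; elim: p => [|p IH] pd; first by exists [::].
have [|s [sp us sPW sdom]] := IH; first by have := pd isT; lia.
set F := flatten _ in us sPW.
have Fs : size F = 2 * p.
  by rewrite -sp /F; elim: (s) => //= e l ->; lia.
have cPW : #|P :\: W| = #|P| - #|W| by rewrite cardsD (setIidPr WP).
pose U := (P :\: W) :\: [set x in F].
have cF : #|[set x in F]| = 2 * p.
  by rewrite -Fs -(card_uniqP us); apply: eq_card => x; rewrite inE.
have cU : #|P| - #|W| - 2 * p <= #|U|.
  by rewrite cardsD cPW leq_sub2l // -cF subset_leq_card // subsetIr.
have UP : U \subset P by apply/subsetP=> x; rewrite !inE => /and3P[].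
have [|a [b [aU bU ab Gab dom]]] := dominating_edge UP; first by have := pd isT; lia.
exists ((a, b) :: s); split=> /=; first by rewrite sp.
- have nF x : x \in U -> x \notin F by rewrite !inE => /and3P[].
  by apply/and3P; split; rewrite ?us // ?nF // inE negb_or ab nF.
- move=> x; rewrite 2!inE => /or3P[/eqP->|/eqP->|/sPW//].
    by move: aU; rewrite inE => /andP[].
  by move: bU; rewrite inE => /andP[].
- by move=> e; rewrite inE => /predU1P[->|/sdom].
Qed.

Lemma uniq_flatten_nth (T : eqType) (ss : seq (seq T)) (i j : nat) (x : T) :
  uniq (flatten ss) -> x \in nth [::] ss i -> x \in nth [::] ss j -> i = j.
Proof.
elim: ss i j => [|s ss IH] [|i] [|j] //=; rewrite cat_uniq => /and3P[_ /hasPn dis us].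
- move=> xs xj; have /dis : x \in flatten ss.
    apply/flattenP; exists (nth [::] ss j) => //; apply: mem_nth.
    by rewrite ltnNge; apply: contraTN xj => le; rewrite nth_default.
  by rewrite /= xs.
- move=> xi xs; have /dis : x \in flatten ss.
    apply/flattenP; exists (nth [::] ss i) => //; apply: mem_nth.
    by rewrite ltnNge; apply: contraTN xi => le; rewrite nth_default.
  by rewrite /= xs.
- by move=> xi xj; congr S; apply: IH xi xj.
Qed.

(** If [#|W| < t], the clique gives [#|W|] singleton bags and leaves [t - #|W|] edges to find;
    [2 * (t - #|W|) + d ^ 2 <= #|P| - #|W|] is the hypothesis rearranged. *)
Lemma pairs_has_model (W : {set V}) (t : nat) :
  W \subset P -> clique G W -> 2 * t + d ^ 2 <= #|P| + #|W| -> has_model t G.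
Proof.
move=> WP Wcl tPW.
pose q := minn #|W| t.
have [|s [sp us sPW sdom]] := @dominating_matching W (t - q) WP.
  by have := subset_leq_card WP; rewrite /q; lia.
pose ws := take q (enum W).
have wsW x : x \in ws -> x \in W by move/mem_take; rewrite mem_enum.
have wss : size ws = q.
  by rewrite size_takel // -cardE geq_minl.
pose bs := map ends s ++ [seq [:: w] | w <- ws].
have bss : size bs = t by rewrite size_cat !size_map sp wss subnK // geq_minr.
have flat1 : flatten [seq [:: w] | w <- ws] = ws by elim: (ws) => //= x l ->.
have ubs : uniq (flatten bs).
  rewrite flatten_cat flat1 cat_uniq us take_uniq ?enum_uniq // andbT /=.
  by apply/hasPn=> x /wsW xW; apply/negP=> /sPW; rewrite inE xW.
have bsP x b : b \in bs -> x \in b -> x \in P.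
  move=> bbs xb; have : x \in flatten bs by apply/flattenP; exists b.
  rewrite flatten_cat flat1 mem_cat => /orP[/sPW|/wsW/(subsetP WP)//].
  by rewrite inE => /andP[].
have kind b : b \in bs ->
    (exists2 e, e \in s & b = ends e) \/ (exists2 w, w \in W & b = [:: w]).
  rewrite mem_cat => /orP[/mapP[e es ->]|/mapP[w /wsW wW ->]].
    by left; exists e.
  by right; exists w.
have mem_bs (i : 'I_t) : nth [::] bs i \in bs by rewrite mem_nth // bss.
have nonempty (i : 'I_t) : exists x, x \in nth [::] bs i.
  case: (kind _ (mem_bs i)) => [[e _ ->]|[w _ ->]].
    by exists e.1; rewrite inE eqxx.
  by exists w; rewrite inE.
exists (fun i : 'I_t => [set x in nth [::] bs i]); split.
- by move=> i; have [x xi] := nonempty i; apply/set0Pn; exists x; rewrite inE.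
- move=> i; case: (kind _ (mem_bs i)) => [[e es ->]|[w _ ->]].
    have -> : [set x in ends e] = e.1 |: [set e.2].
      by apply/setP=> x; rewrite !inE.
    by apply: connected_star => x; rewrite inE => /eqP->; case: (sdom _ es).
  have -> : [set x in [:: w]] = [set w] by apply/setP=> x; rewrite !inE.
  exact: connected_set1.
- move=> i j ij; rewrite disjoints_subset; apply/subsetP=> x; rewrite !inE => xi.
  by apply: contraNN ij => xj; apply/eqP/val_inj; apply: uniq_flatten_nth ubs xi xj.
- have dominated e (j : 'I_t) : e \in s ->
      exists x y, [/\ x \in ends e, y \in nth [::] bs j & G x y].
    move=> es; have [y yj] := nonempty j.
    have [_ /(_ y (bsP _ _ (mem_bs j) yj)) /orP[xy|xy]] := sdom _ es.
      by exists e.1, y; rewrite !inE eqxx.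
    by exists e.2, y; rewrite !inE eqxx orbT.
  move=> i j ij; case: (kind _ (mem_bs i)) => [[e es ei]|[w wW wi]].
    have [x [y [xe yj xy]]] := dominated e j es.
    by exists x, y; rewrite !inE ei.
  case: (kind _ (mem_bs j)) => [[e es ej]|[z zW zj]].
    have [x [y [xe yj xy]]] := dominated e i es.
    by exists y, x; rewrite !inE ej edge_sym.
  exists w, z; rewrite !inE wi zj !inE; split=> //.
  have wz : w != z.
    apply: contraNneq ij => wz; apply/eqP/val_inj.
    by apply: (uniq_flatten_nth (x := w) ubs); rewrite ?wi ?zj inE ?wz.
  by have /forall_inP/(_ w wW)/forall_inP/(_ z zW)/implyP := Wcl; apply.
Qed.

End DominatingEdges.

(** * Linear edge bound for minor-free graphs *)

Definition nbrs (V : finType) (G : sgraph V) (x : V) : {set V} := [set y | G x y].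

(** Ordered pairs count each edge twice, so that degree sums need no halving. *)
Definition arcs (V : finType) (G : sgraph V) : {set V * V} := [set p | G p.1 p.2].

Lemma card_arcs (V : finType) (G : sgraph V) : #|arcs G| = \sum_x #|nbrs G x|.
Proof.
under eq_bigr do rewrite -sum1_card.
rewrite pair_big_dep /= -sum1_card; apply: eq_bigl => -[x y].
by rewrite !inE.
Qed.

Lemma min_degree (V : finType) (G : sgraph V) :
  0 < #|V| -> exists v, #|nbrs G v| * #|V| <= #|arcs G|.
Proof.
move=> /card_gt0P[v0 _].
case: (@arg_minnP _ v0 predT (fun x => #|nbrs G x|)) => // v _ vmin.
exists v; rewrite card_arcs mulnC -sum_nat_const.
rewrite [X in X <= _](_ : _ = \sum_(x : V) #|nbrs G v|); last exact: eq_bigl.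
by apply: leq_sum => x _; apply: vmin.
Qed.

Lemma card_del (V : finType) (y : V) : #|{: {z : V | z != y}}| = #|V|.-1.
Proof. by rewrite card_sig -(cardC1 y); apply: eq_card => z; rewrite !inE. Qed.

Lemma arcs_del_edge (V : finType) (G : sgraph V) (x y : V) : G x y ->
  #|arcs G| = (#|arcs (del_edge G x y)| + 2)%N.
Proof.
move=> xy; have xny : x != y by apply: contraTneq xy => ->; rewrite edge_irr.
have c2 : #|[set (x, y); (y, x)]| = 2.
  by rewrite cards2 xpair_eqE (negbTE xny).
rewrite -c2 -(cardsID [set (x, y); (y, x)] (arcs G)) addnC; congr (_ + _).
  apply: eq_card => -[u v]; rewrite !inE /= /del_edge_rel !xpair_eqE.
  rewrite andbC; congr (_ && ~~ _).
  apply/idP/idP => [/orP[]/andP[/eqP-> /eqP->]|/eqP uv].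
  + by rewrite eqxx.
  + by rewrite finset.setUC.
  have : u \in [set x; y] by rewrite -uv !inE eqxx.
  have : v \in [set x; y] by rewrite -uv !inE eqxx orbT.
  have : x \in [set u; v] by rewrite uv !inE eqxx.
  have : y \in [set u; v] by rewrite uv !inE eqxx orbT.
  rewrite !inE => yuv xuv /orP[/eqP vx|/eqP vy] /orP[/eqP ux|/eqP uy].
  + by move: yuv; rewrite vx ux orbb eq_sym (negbTE xny).
  + by rewrite vx uy !eqxx orbT.
  + by rewrite ux vy !eqxx.
  + by move: xuv; rewrite vy uy orbb (negbTE xny).
apply: eq_card => -[u v]; rewrite !inE /= !xpair_eqE andbC.
case: (boolP (_ || _)) => //= /orP[]/andP[/eqP-> /eqP->] //.
by rewrite edge_sym.
Qed.

Lemma arcs_del_vertex (V : finType) (G : sgraph V) (x : V) :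
  nbrs G x = set0 -> #|arcs G| = #|arcs (del_vertex G x)|.
Proof.
move=> x0; have xN u : G x u = false.
  by have /setP/(_ u) := x0; rewrite !inE.
have inj : injective (fun p : {z : V | z != x} * {z : V | z != x} => (val p.1, val p.2)).
  by move=> [a b] [c d] /= [/val_inj-> /val_inj->].
rewrite -(card_imset _ inj); apply: eq_card => -[u v].
apply/idP/imsetP => [|[[a b] + ->]]; last by rewrite !inE.
rewrite inE /= => uv.
have ux : u != x by apply: contraTneq uv => ->; rewrite xN.
have vx : v != x by apply: contraTneq uv => ->; rewrite edge_sym xN.
by exists (Sub u ux, Sub v vx); rewrite ?inE.
Qed.

(** Contracting [xy] destroys the two arcs of [xy] itself, and each common neighbour [z] merges [yz]
    with [xz], which costs two arcs more. *)
Lemma arcs_contract (V : finType) (G : sgraph V) (x y : V) : G x y ->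
  #|arcs G| <= #|arcs (contract G x y)| + 2 * #|nbrs G x :&: nbrs G y|.+1.
Proof.
move=> xy; have xny : x != y by apply: contraTneq xy => ->; rewrite edge_irr.
pose C := nbrs G x :&: nbrs G y.
pose lost := [set (x, y); (y, x)] :|: (pair y @: C :|: (fun z => (z, y)) @: C).
have clost : #|lost| <= 2 * #|C|.+1.
  have h1 := leq_card_setU [set (x, y); (y, x)] (pair y @: C :|: (fun z => (z, y)) @: C).
  have h2 := leq_card_setU (pair y @: C) ((fun z => (z, y)) @: C).
  have h3 := leq_imset_card (pair y) C.
  have h4 := leq_imset_card (fun z => (z, y)) C.
  have h5 : #|[set (x, y); (y, x)]| <= 2 by rewrite cards2; case: eqP.
  apply: leq_trans h1 _; rewrite (_ : 2 * _ = 2 + (#|C| + #|C|)); last by lia.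
  by apply: leq_add => //; apply: leq_trans h2 _; apply: leq_add.
pose x' : {z : V | z != y} := Sub x xny.
pose r z : {z : V | z != y} := insubd x' z.
have valr z : val (r z) = if z == y then x else z.
  by rewrite val_insubd; case: (z =P y).
have kept u v : (u, v) \in arcs G :\: lost ->
  [/\ G u v, u = y -> v != x /\ ~~ G x v & v = y -> u != x /\ ~~ G x u].
  rewrite inE => /andP[+ uv]; rewrite [_ \in arcs G]inE /= in uv.
  rewrite !inE !negb_or => /and3P[/andP[n1 n2] n3 n4].
  split=> // e; move: uv n1 n2 n3 n4; rewrite {}e => uv n1 n2 n3 n4.
    have vx : v != x by apply: contraNneq n2 => ->.
    split=> //; apply: contraNN n3 => xv; apply/imsetP; exists v => //.
    by rewrite !inE xv uv.
  have ux : u != x by apply: contraNneq n1 => ->.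
  split=> //; apply: contraNN n4 => xu; apply/imsetP; exists u => //.
  by rewrite !inE xu edge_sym uv.
rewrite -(cardsID lost (arcs G)) addnC leq_add //; last first.
  by apply: leq_trans clost; rewrite subset_leq_card // subsetIr.
pose f (p : V * V) := (r p.1, r p.2).
(* Distinct surviving arcs can have the same image only if one has an end [y] where the other has
   [x]; then the far end is a common neighbour and the arc at [y] was put in [lost]. *)
have finj : {in arcs G :\: lost &, injective f}.
{ move=> [u v] [u' v'] /kept[uv ku kv] /kept[uv' ku' kv'] /= [].
  move=> /(congr1 val) + /(congr1 val); rewrite !valr.
  case: (u =P y) => [uy|_]; case: (u' =P y) => [uy'|_];
    case: (v =P y) => [vy|_]; case: (v' =P y) => [vy'|_] eu ev;
    rewrite ?uy ?uy' ?vy ?vy' -?eu ?ev //.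
  all: try by rewrite ?uy ?vy ?uy' ?vy' edge_irr in uv uv'.
  all: exfalso.
  all: try by have [/eqP] := ku uy; rewrite ev.
  all: try by have [/eqP] := ku' uy'; rewrite -ev.
  all: try by have [/eqP] := kv vy; rewrite eu.
  all: try by have [/eqP] := kv' vy'; rewrite -eu.
  all: try by have [_ /negP[]] := ku uy; rewrite ev eu.
  all: try by have [_ /negP[]] := ku' uy'; rewrite -ev -eu.
  all: try by have [_ /negP[]] := kv vy; rewrite eu ev edge_sym.
  all: try by have [_ /negP[]] := kv' vy'; rewrite -eu -ev edge_sym. }
have <- : #|f @: (arcs G :\: lost)| = #|arcs G :\: lost| by apply: card_in_imset.
apply/subset_leq_card/subsetP=> _ /imsetP[[u v] /kept[uv ku kv] ->].
rewrite inE /= /contract_rel !valr -val_eqE /= !valr.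
case: (u =P y) => [uy|_]; case: (v =P y) => [vy|_].
- by rewrite uy vy edge_irr in uv.
- have [vx _] := ku uy; rewrite eq_sym vx eqxx /=; rewrite uy in uv.
  by rewrite uv orbT.
- have [ux _] := kv vy; rewrite ux eqxx /=; rewrite vy edge_sym in uv.
  by rewrite uv !orbT.
- rewrite uv andbT; by apply: contraTneq uv => ->; rewrite edge_irr.
Qed.

(** The graphs where the descent stops. Deleting an edge would break the bound, so it is nearly
    tight; contracting would break it too, so every edge has roughly
    [(phi m - phi (m - 1)) / (2 * a)] common neighbours or more. *)
Definition descent_minimal (a : nat) (phi : nat -> nat) (V : finType) (G : sgraph V) : Prop :=
  [/\ phi #|V| <= a * #|arcs G| < phi #|V| + 2 * a,
      1 < #|V|,
      forall x y, G x y ->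
        phi #|V| < phi #|V|.-1 + 2 * a * #|nbrs G x :&: nbrs G y|.+1
    & forall x, nbrs G x != set0].

(* Contract, delete edges and delete isolated vertices for as long as the lower
   bound on the number of edges given by [phi] survives. *)
Lemma density_descent (t a : nat) (phi : nat -> nat) :
    {homo phi : m n / m <= n} -> (forall m, 0 < m -> 0 < phi m) ->
    (forall (V : finType) (G : sgraph V), descent_minimal a phi G -> has_model t G) ->
  forall (V : finType) (G : sgraph V),
    0 < #|V| -> phi #|V| <= a * #|arcs G| -> has_model t G.
Proof.
move=> phi_le phi_gt0 base V G.
(* Lexicographic induction: contraction and vertex deletion lower the number of vertices, edge
   deletion lowers the number of arcs on the same vertices. *)
have [k] := ubnP #|V|; elim: k => // k IHV in V G *.
have [l] := ubnP #|arcs G|; elim: l => // l IHE in G *; rewrite !ltnS => El Vk V0 aG.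
have V1 : 1 < #|V|.
  have /card_gt0P[[x y]] : 0 < #|arcs G| by have := phi_gt0 _ V0; nia.
  rewrite inE /= => xy; apply/card_gt1P; exists x, y; split=> //.
  by apply: contraTneq xy => ->; rewrite edge_irr.
have V'0 : 0 < #|V|.-1 by lia.
have phi' : phi #|V|.-1 <= phi #|V| by apply: phi_le; apply: leq_pred.
have [/existsP[x /existsP[y /andP[xy xyc]]]|noc] :=
  boolP [exists x, exists y, G x y &&
    (phi #|V|.-1 + 2 * a * #|nbrs G x :&: nbrs G y|.+1 <= phi #|V|)].
  apply: model_of_minor; apply: (minor_contract xy); apply: minor_of_model.
  have ac := arcs_contract xy.
  by apply: IHV; rewrite card_del //; nia.
have [/existsP[x /existsP[y /andP[xy xyc]]]|nod] :=
  boolP [exists x, exists y, G x y && (phi #|V| + 2 * a <= a * #|arcs G|)].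
  apply: model_of_minor; apply: (minor_del_edge xy); apply: minor_of_model.
  have ad := arcs_del_edge xy.
  by apply: IHE => //; nia.
have [/existsP[x /eqP x0]|noi] := boolP [exists x, nbrs G x == set0].
  apply: model_of_minor; apply: (minor_del_vertex (x := x)); apply: minor_of_model.
  by apply: IHV; rewrite card_del // -?(arcs_del_vertex x0); nia.
apply: base; split=> //.
- rewrite aG /= ltnNge; apply/negP=> h.
  have /card_gt0P[[x y]] : 0 < #|arcs G| by have := phi_gt0 _ V0; nia.
  rewrite inE /= => xy; case/negP: nod; apply/existsP; exists x.
  by apply/existsP; exists y; rewrite xy.
- move=> x y xy; rewrite ltnNge; apply/negP=> h; case/negP: noc.
  by apply/existsP; exists x; apply/existsP; exists y; rewrite xy.
- by move=> x; apply: contra noi => x0; apply/existsP; exists x.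
Qed.

Lemma isqrt (s : nat) : exists r, r ^ 2 <= s < r.+1 ^ 2.
Proof.
elim: s => [|s [r /andP[rs sr]]]; first by exists 0.
have [lt|ge] := ltnP s.+1 (r.+1 ^ 2); first by exists r; rewrite lt andbT; lia.
by exists r.+1; rewrite ge /=; nia.
Qed.

Lemma codeg_nbrs (V : finType) (G : sgraph V) (v x : V) :
  #|nonadj G (nbrs G v) x| + #|nbrs G v :&: nbrs G x| = #|nbrs G v|.
Proof.
rewrite -(cardsID (nbrs G x) (nbrs G v)) addnC; congr (_ + _).
by apply: eq_card => y; rewrite !inE andbC.
Qed.

Lemma arcs_le (V : finType) (G : sgraph V) : #|arcs G| <= #|V| * #|V|.-1.
Proof.
rewrite card_arcs -sum_nat_const; apply: leq_sum => x _.
rewrite -(cardC1 x); apply/subset_leq_card/subsetP=> y; rewrite !inE => xy.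
by apply: contraTneq xy => ->; rewrite edge_irr.
Qed.

(** At a minimal graph on [m] vertices an edge has at least about [(2 * m + h) / 8] common
    neighbours, while the minimum degree [s] is at most about [(m + h) / 4]. Since [h < 3 * m],
    vertices of the neighbourhood of [v] miss at most 2/5 of it, and [dense_has_model] applies
    inside. *)
Lemma half_dense_has_model (t h : nat) (V : finType) (G : sgraph V) :
  0 < t -> 5 * (100 * t) ^ 2 <= h -> 0 < #|V| -> #|V| * (#|V| + h) <= 4 * #|arcs G| ->
  has_model t G.
Proof.
move=> t0 th; apply: (@density_descent t 4 (fun m => m * (m + h))).
- by move=> m n mn /=; nia.
- by move=> m m0 /=; nia.
move=> {}V {}G [/andP[lo up] V1 con noi].
have V0 : 0 < #|V| by lia.
have [v vmin] := min_degree G V0.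
have /set0Pn[x xv] := noi v.
set m := #|V| in lo up V1 con V0 vmin *.
have al := arcs_le G; rewrite -/m in al.
have mh : h + 4 <= 3 * m by nia.
set s := #|nbrs G v| in vmin *.
have sm : 4 * s <= m + h + 7 by nia.
have co y : y \in nbrs G v -> 2 * m + h <= 8 * #|nbrs G v :&: nbrs G y|.+1.
  by rewrite inE => /con; nia.
have cos y : y \in nbrs G v -> #|nbrs G v :&: nbrs G y| < s.
  move=> yv; rewrite -[s](codeg_nbrs G v y) -[X in X < _]add0n ltn_add2r card_gt0.
  by apply/set0Pn; exists y; rewrite inE yv edge_irr.
have x100 : 100 <= 100 * t by lia.
have h3 : 400 <= h by rewrite -mulnn in th; nia.
have s_big : (100 * t) ^ 2 <= s by have := co _ xv; have := cos _ xv; lia.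
(* [L = 2 * r] will do: [s < (r + 1) ^ 2 <= 2 ^ L], and [10 * t * (8 * r + 2) <= 100 * t * r <= r ^
   2 <= s]. *)
have [r /andP[rs sr]] := isqrt s.
have rt : 100 * t <= r by nia.
apply: (@dense_has_model V G (nbrs G v) _ t (2 * r)).
- move=> y yv; have := codeg_nbrs G v y; have := co _ yv; rewrite -/s; lia.
- apply: leq_trans sr _; rewrite mulnC expnM leq_exp2r //; exact: ltn_expl.
- by rewrite -/s; lia.
- rewrite -/s; apply: leq_trans rs; rewrite -mulnn.
  apply: leq_trans (_ : (100 * t) * r <= _); last by rewrite leq_mul2r rt orbT.
  by clear -t0 rt; nia.
Qed.

(** Minimality for a linear [phi] gives a vertex of degree at most [2 * k], each of whose edges has
    at least [k] common neighbours. Inside its neighbourhood every degree is then at least half the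
    order, which is [half_dense_has_model] with [h] equal to that order. *)
Lemma few_arcs (t : nat) (V : finType) (G : sgraph V) :
  ~ has_model t G -> 0 < #|V| -> #|arcs G| < 10 * (100 * t) ^ 2 * #|V|.
Proof.
move=> nom V0.
have t0 : 0 < t.
  by case: (posnP t) nom => // -> []; exists (fun=> set0); split; case.
pose k := 5 * (100 * t) ^ 2.
have -> : 10 * (100 * t) ^ 2 = 2 * k by rewrite /k mulnA.
rewrite ltnNge; apply/negP=> many; apply: nom.
apply: (@density_descent t 1 (fun m => 2 * k * m)) V0 _; rewrite ?mul1n //.
- by move=> m n mn /=; nia.
- by move=> m m0 /=; rewrite /k; nia.
move=> W K [/andP[_ up] W1 con noi].
have W0 : 0 < #|W| by lia.
have [v vmin] := min_degree K W0.
have /set0Pn[x xv] := noi v.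
have v2k : #|nbrs K v| <= 2 * k by nia.
have co y : y \in nbrs K v -> k <= #|nbrs K v :&: nbrs K y|.
  by rewrite inE => /con; nia.
apply: (@has_model_induced t W K (nbrs K v)).
have cA : #|{: {z : W | z \in nbrs K v}}| = #|nbrs K v|.
  by rewrite card_sig; apply: eq_card => z; rewrite !inE.
have kA : k <= #|nbrs K v| by apply: leq_trans (co _ xv) _; rewrite subset_leq_card // subsetIl.
apply: (@half_dense_has_model t #|nbrs K v|) => //.
  by rewrite cA; apply/card_gt0P; exists x.
rewrite cA card_arcs.
have : \sum_(x : {z : W | z \in nbrs K v}) k <=
       \sum_x #|nbrs (induced K (nbrs K v)) x|.
  apply: leq_sum => -[y yv] _; apply: leq_trans (co _ yv) _.
  rewrite -(card_imset _ val_inj); apply/subset_leq_card/subsetP=> z.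
  rewrite inE => /andP[zv yz]; apply/imsetP; exists (Sub z zv) => //.
  by rewrite inE /= /induced_rel /=; rewrite inE in yz.
by rewrite sum_nat_const -/(#|_|) cA; nia.
Qed.

(** Degeneracy: the minimum degree of the induced graph is at most its mean, below
    [10 * (100 * t) ^ 2], which is rounded up to the square of [400 * t]. *)
Lemma sparse_vertex (t : nat) (V : finType) (G : sgraph V) (S : {set V}) :
  ~ has_model t G -> S != set0 -> exists2 v, v \in S & #|nbrs G v :&: S| <= (400 * t) ^ 2.
Proof.
move=> nom /set0Pn[v0 v0S]; pose H := induced G S.
have H0 : 0 < #|{: {z : V | z \in S}}| by rewrite card_sig; apply/card_gt0P; exists v0.
have few := few_arcs (fun m => nom (has_model_induced m)) H0 : #|arcs H| < _.
have [[v vS] vmin] := min_degree H H0.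
exists v => //.
have -> : #|nbrs G v :&: S| = #|nbrs H (Sub v vS)|.
  rewrite -(card_imset _ val_inj); apply: eq_card => z; rewrite !inE.
  apply/andP/imsetP => [[vz zS]|[[w wS] + ->]].
    by exists (Sub z zS) => //; rewrite inE.
  by rewrite inE /= /induced_rel /= => ->.
have d2k : #|nbrs H (Sub v vS)| < 10 * (100 * t) ^ 2.
  by rewrite -(ltn_pmul2r H0); apply: leq_ltn_trans vmin few.
have -> : 400 * t = 4 * (100 * t) by lia.
by rewrite expnMn; lia.
Qed.

(** * Counting maximal cliques *)

Section CountMaxCliques.
Variables (V : finType) (G : sgraph V).

Definition max_clique_in (P C : {set V}) : bool :=
  [&& C \subset P, clique G C &
      [forall x in P, [forall y in C, G x y] ==> (x \in C)]].

Lemma cliqueP (C : {set V}) :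
  reflect {in C &, forall x y, x != y -> G x y} (clique G C).
Proof.
apply: (iffP forall_inP) => [h x y xC yC xy|h x xC].
  by have /forall_inP/(_ y yC)/implyP := h x xC; apply.
by apply/forall_inP=> y yC; apply/implyP; apply: h.
Qed.

Lemma max_clique_inP (P C : {set V}) :
  reflect [/\ C \subset P, {in C &, forall x y, x != y -> G x y} &
              forall x, x \in P -> {in C, forall y, G x y} -> x \in C]
          (max_clique_in P C).
Proof.
apply: (iffP and3P) => [[CP /cliqueP Cc /forall_inP Cm]|[CP Cc Cm]]; split=> //.
- move=> x xP xC; have /implyP := Cm x xP; apply.
  by apply/forall_inP.
- exact/cliqueP.
- by apply/forall_inP=> x xP; apply/implyP=> /forall_inP; apply: Cm.
Qed.

Definition n_max_cliques (P : {set V}) : nat := #|[set C | max_clique_in P C]|.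

Lemma n_max_cliques0 : n_max_cliques set0 <= 1.
Proof.
rewrite -(cards1 (set0 : {set V})); apply/subset_leq_card/subsetP=> C.
by rewrite !inE => /and3P[]; rewrite subset0.
Qed.

Lemma max_clique_without (P C : {set V}) (u : V) :
  max_clique_in P C -> u \notin C -> max_clique_in (P :\ u) C.
Proof.
move=> /max_clique_inP[CP Cc Cm] uC; apply/max_clique_inP; split=> //.
  apply/subsetP=> x xC; rewrite !inE (subsetP CP) // andbT.
  by apply: contraNneq uC => <-.
by move=> x; rewrite inE => /andP[_ xP]; apply: Cm.
Qed.

Lemma max_clique_with (P C : {set V}) (u : V) :
  max_clique_in P C -> u \in C -> max_clique_in (P :&: nbrs G u) (C :\ u).
Proof.
move=> /max_clique_inP[CP Cc Cm] uC; apply/max_clique_inP; split.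
- apply/subsetP=> x; rewrite !inE => /andP[xu xC].
  by rewrite (subsetP CP) // Cc // eq_sym.
- by move=> x y; rewrite !inE => /andP[_ xC] /andP[_ yC]; apply: Cc.
- move=> x; rewrite !inE => /andP[xP ux] xC.
  have xu : x != u by apply: contraTneq ux => ->; rewrite edge_irr.
  rewrite xu; apply: Cm => // y yC; have [->|yu] := eqVneq y u; first by rewrite edge_sym.
  by apply: xC; rewrite !inE yu.
Qed.

Lemma n_max_cliques_with (P : {set V}) (u : V) :
  #|[set C | max_clique_in P C & u \in C]| <= n_max_cliques (P :&: nbrs G u).
Proof.
have inj : {in [set C | max_clique_in P C & u \in C] &, injective (fun C => C :\ u)}.
  by move=> C D; rewrite !inE => /andP[_ uC] /andP[_ uD] CD; rewrite -(setD1K uC) CD setD1K.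
rewrite -(card_in_imset inj); apply/subset_leq_card/subsetP=> _ /imsetP[C + ->].
by rewrite !inE => /andP[]; apply: max_clique_with.
Qed.

Lemma n_max_cliques_binary (P : {set V}) (u : V) :
  n_max_cliques P <= n_max_cliques (P :\ u) + n_max_cliques (P :&: nbrs G u).
Proof.
rewrite /n_max_cliques -(cardsID [set C : {set V} | u \in C]) addnC; apply: leq_add.
  apply/subset_leq_card/subsetP=> C; rewrite !inE => /andP[uC].
  by move=> /max_clique_without; apply.
apply: leq_trans (n_max_cliques_with P u).
by apply/subset_leq_card/subsetP=> C; rewrite !inE.
Qed.

(* A maximal clique contains [v] or a non-neighbour of [v]. *)
Lemma n_max_cliques_pivot (P : {set V}) (v : V) : v \in P ->
  n_max_cliques P <= \sum_(u in nonadj G P v) n_max_cliques (P :&: nbrs G u).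
Proof.
move=> vP; apply: leq_trans (_ : \sum_(u in nonadj G P v)
    #|[set C | max_clique_in P C & u \in C]| <= _); last first.
  by apply: leq_sum => u _; apply: n_max_cliques_with.
apply: leq_trans (_ : #|\bigcup_(u in nonadj G P v) [set C | max_clique_in P C & u \in C]| <= _).
  apply/subset_leq_card/subsetP=> C; rewrite inE => PC.
  have /max_clique_inP[CP Cc Cm] := PC.
  have [/existsP[u /andP[uC vu]]|none] := boolP [exists u, (u \in C) && ~~ G v u].
    by apply/bigcupP; exists u; rewrite !inE ?PC // (subsetP CP).
  have vC : v \in C.
    apply: Cm => // y yC; apply: contraNT none => vy.
    by apply/existsP; exists y; rewrite yC.
  case/existsP: none; exists v; by rewrite vC edge_irr.
elim/big_ind2: _ => [|X m Y p Xm Yp|//]; first by rewrite cards0.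
by apply: leq_trans (leq_card_setU _ _) _; apply: leq_add.
Qed.

(** Base 4 and exponent 5 meet here: equality holds at [d = 3], that is four branches. Beyond it the
    left side grows by a factor below 4 in each step. *)
Lemma succ_exp5_le (d : nat) : d.+1 ^ 5 <= 4 ^ d.+2.
Proof.
case: (leqP d 3) => [|d4]; first by move: d => [|[|[|[]]]].
elim: d d4 => // d IH; rewrite ltnS leq_eqVlt => /predU1P[<-//|/[dup] d4 /IH {}IH].
rewrite [4 ^ _]expnS; apply: leq_trans (_ : 4 * d.+1 ^ 5 <= _); last by rewrite leq_mul2l.
have h1 : 4 * d.+2 <= 5 * d.+1 by lia.
have h2 : 5 * (d.+2 * d.+2) <= 8 * (d.+1 * d.+1) by nia.
have := leq_mul h1 (leq_mul h2 h2); rewrite !expnS expn0; lia.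
Qed.

(** Inductive step of both branching counts, with [N = #|P|] and [j + 1] neighbour branches still
    allowed: deleting [u] keeps the allowance, restricting to its neighbours spends one unit. *)
Lemma expn_binary_growth (N j : nat) : N ^ j.+1 + N ^ j <= N.+1 ^ j.+1.
Proof.
rewrite !expnS addnC -mulSn leq_mul2l.
by case: (posnP j) => [->//|j0]; rewrite leq_exp2r // leqnSn orbT.
Qed.

(** Less than 3/5 of [N] is kept and [(3/5) ^ 2 < 1/2], so the binary logarithm of the square bounds
    the number of neighbour branches. *)
Lemma sqr_shrink (a b N : nat) : b + a = N -> 2 * N < 5 * b -> 2 * a ^ 2 <= N ^ 2.
Proof. by move=> <- h; rewrite -!mulnn; nia. Qed.

Lemma card_nonadj (P : {set V}) (u : V) :
  #|nonadj G P u| + #|P :&: nbrs G u| = #|P|.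
Proof.
rewrite -(cardsID (nbrs G u) P) addnC; congr (_ + _).
by apply: eq_card => y; rewrite !inE andbC.
Qed.

(** Pivot on a vertex [v] with the fewest non-neighbours, say [d + 1]. Every non-neighbour [u] of
    [v] has at least as many, so restricting to its neighbours loses at least [d + 1] vertices;
    cliques there extend by [u], which lowers [w] by one. *)
Lemma n_max_cliques_exp5 (P : {set V}) (w : nat) :
  (forall W : {set V}, W \subset P -> clique G W -> #|W| <= w) ->
  n_max_cliques P ^ 5 <= 4 ^ (#|P| + w).
Proof.
have [n] := ubnP #|P|; elim: n => // n IH in P w *; rewrite ltnS => Pn wP.
have [->|/set0Pn[v0 v0P]] := eqVneq P set0.
  apply: (@leq_trans 1); last by rewrite expn_gt0.
  by rewrite -[1](exp1n 5) leq_exp2r // n_max_cliques0.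
case: (@arg_minnP _ v0 (mem P) (fun x => #|nonadj G P x|)) => // v.
rewrite -[mem P v]/(v \in P) => vP vmin.
have vN : v \in nonadj G P v by rewrite inE vP edge_irr.
case: (@arg_maxnP _ v (mem (nonadj G P v)) (fun u => n_max_cliques (P :&: nbrs G u)) vN).
move=> u; rewrite -[mem _ u]/(u \in nonadj G P v) => uv umax; have uP : u \in P by move: uv; rewrite inE => /andP[].
have d0 : 0 < #|nonadj G P v| by apply/card_gt0P; exists u.
have w0 : 0 < w.
  apply: leq_trans (wP [set u] _ _); rewrite ?cards1 ?sub1set //.
  by apply/cliqueP=> x y; rewrite !inE => /eqP-> /eqP->; rewrite eqxx.
have cP := card_nonadj P u.
have vu := vmin u uP.
have small : n_max_cliques (P :&: nbrs G u) ^ 5 <= 4 ^ (#|P :&: nbrs G u| + w.-1).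
  apply: IH => [|W WP Wc]; first by lia.
  have uW : u \notin W.
    by apply/negP=> /(subsetP WP); rewrite !inE edge_irr andbF.
  rewrite -ltnS prednK // -[X in X <= _]add1n.
  have -> : 1 + #|W| = #|u |: W| by rewrite cardsU1 uW.
  apply: wP.
    by rewrite subUset sub1set uP (subset_trans WP) // subsetIl.
  have uN x : x \in W -> G u x by move/(subsetP WP); rewrite !inE => /andP[].
  apply/cliqueP=> x y; rewrite !inE => /predU1P[->|xW] /predU1P[->|yW].
  - by rewrite eqxx.
  - by rewrite uN.
  - by rewrite edge_sym uN.
  - by move: Wc => /cliqueP; apply.
apply: leq_trans (_ : (#|nonadj G P v| * n_max_cliques (P :&: nbrs G u)) ^ 5 <= _).
  rewrite leq_exp2r //; apply: leq_trans (n_max_cliques_pivot vP) _.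
  by rewrite -sum_nat_const; apply: leq_sum => x xv; apply: umax.
rewrite expnMn.
case E: #|nonadj G P v| d0 => [|d] // _.
(* The fifth power of the [d + 1] branches is paid by the [d + 2] units by which [#|P| + w] has
   dropped. *)
apply: leq_trans (leq_mul (succ_exp5_le d) small) _.
by rewrite -expnD leq_exp2l //; lia.
Qed.

Section MinorFree.
Variable t : nat.
Hypothesis no_model : ~ has_model t G.

(** The clique bound is used as [w = 2 * t + d ^ 2 - #|P|], so that [#|P|] cancels in the exponent;
    the successor absorbs the rounding of the fifth root. *)
Lemma n_max_cliques_dense (P : {set V}) (d : nat) :
  (forall x, x \in P -> #|nonadj G P x| <= d) ->
  n_max_cliques P <= 4 ^ ((2 * t + d ^ 2) %/ 5).+1.
Proof.
move=> codeg.
have big (W : {set V}) : W \subset P -> clique G W -> #|P| + #|W| <= 2 * t + d ^ 2.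
  move=> WP Wc; rewrite leqNgt; apply/negP=> h; apply: no_model.
  by apply: (pairs_has_model codeg WP Wc); apply: ltnW.
have P2 : #|P| <= 2 * t + d ^ 2.
  have := big set0; rewrite cards0 addn0; apply; first exact: sub0set.
  by apply/cliqueP=> x y; rewrite inE.
rewrite -(@leq_exp2r _ _ 5) //.
apply: leq_trans (@n_max_cliques_exp5 P (2 * t + d ^ 2 - #|P|) _) _.
  by move=> W WP Wc; have := big W WP Wc; lia.
rewrite subnKC // -expnM leq_exp2l //.
by have := divn_eq (2 * t + d ^ 2) 5; have := @ltn_pmod (2 * t + d ^ 2) 5 isT; lia.
Qed.

(** A neighbour branch is taken only at a vertex with more than [d] non-neighbours, so it removes at
    least [d + 1] vertices and occurs at most [#|P| %/ d.+1] times; the last factor counts where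
    these branches occur. *)
Lemma n_max_cliques_medium (P : {set V}) (d : nat) :
  n_max_cliques P <= 4 ^ ((2 * t + d ^ 2) %/ 5).+1 * #|P|.+1 ^ (#|P| %/ d.+1).
Proof.
have [n] := ubnP #|P|; elim: n => // n IH in P *; rewrite ltnS => Pn.
set Y := 4 ^ _ in IH *.
have [/forall_inP dense|] := boolP [forall x in P, #|nonadj G P x| <= d].
  by apply: leq_trans (n_max_cliques_dense dense) _; rewrite -[X in X <= _]muln1 leq_mul2l expn_gt0 orbT.
rewrite negb_forall_in => /exists_inP[u uP]; rewrite -ltnNge => du.
have cP := card_nonadj P u.
have cPu : #|P| = #|P :\ u|.+1 by rewrite (cardsD1 u P) uP.
apply: leq_trans (n_max_cliques_binary P u) _.
have h1 := IH (P :\ u); have h2 := IH (P :&: nbrs G u).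
move/(_ ltac:(lia)) in h1; move/(_ ltac:(lia)) in h2.
have [j jE] : exists j, #|P| %/ d.+1 = j.+1.
  by exists (#|P| %/ d.+1).-1; rewrite prednK // divn_gt0 //; lia.
have le1 : n_max_cliques (P :\ u) <= Y * #|P| ^ j.+1.
  apply: leq_trans h1 _; rewrite -cPu leq_mul2l; apply/orP; right.
  by rewrite leq_pexp2l ?cPu // -jE leq_div2r //; lia.
have le2 : n_max_cliques (P :&: nbrs G u) <= Y * #|P| ^ j.
  apply: leq_trans h2 _; rewrite leq_mul2l; apply/orP; right.
  apply: (@leq_trans (#|P :&: nbrs G u|.+1 ^ j)); last first.
    by case: (posnP j) => [->//|j0]; rewrite leq_exp2r //; lia.
  rewrite leq_pexp2l // -ltnS -jE.
  have -> : #|P| = #|P| - d.+1 + d.+1 by lia.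
  by rewrite divnDr // divnn /= addn1 ltnS leq_div2r //; lia.
apply: leq_trans (leq_add le1 le2) _; rewrite -mulnDr leq_mul2l jE; apply/orP; right.
exact: expn_binary_growth.
Qed.

(** Above the threshold [M] of [dense_has_model] some vertex has more than 2/5 non-neighbours. The
    budget [j] of neighbour branches is tied to [#|P| ^ 2 < 2 ^ j], which each such branch restores
    with [j - 1]. *)
Lemma n_max_cliques_large (L j d : nat) (P : {set V}) :
  let M := 10 * (t * (4 * L + 2)) in
  #|P| < 2 ^ L -> #|P| ^ 2 < 2 ^ j ->
  n_max_cliques P <=
    4 ^ ((2 * t + d ^ 2) %/ 5).+1 * M.+1 ^ (M %/ d.+1) * #|P|.+1 ^ j.
Proof.
move=> M; set Y := _ * M.+1 ^ _.
have [n] := ubnP #|P|; elim: n => // n IH in P j *; rewrite ltnS => Pn PL Pj.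
have [PM|MP] := leqP #|P| M.
  apply: leq_trans (n_max_cliques_medium P d) _; rewrite -[X in X <= _]muln1.
  apply: leq_mul; last by rewrite expn_gt0.
  rewrite leq_mul2l; apply/orP; right.
  apply: (@leq_trans (M.+1 ^ (#|P| %/ d.+1))).
    by case: (posnP (#|P| %/ d.+1)) => [->//|j0]; rewrite leq_exp2r.
  by rewrite leq_pexp2l // leq_div2r.
have [/exists_inP[u uP ud]|nou] := boolP [exists u in P, 2 * #|P| < 5 * #|nonadj G P u|];
    last first.
  case: no_model; apply: (@dense_has_model V G P _ t L) => //; last exact: ltnW.
    move=> x xP; rewrite leqNgt; apply: contra nou => h.
    by apply/exists_inP; exists x.
  by lia.
have cP := card_nonadj P u.
have cPu : #|P| = #|P :\ u|.+1 by rewrite (cardsD1 u P) uP.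
apply: leq_trans (n_max_cliques_binary P u) _.
case: j Pj => [|j] Pj; first by rewrite expn0 cPu in Pj; lia.
have le1 : n_max_cliques (P :\ u) <= Y * #|P| ^ j.+1.
  by rewrite cPu; apply: IH; [lia|lia|apply: leq_trans Pj; rewrite ltnS leq_exp2r //; lia].
have le2 : n_max_cliques (P :&: nbrs G u) <= Y * #|P| ^ j.
  apply: leq_trans (IH _ j _ _ _) _; [lia|lia| |].
    by have := leq_ltn_trans (sqr_shrink cP ud) Pj; rewrite [2 ^ _]expnS ltn_mul2l.
  rewrite leq_mul2l; apply/orP; right.
  by case: (posnP j) => [->//|j0]; rewrite leq_exp2r //; lia.
apply: leq_trans (leq_add le1 le2) _; rewrite -mulnDr leq_mul2l; apply/orP; right.
exact: expn_binary_growth.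
Qed.

End MinorFree.
End CountMaxCliques.

(** * A duplicate-free tree of maximal cliques *)

Section Tree.
Variable adj : nat -> nat -> bool.
Hypothesis adj_sym : forall x y, adj x y = adj y x.

(* A bit sequence [s] of size [i] stands for a subset of the first [i] vertices. *)
Definition max_clique_seq (i : nat) (s : bitseq) : Prop :=
  [/\ size s = i,
      forall c d, nth false s c -> nth false s d -> c != d -> adj c d
    & forall j, j < i -> ~~ nth false s j -> exists2 c, nth false s c & ~~ adj c j].

Definition without (s : bitseq) : bitseq := rcons s false.

Definition with_last (i : nat) (s : bitseq) : bitseq :=
  rcons (mkseq (fun j => nth false s j && adj j i) i) true.

Definition without_ok (i : nat) (s : bitseq) : bool :=
  has (fun c => nth false s c && ~~ adj c i) (iota 0 i).

(** The vertex [c] of [s] keeps [j] out. If [adj c i], it does so in [with_last i s] as well;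
    otherwise it precedes [j] in the greedy completion. For a neighbour [j] of [i] only the first
    kind counts, since [with_last i s] itself has to exclude [j]. *)
Definition conflict (i : nat) (s : bitseq) (j c : nat) : bool :=
  [&& nth false s c, ~~ adj c j & adj c i || (c < j) && ~~ adj j i].

(* [with_last i s] is maximal and [s] is the lexicographically first maximal
   clique of the first [i] vertices containing the neighbours of [i] in [s]. *)
Definition with_last_ok (i : nat) (s : bitseq) : bool :=
  all (fun j => nth false s j || has (conflict i s j) (iota 0 i)) (iota 0 i).

Definition children (i : nat) (s : bitseq) : seq bitseq :=
  (if without_ok i s then [:: without s] else [::]) ++
  (if with_last_ok i s then [:: with_last i s] else [::]).

Fixpoint descendants (k i : nat) (s : bitseq) : seq bitseq :=
  if k is k'.+1 then flatten [seq descendants k' i.+1 s' | s' <- children i s]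
  else [:: s].

Fixpoint tree_size (k i : nat) (s : bitseq) : nat :=
  if k is k'.+1 then (sumn [seq tree_size k' i.+1 s' | s' <- children i s]).+1 else 1.

(** The recursion unfolds at the root; invariants of whole levels need it unfolded at the leaves. *)
Lemma descendantsS k i s :
  descendants k.+1 i s = flatten [seq children (i + k) s' | s' <- descendants k i s].
Proof.
elim: k i s => [|k IH] i s.
  by rewrite addn0 /= cats0; elim: (children i s) => //= x l ->.
rewrite -[descendants k.+2 i s]/(flatten [seq descendants k.+1 i.+1 s' | s' <- children i s]).
rewrite -[descendants k.+1 i s]/(flatten [seq descendants k i.+1 s' | s' <- children i s]).
elim: (children i s) => //= x l ->.
by rewrite map_cat flatten_cat -addSnnS; congr (_ ++ _); rewrite -IH.
Qed.

(** Nodes are counted by levels because each level will be bounded by a number of maximal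
    cliques. *)
Lemma tree_size_sum k i s :
  tree_size k i s = \sum_(l < k.+1) size (descendants l i s).
Proof.
elim: k i s => [|k IH] i s; first by rewrite big_ord1.
rewrite big_ord_recl /= -add1n; congr (_ + _).
elim: (children i s) => [|x l IHl] /=; first by rewrite big1.
rewrite IHl IH -big_split /=; apply: eq_bigr => j _.
by rewrite size_cat.
Qed.

Lemma nth_without i s j : size s = i -> nth false (without s) j = nth false s j.
Proof.
move=> si; rewrite nth_rcons; case: ltngtP => // sj.
- by rewrite nth_default // ltnW.
- by rewrite sj nth_default.
Qed.

Lemma nth_with_last i s j : size s = i ->
  nth false (with_last i s) j = (j == i) || nth false s j && adj j i.
Proof.
move=> si; rewrite nth_rcons size_mkseq; case: ltngtP => [ji|ij|->] //=.
- by rewrite nth_mkseq.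
- by rewrite nth_default // si ltnW.
Qed.

Lemma max_clique_seq_lt i s c : max_clique_seq i s -> nth false s c -> c < i.
Proof.
move=> [<- _ _]; rewrite ltnNge; apply: contraTN => sc.
by rewrite nth_default.
Qed.

Lemma children_max i s s' :
  max_clique_seq i s -> s' \in children i s -> max_clique_seq i.+1 s'.
Proof.
move=> ms; have [si sc sm] := ms; have slt c := @max_clique_seq_lt i s c ms.
rewrite mem_cat => /orP[].
  case: ifP => //; rewrite inE => /hasP[c _ /andP[cs ci]] /eqP->.
  split; first by rewrite size_rcons si.
  - by move=> d e; rewrite !(nth_without _ si); apply: sc.
  - move=> j; rewrite ltnS leq_eqVlt (nth_without _ si) => /predU1P[->|ji] js.
      by exists c; rewrite ?(nth_without _ si).
    by have [d ds dj] := sm j ji js; exists d; rewrite ?(nth_without _ si).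
case: ifP => //; rewrite inE => /allP ok /eqP->.
split; first by rewrite size_rcons size_mkseq.
- move=> d e; rewrite !(nth_with_last _ si).
  move=> /predU1P[->|/andP[ds di]] /predU1P[->|/andP[es ei]].
  + by rewrite eqxx.
  + by rewrite adj_sym.
  + by [].
  + exact: sc.
- move=> j; rewrite ltnS leq_eqVlt (nth_with_last _ si).
  move=> /predU1P[->|ji]; first by rewrite eqxx.
  rewrite ltn_eqF //= negb_and => js.
  have wi : nth false (with_last i s) i by rewrite (nth_with_last _ si) eqxx.
  have [aji|nji] := boolP (adj j i); last by exists i => //; rewrite adj_sym.
  rewrite aji orbF in js.
  have := ok j; rewrite mem_iota add0n ji (negbTE js) /= => /(_ isT)/hasP[c _].
  rewrite /conflict aji andbF orbF => /and3P[cs cj ci].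
  by exists c; rewrite ?(nth_with_last _ si) ?cs ?ci ?orbT.
Qed.

(** The lexicographically first completion of [S]. The predicate [ok] stands for adjacency to all of
    [S], including members of [S] that come after the vertex under decision. *)
Fixpoint greedy (S ok : pred nat) (k : nat) : bitseq :=
  if k is j.+1 then
    let g := greedy S ok j in
    rcons g (S j || ok j && all (fun c => nth false g c ==> adj c j) (iota 0 j))
  else [::].

Lemma size_greedy S ok k : size (greedy S ok k) = k.
Proof. by elim: k => //= k IH; rewrite size_rcons IH. Qed.

Lemma nth_greedy S ok k j : j < k ->
  nth false (greedy S ok k) j = nth false (greedy S ok j.+1) j.
Proof.
elim: k => // k IH; rewrite ltnS leq_eqVlt => /predU1P[->//|jk].
by rewrite [greedy _ _ k.+1]/= nth_rcons size_greedy jk IH.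
Qed.

Lemma greedyE (S ok : pred nat) k j : j < k ->
  nth false (greedy S ok k) j =
  S j || ok j && all (fun c => nth false (greedy S ok k) c ==> adj c j) (iota 0 j).
Proof.
move=> jk; rewrite nth_greedy //= nth_rcons size_greedy ltnn eqxx; congr (_ || _ && _).
apply: eq_in_all => c; rewrite mem_iota add0n => /= cj.
by rewrite (nth_greedy _ _ (ltn_trans cj jk)) (nth_greedy _ _ cj).
Qed.

(** A clique avoiding [i] is its own parent, being already maximal on the first [i] vertices. The
    parent of a clique through [i] is the greedy completion of its other vertices, a canonical
    choice as in reverse search. *)
Lemma parent_exists i s' : max_clique_seq i.+1 s' ->
  exists2 s, max_clique_seq i s & s' \in children i s.
Proof.
move=> ms; have [si sc sm] := ms; have slt c := @max_clique_seq_lt i.+1 s' c ms.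
case: (boolP (nth false s' i)) => si'.
  pose ok j := all (fun c => (nth false s' c && (c < i)) ==> adj c j) (iota 0 i).
  pose S j := nth false s' j && (j < i).
  have okP j : reflect (forall c, S c -> adj c j) (ok j).
    apply: (iffP allP) => [h c Sc|h c _]; last by apply/implyP; apply: h.
    have /andP[_ ci] := Sc; have := h c; rewrite mem_iota add0n ci => /(_ isT)/implyP.
    by rewrite andbT; apply; case/andP: Sc.
  pose s := greedy S ok i; have ss : size s = i by rewrite size_greedy.
  have sE j : nth false s j =
      (j < i) && (S j || ok j && all (fun c => nth false s c ==> adj c j) (iota 0 j)).
    by case: ltnP => ji /=; [apply: greedyE|rewrite nth_default ?ss].
  have Ss j : S j -> nth false s j by move=> Sj; rewrite sE Sj; case/andP: Sj => _ ->.
  have Sadj c : S c -> adj c i.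
    by case/andP=> c1 ci; apply: sc => //; rewrite ltn_eqF.
  have scl c d : nth false s c -> nth false s d -> c < d -> adj c d.
    move=> hc; rewrite (sE d) => /andP[di /orP[Sd|/andP[_ /allP ad]]] cd; last first.
      by have := ad c; rewrite mem_iota add0n cd hc => /(_ isT).
    move: hc; rewrite sE => /andP[ci /orP[Sc|/andP[/okP oc _]]].
      by case/andP: Sc Sd => sc1 _ /andP[sd _]; apply: sc; rewrite // ltn_eqF.
    by rewrite adj_sym; apply: oc.
  have smax : max_clique_seq i s.
    split=> //.
    - move=> c d hc hd; case: ltngtP => // cd _; first exact: scl.
      by rewrite adj_sym; apply: scl.
    - move=> j ji; rewrite sE ji /= negb_or => /andP[nS].
      rewrite negb_and => /orP[/okP no|/allPn[c _]].
        have /allPn[c] : ~~ ok j by apply/okP.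
        by rewrite mem_iota negb_imply => _ /andP[Sc cj]; exists c => //; apply: Ss.
      by rewrite negb_imply => /andP[hc cj]; exists c.
  (* A vertex of [s] adjacent to [i] is in [s'], which is maximal. *)
  have back j : nth false s j -> adj j i -> nth false s' j.
    move=> hj aji; apply: contraT => nj.
    have ji : j < i.+1 by rewrite ltnW // ltnS -ss; rewrite sE in hj; case/andP: hj => ji _; rewrite ss.
    have [c hc] := sm j ji nj; rewrite adj_sym.
    have [->|ci] := eqVneq c i; first by rewrite aji.
    have Sc : S c by rewrite /S hc /= ltn_neqAle ci -ltnS slt.
    have [e|cj] := eqVneq c j; first by rewrite -e hc in nj.
    have [_ cl _] := smax; by rewrite adj_sym (cl c j (Ss _ Sc) hj cj).
  exists s => //; rewrite mem_cat; apply/orP; right.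
  have -> : with_last_ok i s.
    apply/allP=> j; rewrite mem_iota add0n => /= ji.
    have [//|nj] := boolP (nth false s j); apply/hasP.
    have [aji|naji] := boolP (adj j i).
      have ns' : ~~ nth false s' j.
        by apply: contra nj => hj; apply: Ss; rewrite /S hj.
      have [c hc cj] := sm j (ltnW ji) ns'.
      have ci : c != i by apply: contraNneq cj => ->; rewrite adj_sym.
      have Sc : S c by rewrite /S hc /= ltn_neqAle ci -ltnS slt.
      exists c; first by rewrite mem_iota add0n; case/andP: Sc.
      by rewrite /conflict Ss // cj Sadj.
    move: nj; rewrite sE ji /= negb_or negb_and => /andP[_ /orP[|]].
      move=> /allPn[c]; rewrite mem_iota add0n negb_imply => ci /andP[Sc cj].
      by exists c; rewrite ?mem_iota ?add0n // /conflict Ss // cj Sadj.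
    move=> /allPn[c]; rewrite mem_iota add0n negb_imply => /= cj /andP[hc ncj].
    exists c; first by rewrite mem_iota add0n (ltn_trans cj ji).
    by rewrite /conflict hc ncj cj naji orbT.
  rewrite inE; apply/eqP; apply: (@eq_from_nth _ false).
    by rewrite si size_rcons size_mkseq.
  move=> j; rewrite si ltnS leq_eqVlt (nth_with_last _ ss) => /predU1P[->|ji].
    by rewrite eqxx si'.
  rewrite ltn_eqF //=; apply/idP/andP => [hj|[hj aji]]; last exact: back.
  have Sj : S j by rewrite /S hj.
  by split; [apply: Ss|apply: Sadj].
(* Now [i] is not in [s'], and maximality of [s'] at [i] supplies the non-neighbour that
   [without_ok] asks for. *)
exists (take i s'); last first.
  rewrite mem_cat; apply/orP; left.
  have sE : s' = without (take i s').
    by rewrite /without -[in LHS](cat_take_drop i s') (drop_nth false) ?si // (negbTE si') drop_oversize ?si // cats1.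
  have -> : without_ok i (take i s').
    have [c hc ci] := sm i (ltnSn i) si'.
    have cli : c < i by rewrite ltn_neqAle -ltnS slt // andbT; apply: contraNneq si' => <-.
    by apply/hasP; exists c; rewrite ?mem_iota //= nth_take // hc.
  by rewrite inE; apply/eqP.
have tk c : nth false (take i s') c = nth false s' c.
  have [ci|ic] := ltnP c i; first by rewrite nth_take.
  rewrite nth_default ?size_takel ?si //; move: ic; rewrite leq_eqVlt => /predU1P[<-|ic].
    by rewrite (negbTE si').
  by rewrite nth_default // si.
split; first by rewrite size_takel // si.
- by move=> c d; rewrite !tk; apply: sc.
- by move=> j ji; rewrite tk => nj; have [c hc cj] := sm j (ltnW ji) nj; exists c; rewrite ?tk.
Qed.

(** Two parents of a clique through [i] share the neighbours of [i]. If they agree below [j] and one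
    omits [j], its conflict vertex is a neighbour of [i] or lies below [j]; hence it belongs to the
    other parent too and keeps [j] out there. *)
Lemma parent_unique i s1 s2 s' : max_clique_seq i s1 -> max_clique_seq i s2 ->
  s' \in children i s1 -> s' \in children i s2 -> s1 = s2.
Proof.
move=> m1 m2; have [z1 c1 x1] := m1; have [z2 c2 x2] := m2.
have lastb s : s' \in children i s -> (last true s' -> with_last_ok i s /\ s' = with_last i s) /\
    (~~ last true s' -> s' = without s).
  rewrite mem_cat => /orP[]; case: ifP => // ok; rewrite inE => /eqP->;
    by rewrite last_rcons.
move=> /lastb[w1 o1] /lastb[w2 o2].
case: (boolP (last true s')) => [l|l]; last first.
  by have := o2 l; rewrite (o1 l) => /rcons_inj[].
have [ok1 e1] := w1 l; have [ok2 e2] := w2 l.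
have agree j : j < i -> adj j i -> nth false s1 j = nth false s2 j.
  move=> ji aji; have := congr1 (fun s => nth false s j) e2.
  by rewrite e1 !nth_with_last // aji !andbT ltn_eqF.
apply: (@eq_from_nth _ false); rewrite z1 // => j.
have [k] := ubnP j; elim: k j => // k IH j jk ji.
have half sa sb : max_clique_seq i sa -> with_last_ok i sb ->
    (forall c, c < i -> adj c i -> nth false sa c = nth false sb c) ->
    (forall c, c < j -> nth false sa c = nth false sb c) ->
    nth false sa j -> nth false sb j.
  move=> [za ca xa] /allP okb ag lo hj; have := okb j; rewrite mem_iota add0n ji => /(_ isT).
  case/orP=> // /hasP[c]; rewrite mem_iota add0n => ci /and3P[hc cj].
  have [e|ncj] := eqVneq c j; first by rewrite -e.
  move=> side; have ha : nth false sa c.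
    by case/orP: side => [aci|/andP[cltj _]]; [rewrite ag|rewrite lo].
  by rewrite (ca c j ha hj ncj) in cj.
apply/idP/idP.
  by apply: (half s1 s2) => // c cj; apply: IH; [lia|apply: ltn_trans ji].
apply: (half s2 s1) => // [c ci aci|c cj]; first by rewrite agree.
by rewrite IH //; [lia|apply: ltn_trans ji].
Qed.

Lemma children_uniq i s : uniq (children i s).
Proof.
rewrite /children; case: ifP; case: ifP => //= _ _; rewrite inE andbT.
by apply/negP=> /eqP/rcons_inj[].
Qed.

Lemma descendants_max i s : s \in descendants i 0 [::] <-> max_clique_seq i s.
Proof.
elim: i s => [|i IH] s.
  rewrite inE; split=> [/eqP->|[/size0nil->//]].
  by split=> // c d; rewrite nth_nil.
rewrite descendantsS add0n; split.
  move=> /flattenP[_ /mapP[s0 /IH m0 ->]]; exact: children_max.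
move=> /parent_exists[s0 m0 ss0]; apply/flattenP; exists (children i s0) => //.
by apply/mapP; exists s0 => //; apply/IH.
Qed.

Lemma descendants_uniq i : uniq (descendants i 0 [::]).
Proof.
elim: i => // i IH; rewrite descendantsS add0n.
have {IH} : uniq (descendants i 0 [::]) /\ {in descendants i 0 [::], forall s, max_clique_seq i s}.
  by split=> // s /descendants_max.
elim: (descendants i 0 [::]) => //= s l IHl [/andP[sl ul] m].
rewrite cat_uniq children_uniq IHl ?andbT /=; last first.
  by split=> // x xl; apply: m; rewrite inE xl orbT.
apply/hasPn=> x /flattenP[_ /mapP[s0 s0l ->] x0]; apply: contra sl => xs.
rewrite (@parent_unique i s s0 x) //; apply: m; rewrite inE ?eqxx //.
by rewrite s0l orbT.
Qed.

End Tree.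

(** * A structured language and its compilation *)

Inductive expr :=
| Num (k : nat)
| Var (x : nat)
| Op (o : arith) (e1 e2 : expr)
| Get (a : nat) (e : expr).

Inductive cmd :=
| Skip
| Assign (x : nat) (e : expr)
| Read (x : nat) (e : expr)
| Store (a : nat) (e1 e2 : expr)
| Emit (e : expr)
| Seq (c1 c2 : cmd)
| If (e1 e2 : expr) (c1 c2 : cmd)
| While (e1 e2 : expr) (c : cmd).

Record state := State {
  vars : nat -> nat;
  arrs : nat -> nat -> nat;
  outp : seq nat }.

Definition setv (s : state) (x v : nat) : state :=
  State (upd (vars s) x v) (arrs s) (outp s).

Definition seta (s : state) (a i v : nat) : state :=
  State (vars s) (fun b => if b == a then upd (arrs s a) i v else arrs s b) (outp s).

Definition emit (s : state) (v : nat) : state :=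
  State (vars s) (arrs s) (rcons (outp s) v).

Definition nvars := 40.
Definition narrs := 8.

(* Register [nvars] holds the base address [Z] of the arrays, whose cells are
   interleaved: cell [i] of array [a] is at address [Z + (narrs * i + a)]. *)
Definition address (a r : nat) : program :=
  [:: Const r.+1 narrs; Arith Mul r r r.+1; Const r.+1 a; Arith Add r r r.+1;
      Arith Add r nvars r].

Fixpoint compile_expr (r : nat) (e : expr) : program :=
  match e with
  | Num k => [:: Const r k]
  | Var x => [:: Const r 0; Arith Add r x r]
  | Op o e1 e2 => compile_expr r e1 ++ compile_expr r.+1 e2 ++ [:: Arith o r r r.+1]
  | Get a e => compile_expr r e ++ address a r ++ [:: LoadMem r r]
  end.

(** Expression code is straight-line, so its length is also its running time; it does not depend on
    the target register. *)
Definition ecost (e : expr) : nat := size (compile_expr 0 e).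

Lemma size_compile_expr r e : size (compile_expr r e) = ecost e.
Proof.
rewrite /ecost; elim: e r 0 => //= [o e1 IH1 e2 IH2|a e IH] r r'.
  by rewrite !size_cat (IH1 r r') (IH2 r.+1 r'.+1).
by rewrite !size_cat (IH r r').
Qed.

Definition tmp := nvars.+1.

Fixpoint compile (l : nat) (c : cmd) : program :=
  match c with
  | Skip => [::]
  | Assign x e => compile_expr tmp e ++ [:: Const tmp.+1 0; Arith Add x tmp tmp.+1]
  | Read x e => compile_expr tmp e ++ [:: LoadMem x tmp]
  | Store a e1 e2 =>
      compile_expr tmp e1 ++ address a tmp ++ compile_expr tmp.+1 e2 ++
      [:: StoreMem tmp tmp.+1]
  | Emit e => compile_expr tmp e ++ [:: Output tmp]
  | Seq c1 c2 =>
      let p1 := compile l c1 in p1 ++ compile (l + size p1) c2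
  | If e1 e2 c1 c2 =>
      let l2 := l + ecost e1 + ecost e2 + 1 in
      let p2 := compile l2 c2 in
      let l1 := l2 + size p2 + 1 in
      let p1 := compile l1 c1 in
      compile_expr tmp e1 ++ compile_expr tmp.+1 e2 ++ [:: JumpLt tmp tmp.+1 l1] ++
      p2 ++ [:: Jump (l1 + size p1)] ++ p1
  | While e1 e2 c1 =>
      let l1 := l + ecost e1 + ecost e2 + 2 in
      let p1 := compile l1 c1 in
      compile_expr tmp e1 ++ compile_expr tmp.+1 e2 ++
      [:: JumpLt tmp tmp.+1 l1; Jump (l1 + size p1 + 1)] ++
      p1 ++ [:: Jump l]
  end.

Fixpoint eval (s : state) (e : expr) : nat :=
  match e with
  | Num k => k
  | Var x => vars s x
  | Op o e1 e2 => eval_arith o (eval s e1) (eval s e2)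
  | Get a e => arrs s a (eval s e)
  end.

(* [esize e] bounds the exponent of the values occurring in the evaluation of
   [e] when constants, variables and array cells are smaller than the base. *)
Fixpoint esize (e : expr) : nat :=
  match e with
  | Num _ | Var _ => 1
  | Op _ e1 e2 => esize e1 + esize e2
  | Get _ e => esize e + 3
  end.

Fixpoint csize (c : cmd) : nat :=
  match c with
  | Skip => 0
  | Assign _ e | Read _ e | Emit e => esize e
  | Store _ e1 e2 => maxn (esize e1 + 3) (esize e2)
  | Seq c1 c2 => maxn (csize c1) (csize c2)
  | If e1 e2 c1 c2 => maxn (maxn (esize e1) (esize e2)) (maxn (csize c1) (csize c2))
  | While e1 e2 c => maxn (maxn (esize e1) (esize e2)) (csize c)
  end.

(** 400 is the largest constant of the listing program, and [U] is assumed to exceed it. *)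
Fixpoint wf_expr (e : expr) : bool :=
  match e with
  | Num k => k <= 400
  | Var x => x < nvars
  | Op _ e1 e2 => wf_expr e1 && wf_expr e2
  | Get a e => (a < narrs) && wf_expr e
  end.

Fixpoint wf (c : cmd) : bool :=
  match c with
  | Skip => true
  | Assign x e | Read x e => (x < nvars) && wf_expr e
  | Store a e1 e2 => [&& a < narrs, wf_expr e1 & wf_expr e2]
  | Emit e => wf_expr e
  | Seq c1 c2 => wf c1 && wf c2
  | If e1 e2 c1 c2 => [&& wf_expr e1, wf_expr e2, wf c1 & wf c2]
  | While e1 e2 c => [&& wf_expr e1, wf_expr e2 & wf c]
  end.

Section Run.
Variables (Z U : nat) (inp : nat -> nat).

(** Big-step semantics with instruction counts. Values kept in variables and arrays have to stay
    below [U], while intermediate values may grow up to [U ^ csize c]; the words of the machine are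
    chosen that large. *)
Inductive run : cmd -> state -> state -> nat -> Prop :=
| run_skip s : run Skip s s 0
| run_assign s x e : eval s e < U ->
    run (Assign x e) s (setv s x (eval s e)) (ecost e + 2)
| run_read s x e : eval s e < Z -> inp (eval s e) < U ->
    run (Read x e) s (setv s x (inp (eval s e))) (ecost e + 1)
| run_store s a e1 e2 : eval s e2 < U ->
    run (Store a e1 e2) s (seta s a (eval s e1) (eval s e2)) (ecost e1 + 5 + (ecost e2 + 1))
| run_emit s e : run (Emit e) s (emit s (eval s e)) (ecost e + 1)
| run_seq s s1 s2 c1 c2 T1 T2 :
    run c1 s s1 T1 -> run c2 s1 s2 T2 -> run (Seq c1 c2) s s2 (T1 + T2)
| run_if_true s s1 e1 e2 c1 c2 T : eval s e1 < eval s e2 ->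
    run c1 s s1 T -> run (If e1 e2 c1 c2) s s1 (ecost e1 + (ecost e2 + (1 + T)))
| run_if_false s s1 e1 e2 c1 c2 T : eval s e2 <= eval s e1 ->
    run c2 s s1 T -> run (If e1 e2 c1 c2) s s1 (ecost e1 + (ecost e2 + (1 + (T + 1))))
| run_while_true s s1 s2 e1 e2 c T1 T2 : eval s e1 < eval s e2 ->
    run c s s1 T1 -> run (While e1 e2 c) s1 s2 T2 ->
    run (While e1 e2 c) s s2 (ecost e1 + (ecost e2 + (1 + (T1 + (1 + T2)))))
| run_while_false s e1 e2 c : eval s e2 <= eval s e1 ->
    run (While e1 e2 c) s s (ecost e1 + (ecost e2 + 2)).

Definition bounded (s : state) : Prop :=
  (forall x, x < nvars -> vars s x < U) /\ (forall a i, a < narrs -> arrs s a i < U).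

Definition represents (s : state) (c : config) : Prop :=
  [/\ forall x, x < nvars -> reg c x = vars s x,
      reg c nvars = Z,
      forall i, i < Z -> memory c i = inp i,
      forall a i, a < narrs -> memory c (Z + (narrs * i + a)) = arrs s a i
    & out c = outp s].

Section Correctness.
Local Arguments exec : simpl never.
Local Arguments address : simpl never.
Variables (w : nat) (P : program).
Hypotheses (U_gt400 : 400 < U) (Z_lt : Z < U) (U_le : U <= w).

Definition code_at (l : nat) (p : program) : Prop :=
  forall i, i < size p -> nth Halt P (l + i) = nth Halt p i.

Lemma code_at_cat l p1 p2 :
  code_at l (p1 ++ p2) -> code_at l p1 /\ code_at (l + size p1) p2.
Proof.
move=> h; split=> i ip.
  by rewrite h ?nth_cat ?ip // size_cat ltn_addr.
rewrite -addnA h ?nth_cat ?size_cat ?ltn_add2l //.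
by rewrite ltnNge leq_addr addKn.
Qed.

Lemma execD T1 T2 (c c1 : config) :
  exec w P T1 c = Some c1 -> exec w P (T1 + T2) c = exec w P T2 c1.
Proof. by move=> h; rewrite /exec addnC iterD -/(exec w P T1 c) h. Qed.

Lemma exec1 c : exec w P 1 c = step w P c.
Proof. by []. Qed.

Lemma eval_lt s e : bounded s -> wf_expr e -> eval s e < U ^ esize e.
Proof.
have U0 : 0 < U by lia.
have esize_gt0 e' : 0 < esize e' by elim: e' => //= *; lia.
move=> [bv ba]; elim: e => [k|x|o e1 IH1 e2 IH2|a e IH] /=.
- by move=> k4; rewrite expn1; lia.
- by move=> /bv; rewrite expn1.
- move=> /andP[/IH1 {}IH1 /IH2 {}IH2].
  have le1 : U ^ esize e1 <= U ^ (esize e1 + esize e2) by rewrite leq_exp2l ?leq_addr //; lia.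
  have Ue2 : U <= U ^ esize e2 by rewrite -{1}(expn1 U) leq_exp2l //; lia.
  have Ue1 : U <= U ^ esize e1 by rewrite -{1}(expn1 U) leq_exp2l //; lia.
  case: o => /=.
  + by rewrite expnD; nia.
  + by lia.
  + by rewrite expnD; apply: ltn_mul.
  + by apply: leq_ltn_trans (leq_div _ _) _; apply: leq_trans IH1 le1.
  + by apply: leq_ltn_trans (leq_mod _ _) _; apply: leq_trans IH1 le1.
- move=> /andP[/ba h _]; apply: leq_trans (h _) _.
  by rewrite -{1}(expn1 U) leq_exp2l; lia.
Qed.

(** This is the origin of the 3 in [esize] of an array access: [U ^ 3] leaves room for the base [Z],
    the interleaving factor and the array number. *)
Lemma address_lt s e a : bounded s -> wf_expr e -> a < narrs ->
  Z + (narrs * eval s e + a) < U ^ (esize e + 3).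
Proof.
move=> sb we aN; rewrite expnD.
have esize_gt0 : 0 < esize e by elim: (e) => //= *; lia.
have := eval_lt sb we; have : U <= U ^ esize e by rewrite -{1}(expn1 U) leq_exp2l //; lia.
rewrite /narrs in aN *; rewrite -[3]/(1 + 2) expnD expn1.
have : 400 <= U ^ 2 by rewrite -mulnn; nia.
move: (U ^ 2) (U ^ esize e) => A B A4 UB eB.
have : 10 * B <= B * (U * A) by rewrite mulnC leq_mul2l; nia.
lia.
Qed.

Lemma step_const c d k l : code_at (pc c) (Const d k :: l) -> k < w ->
  step w P c = Some (Config (pc c).+1 (upd (reg c) d k) (memory c) (out c)).
Proof.
by move=> /(_ 0 isT); rewrite addn0 /step /current /= => -> kw; rewrite /set_reg kw.
Qed.

Lemma step_arith c o d a b l : code_at (pc c) (Arith o d a b :: l) ->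
  eval_arith o (reg c a) (reg c b) < w ->
  step w P c = Some (Config (pc c).+1 (upd (reg c) d (eval_arith o (reg c a) (reg c b)))
                       (memory c) (out c)).
Proof.
by move=> /(_ 0 isT); rewrite addn0 /step /current /= => -> kw; rewrite /set_reg kw.
Qed.

Lemma step_load c d a l : code_at (pc c) (LoadMem d a :: l) ->
  memory c (reg c a) < w ->
  step w P c = Some (Config (pc c).+1 (upd (reg c) d (memory c (reg c a)))
                       (memory c) (out c)).
Proof.
by move=> /(_ 0 isT); rewrite addn0 /step /current /= => -> kw; rewrite /set_reg kw.
Qed.

Lemma code_at_behead l i p : code_at l (i :: p) -> code_at l.+1 p.
Proof. by move=> h k kp; rewrite addSnnS h. Qed.

Lemma execS T c c1 : step w P c = Some c1 -> exec w P T.+1 c = exec w P T c1.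
Proof. by move=> h; rewrite /exec iterSr /= h. Qed.

Definition computes (n r v : nat) (c c' : config) : Prop :=
  [/\ exec w P n c = Some c', pc c' = pc c + n, reg c' r = v,
      forall y, y < r -> reg c' y = reg c y
    & memory c' = memory c /\ out c' = out c].

Lemma exec_address c a r v : code_at (pc c) (address a r) -> nvars < r ->
  reg c nvars = Z -> reg c r = v -> a < narrs -> Z + (narrs * v + a) < w ->
  exists c', computes 5 r (Z + (narrs * v + a)) c c'.
Proof.
move=> h0 rN cZ cr aN sw; have vw : narrs * v + a < w by lia.
have nw : narrs < w by rewrite /narrs; lia.
have h1 := code_at_behead h0; have h2 := code_at_behead h1.
have h3 := code_at_behead h2; have h4 := code_at_behead h3.
have e1 : (r == r.+1) = false by lia.
have e2 : (nvars == r) = false by rewrite /nvars in rN *; lia.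
have e3 : (nvars == r.+1) = false by rewrite /nvars in rN *; lia.
have e4 : (r.+1 == r) = false by lia.
eexists; split.
- rewrite (execS _ (step_const h0 _)) //.
  rewrite (execS _ (step_arith (c := Config _ _ _ _) h1 _)) /= /upd eqxx ?e1 ?cr; last by lia.
  rewrite (execS _ (step_const (c := Config _ _ _ _) h2 _)); last by lia.
  rewrite (execS _ (step_arith (c := Config _ _ _ _) h3 _)) /= /upd !eqxx ?e1 ?e4 ?cr; last by lia.
  rewrite (execS _ (step_arith (c := Config _ _ _ _) h4 _)) /= /upd !eqxx ?e1 ?e2 ?e3 ?e4 ?cr ?cZ; last by lia.
  by [].
- by rewrite /=; lia.
- by rewrite /= eqxx ?e2 ?e3 ?cZ mulnC.
- move=> y yr /=; have f1 : (y == r) = false by lia.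
  have f2 : (y == r.+1) = false by lia.
  by rewrite f1 f2.
- by [].
Qed.

(** Registers from [r] upwards act as an evaluation stack: the first operand waits in [r] while the
    second is computed from [r + 1] on, and everything below [r] is preserved. *)
Lemma compile_expr_correct s e : bounded s -> wf_expr e -> U ^ esize e <= w ->
  forall r c, represents s c -> nvars < r -> code_at (pc c) (compile_expr r e) ->
  exists c', computes (ecost e) r (eval s e) c c'.
Proof.
have esize_gt0 e' : 0 < esize e' by elim: e' => //= *; lia.
move=> sb; elim: e => [k|x|o e1 IH1 e2 IH2|a e IH] /= we ew r c cs rN h.
- eexists; split; first by rewrite -[ecost _]/1 (execS _ (step_const h _)) //; lia.
  + by rewrite /= addn1.
  + by rewrite /= /upd eqxx.
  + by move=> y yr; rewrite /= /upd ltn_eqF.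
  + by [].
- have [cv cZ cm ca co] := cs; have [bv ba] := sb.
  have ne : (x == r) = false by lia.
  eexists; split.
  + rewrite -[ecost _]/2 (execS _ (step_const h _)); last by lia.
    rewrite (execS _ (step_arith (c := Config _ _ _ _) (code_at_behead h) _)) /= /upd ?ne ?eqxx ?addn0 ?cv //.
    by apply: leq_trans (bv _ we) _.
  + by rewrite /ecost /=; lia.
  + by rewrite /= eqxx.
  + by move=> y yr; rewrite /= ltn_eqF.
  + by [].
- have /andP[we1 we2] := we.
  have [h1 /code_at_cat[h2 h3]] := code_at_cat h.
  have le1 : U ^ esize e1 <= w by apply: leq_trans ew; rewrite leq_exp2l ?leq_addr //; lia.
  have le2 : U ^ esize e2 <= w by apply: leq_trans ew; rewrite leq_exp2l ?leq_addl //; lia.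
  have [c1 k1] := IH1 we1 le1 r c cs rN h1.
  have [cv cZ cm ca co] := cs; have [x1 p1 v1 b1 [m1 o1]] := k1.
  have cs1 : represents s c1.
    split=> [x xN||i iZ|b i bN|]; rewrite ?m1 ?o1; auto.
      by rewrite b1 ?cv // (ltn_trans xN).
    by rewrite b1.
  rewrite size_compile_expr -p1 in h2 h3.
  have [c2 k2] := IH2 we2 le2 r.+1 c1 cs1 (ltnW rN) h2.
  have [x2 p2 v2 b2 [m2 o2]] := k2.
  rewrite size_compile_expr -p2 in h3.
  have ov : eval_arith o (eval s e1) (eval s e2) < w.
    by apply: leq_trans ew; apply: (@eval_lt s (Op o e1 e2)).
  have r12 : reg c2 r = eval s e1 by rewrite b2.
  eexists; split.
  + have -> : ecost (Op o e1 e2) = ecost e1 + (ecost e2 + 1).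
      by rewrite /ecost /= !size_cat !size_compile_expr /=.
    rewrite (execD _ x1) (execD _ x2) exec1 (step_arith h3) ?r12 ?v2 //.
  + rewrite /= p2 p1 /ecost /= !size_cat !size_compile_expr /=; lia.
  + by rewrite /= /upd eqxx.
  + by move=> y yr; rewrite /= /upd ltn_eqF // b2 ?b1 //; lia.
  + by rewrite /= m2 o2 m1 o1.
- have /andP[aN we1] := we.
  have [h1 h23] := code_at_cat h.
  have [h2 h3] := @code_at_cat _ (address a r) [:: LoadMem r r] h23.
  have le1 : U ^ esize e <= w by apply: leq_trans ew; rewrite leq_exp2l ?leq_addr //; lia.
  have [c1 k1] := IH we1 le1 r c cs rN h1.
  have [cv cZ cm ca co] := cs; have [x1 p1 v1 b1 [m1 o1]] := k1.
  rewrite size_compile_expr -p1 in h2.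
  have ab : Z + (narrs * eval s e + a) < w.
    by apply: leq_trans ew; apply: address_lt.
  have [|c2 k2] := exec_address h2 rN _ v1 aN ab; first by rewrite b1.
  have [x2 p2 v2 b2 [m2 o2]] := k2.
  rewrite size_compile_expr -p1 -[size _]/5 -p2 in h3.
  have ld : memory c2 (reg c2 r) = arrs s a (eval s e) by rewrite v2 m2 m1 ca.
  have av : arrs s a (eval s e) < w by have [_ ba] := sb; apply: leq_trans (ba _ _ aN) _.
  eexists; split.
  + have -> : ecost (Get a e) = ecost e + (5 + 1).
      by rewrite /ecost /= !size_cat !size_compile_expr /=.
    by rewrite (execD _ x1) (execD _ x2) exec1 (step_load h3) ?ld.
  + rewrite /= p2 p1 /ecost /= !size_cat !size_compile_expr /=; lia.
  + by rewrite /= /upd eqxx.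
  + by move=> y yr; rewrite /= /upd ltn_eqF // b2 ?b1.
  + by rewrite /= m2 o2 m1 o1.
Qed.

Lemma represents_computes s n r v c c' :
  nvars < r -> computes n r v c c' -> represents s c -> represents s c'.
Proof.
move=> rN [_ _ _ b [m o]] [cv cZ cm ca co]; split=> [x xN||i iZ|a i aN|].
- by rewrite b ?cv // (ltn_trans xN).
- by rewrite b.
- by rewrite m cm.
- by rewrite m ca.
- by rewrite o co.
Qed.

Lemma compile_two_correct s e1 e2 : bounded s -> wf_expr e1 -> wf_expr e2 ->
  U ^ esize e1 <= w -> U ^ esize e2 <= w ->
  forall c p, represents s c ->
  code_at (pc c) (compile_expr tmp e1 ++ compile_expr tmp.+1 e2 ++ p) ->
  exists c', [/\ exec w P (ecost e1 + ecost e2) c = Some c',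
    pc c' = pc c + (ecost e1 + ecost e2), reg c' tmp = eval s e1 /\ reg c' tmp.+1 = eval s e2,
    represents s c' & code_at (pc c') p].
Proof.
move=> sb we1 we2 le1 le2 c p cs h.
have [h1 /code_at_cat[h2 h3]] := code_at_cat h.
have [c1 k1] := compile_expr_correct sb we1 le1 cs (isT : nvars < tmp) h1.
have cs1 := represents_computes (isT : nvars < tmp) k1 cs.
have [x1 p1 v1 b1 [m1 o1]] := k1.
rewrite !size_compile_expr -p1 in h2 h3.
have [c2 k2] := compile_expr_correct sb we2 le2 cs1 (isT : nvars < tmp.+1) h2.
have cs2 := represents_computes (isT : nvars < tmp.+1) k2 cs1.
have [x2 p2 v2 b2 [m2 o2]] := k2.
exists c2; split=> //; first by rewrite (execD _ x1).
- by rewrite p2 p1 addnA.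
- by rewrite b2.
- by rewrite p2.
Qed.

Lemma bounded_setv s x v : bounded s -> v < U -> bounded (setv s x v).
Proof. by move=> [bv ba] vU; split=> // y yN; rewrite /= /upd; case: eqP => // _; apply: bv. Qed.

Lemma bounded_seta s a i v : bounded s -> v < U -> bounded (seta s a i v).
Proof.
move=> [bv ba] vU; split=> // b j bN; rewrite /=; case: eqP => [ab|_]; last exact: ba.
by rewrite /upd; case: eqP => // _; apply: ba; rewrite -ab.
Qed.

Lemma represents_setv s c x v l : x < nvars -> represents s c ->
  reg c =1 reg c -> represents (setv s x v) (Config l (upd (reg c) x v) (memory c) (out c)).
Proof.
move=> xN [cv cZ cm ca co] _; split=> //= [y yN|]; rewrite /upd.
  by case: eqP => // _; apply: cv.
by rewrite gtn_eqF.
Qed.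

Ltac code_sizes :=
  rewrite /= ?(size_cat, size_compile_expr) /= ?(size_cat, size_compile_expr) /=.

(** Induction on the derivation of [run] rather than on the command, because the derivation of a
    loop contains one of the same loop. *)
Lemma run_correct c s s' T : run c s s' T -> wf c -> U ^ csize c <= w -> bounded s ->
  forall cfg, code_at (pc cfg) (compile (pc cfg) c) -> represents s cfg ->
  exists cfg', [/\ exec w P T cfg = Some cfg', pc cfg' = pc cfg + size (compile (pc cfg) c),
    represents s' cfg' & bounded s'].
Proof.
have Uw a b : a <= b -> U ^ b <= w -> U ^ a <= w.
  by move=> ab; apply: leq_trans; rewrite leq_exp2l //; lia.
elim=> {c s s' T} [s|s x e eU|s x e eZ iU|s a e1 e2 eU|s e|s s1 s2 c1 c2 T1 T2 _ IH1 _ IH2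
    |s s1 e1 e2 c1 c2 T lt _ IH|s s1 e1 e2 c1 c2 T le _ IH
    |s s1 s2 e1 e2 c T1 T2 lt _ IH1 _ IH2|s e1 e2 c le] /=.
- by move=> _ _ sb cfg _ cs; exists cfg; rewrite addn0.
- move=> /andP[xN we] ew sb cfg h cs; have [h1 h2] := code_at_cat h.
  have [c1 k1] := compile_expr_correct sb we ew cs (isT : nvars < tmp) h1.
  have cs1 := represents_computes (isT : nvars < tmp) k1 cs.
  have [x1 p1 v1 b1 [m1 o1]] := k1.
  rewrite size_compile_expr -p1 in h2.
  have xt : (x == tmp.+1) = false by rewrite ltn_eqF // (ltn_trans xN).
  eexists; split.
  + rewrite (execD _ x1) (execS _ (step_const h2 _)); last by lia.
    rewrite (execS _ (step_arith (c := Config _ _ _ _) (code_at_behead h2) _)) //=.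
    by rewrite /upd /= addn0 v1; lia.
  + by rewrite /= p1 size_cat size_compile_expr /=; lia.
  + have [cv cZ cm ca co] := cs1; split=> //= [y yN|]; rewrite /upd /= ?addn0 ?v1.
      case: eqP => // _; rewrite ltn_eqF ?cv // (ltn_trans yN) //.
    by rewrite gtn_eqF.
  + exact: bounded_setv.
- move=> /andP[xN we] ew sb cfg h cs; have [h1 h2] := code_at_cat h.
  have [c1 k1] := compile_expr_correct sb we ew cs (isT : nvars < tmp) h1.
  have cs1 := represents_computes (isT : nvars < tmp) k1 cs.
  have [x1 p1 v1 b1 [m1 o1]] := k1.
  rewrite size_compile_expr -p1 in h2.
  have [cv cZ cm ca co] := cs1.
  have ld : memory c1 (reg c1 tmp) = inp (eval s e) by rewrite v1 cm.
  eexists; split.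
  + by rewrite (execD _ x1) exec1 (step_load h2) ?ld //; lia.
  + by rewrite /= p1 size_cat size_compile_expr /=; lia.
  + exact: represents_setv.
  + exact: bounded_setv.
- move=> /and3P[aN we1 we2] ew sb cfg h cs; have [h1 h'] := code_at_cat h.
  have [h2 /code_at_cat[h3 h4]] :=
    @code_at_cat _ (address a tmp) (compile_expr tmp.+1 e2 ++ [:: StoreMem tmp tmp.+1]) h'.
  have ew1 : U ^ (esize e1 + 3) <= w by apply: Uw ew; apply: leq_maxl.
  have ew2 : U ^ (esize e2) <= w by apply: Uw ew; apply: leq_maxr.
  have ew1' : U ^ esize e1 <= w by apply: Uw ew1; apply: leq_addr.
  have [c1 k1] := compile_expr_correct sb we1 ew1' cs (isT : nvars < tmp) h1.
  have cs1 := represents_computes (isT : nvars < tmp) k1 cs.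
  have [x1 p1 v1 b1 [m1 o1]] := k1.
  rewrite !size_compile_expr -p1 in h2 h3 h4.
  have [_ cZ1 _ _ _] := cs1.
  have ab : Z + (narrs * eval s e1 + a) < w.
    by apply: leq_trans ew1; apply: address_lt.
  have [c2 k2] := exec_address h2 (isT : nvars < tmp) cZ1 v1 aN ab.
  have cs2 := represents_computes (isT : nvars < tmp) k2 cs1.
  have [x2 p2 v2 b2 [m2 o2]] := k2.
  rewrite -[size (address _ _)]/5 -p2 in h3 h4.
  have [c3 k3] := compile_expr_correct sb we2 ew2 cs2 (isT : nvars < tmp.+1) h3.
  have cs3 := represents_computes (isT : nvars < tmp.+1) k3 cs2.
  have [x3 p3 v3 b3 [m3 o3]] := k3.
  rewrite -p3 in h4.
  have t3 : reg c3 tmp = Z + (narrs * eval s e1 + a) by rewrite b3.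
  eexists; split.
  + have x12 : exec w P (ecost e1 + 5) cfg = Some c2 by rewrite (execD _ x1).
    rewrite (execD _ x12) (execD _ x3) exec1.
    by have := h4 0 isT; rewrite addn0 /step /current => ->.
  + by rewrite /= p3 p2 p1 !size_cat !size_compile_expr /= !size_cat !size_compile_expr /=; lia.
  + have [cv cZ cm ca co] := cs3; split=> //=.
    * move=> i iZ; rewrite t3 /upd ltn_eqF ?cm //; lia.
    * move=> b i bN; rewrite t3 v3 /upd eqn_add2l.
      have -> : (narrs * i + b == narrs * eval s e1 + a) = (b == a) && (i == eval s e1).
        by rewrite /narrs in aN bN *; apply/eqP/andP => [h5|[/eqP-> /eqP->]//]; lia.
      by case: (b =P a) => [->|_] /=; [case: eqP => // _; apply: ca|apply: ca].
  + exact: bounded_seta.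
- move=> we ew sb cfg h cs; have [h1 h2] := code_at_cat h.
  have [c1 k1] := compile_expr_correct sb we ew cs (isT : nvars < tmp) h1.
  have cs1 := represents_computes (isT : nvars < tmp) k1 cs.
  have [x1 p1 v1 b1 [m1 o1]] := k1.
  rewrite size_compile_expr -p1 in h2.
  eexists; split=> //.
  + rewrite (execD _ x1) exec1.
    by have := h2 0 isT; rewrite addn0 /step /current => ->.
  + by rewrite /= p1 size_cat size_compile_expr /=; lia.
  + by have [cv cZ cm ca co] := cs1; split=> //=; rewrite v1 co.
- move=> /andP[wf1 wf2] ew sb cfg h cs; have [h1 h2] := code_at_cat h.
  have ew1 := Uw _ _ (leq_maxl _ _) ew; have ew2 := Uw _ _ (leq_maxr _ _) ew.
  have [cfg1 [x1 p1 cs1 sb1]] := IH1 wf1 ew1 sb cfg h1 cs.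
  rewrite -p1 in h2; have [cfg2 [x2 p2 cs2 sb2]] := IH2 wf2 ew2 sb1 cfg1 h2 cs1.
  exists cfg2; split=> //; first by rewrite (execD _ x1).
  by rewrite p2 p1 size_cat addnA.
- move=> /and4P[we1 we2 wf1 wf2] ew sb cfg h cs.
  have ew12 := Uw _ _ (leq_maxl _ _) ew; have ewc := Uw _ _ (leq_maxr _ _) ew.
  have [d1 [x1 p1 [v1 v2] cs1 h1]] := compile_two_correct sb we1 we2
    (Uw _ _ (leq_maxl _ _) ew12) (Uw _ _ (leq_maxr _ _) ew12) cs h.
  have [_ h2] := @code_at_cat _ [:: JumpLt _ _ _] _ h1.
  have [_ h3] := code_at_cat h2; have h4 := code_at_behead h3.
  set q2 := compile _ c2 in h h1 h2 h3 h4 *.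
  set l1 := _ + size q2 + 1 in h h1 h2 h3 h4 *.
  pose c' := Config l1 (reg d1) (memory d1) (out d1).
  have cs' : represents s c' by case: cs1.
  have l1E : (pc d1 + 1 + size q2).+1 = l1 by rewrite /l1 p1; lia.
  rewrite -[size [:: _]]/1 l1E in h4.
  have [cfg2 [x2 p2 cs2 sb2]] := IH wf1 (Uw _ _ (leq_maxl _ _) ewc) sb c' h4 cs'.
  exists cfg2; split=> //.
  + rewrite addnA (execD _ x1) add1n (@execS _ _ c') //.
    by have := h1 0 isT; rewrite addn0 /step /current => ->; rewrite /= v1 v2 lt.
  + rewrite p2 -[pc c']/l1; code_sizes; rewrite -/q2 /l1; lia.
- move=> /and4P[we1 we2 wf1 wf2] ew sb cfg h cs.
  have ew12 := Uw _ _ (leq_maxl _ _) ew; have ewc := Uw _ _ (leq_maxr _ _) ew.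
  have [c1' [x1 p1 [v1 v2] cs1 h1]] := compile_two_correct sb we1 we2
    (Uw _ _ (leq_maxl _ _) ew12) (Uw _ _ (leq_maxr _ _) ew12) cs h.
  have [_ h2] := @code_at_cat _ [:: JumpLt _ _ _] _ h1.
  set l2 := pc cfg + ecost e1 + ecost e2 + 1 in h h1 h2 *.
  have l2E : pc c1' + 1 = l2 by rewrite /l2 p1; lia.
  rewrite -[size [:: _]]/1 l2E in h2.
  have [h3 h4] := code_at_cat h2.
  pose c' := Config l2 (reg c1') (memory c1') (out c1').
  have cs' : represents s c' by case: cs1.
  have [cfg2 [x2 p2 cs2 sb2]] := IH wf2 (Uw _ _ (leq_maxr _ _) ewc) sb c' h3 cs'.
  eexists; split; last exact: sb2.
  + rewrite addnA (execD _ x1) add1n (@execS _ _ c'); last first.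
      have := h1 0 isT; rewrite addn0 /step /current => ->.
      by rewrite /= v1 v2 ltnNge le /= -[(pc c1').+1]addn1 l2E.
    rewrite (execD _ x2) exec1.
    by have := h4 0 isT; rewrite addn0 -[l2]/(pc c') -p2 /step /current => ->.
  + by rewrite /= p2 -[pc c']/l2; code_sizes; rewrite /l2; lia.
  + by case: cs2.
- move=> /and3P[we1 we2 wf1] ew sb cfg h cs.
  have ew12 := Uw _ _ (leq_maxl _ _) ew; have ewc := Uw _ _ (leq_maxr _ _) ew.
  have [c1 [x1 p1 [v1 v2] cs1 h1]] := compile_two_correct sb we1 we2
    (Uw _ _ (leq_maxl _ _) ew12) (Uw _ _ (leq_maxr _ _) ew12) cs h.
  have [_ h2] := @code_at_cat _ [:: JumpLt _ _ _; Jump _] _ h1.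
  set l1 := pc cfg + ecost e1 + ecost e2 + 2 in h h1 h2 *.
  have l1E : pc c1 + 2 = l1 by rewrite /l1 p1; lia.
  rewrite -[size [:: _; _]]/2 l1E in h2.
  have [h3 h4] := code_at_cat h2.
  pose c' := Config l1 (reg c1) (memory c1) (out c1).
  have cs' : represents s c' by case: cs1.
  have [cfg2 [x2 p2 cs2 sb2]] := IH1 wf1 ewc sb c' h3 cs'.
  pose c'' := Config (pc cfg) (reg cfg2) (memory cfg2) (out cfg2).
  have cs'' : represents s1 c'' by case: cs2.
  have [|cfg3 [x3 p3 cs3 sb3]] := IH2 _ ew sb2 c'' h cs''; first by rewrite /= we1 we2.
  exists cfg3; split=> //.
  rewrite addnA (execD _ x1) add1n (@execS _ _ c'); last first.
    by have := h1 0 isT; rewrite addn0 /step /current => ->; rewrite /= v1 v2 lt.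
  rewrite (execD _ x2) add1n (@execS _ _ c'') //.
  by have := h4 0 isT; rewrite addn0 -[l1]/(pc c') -p2 /step /current => ->.
- move=> /and3P[we1 we2 wf1] ew sb cfg h cs.
  have ew12 := Uw _ _ (leq_maxl _ _) ew.
  have [c1 [x1 p1 [v1 v2] cs1 h1]] := compile_two_correct sb we1 we2
    (Uw _ _ (leq_maxl _ _) ew12) (Uw _ _ (leq_maxr _ _) ew12) cs h.
  pose c' := Config (pc c1).+1 (reg c1) (memory c1) (out c1).
  eexists; split; last exact: sb.
  + rewrite addnA (execD _ x1) (@execS _ _ c'); last first.
      by have := h1 0 isT; rewrite addn0 /step /current => ->; rewrite /= v1 v2 ltnNge le.
    by rewrite exec1; have := h1 1 isT; rewrite addn1 /step /current /= => ->.
  + by code_sizes; lia.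
  + by case: cs1.
Qed.

End Correctness.
End Run.

(** * Total correctness with cost bounds *)

Fixpoint written_vars (c : cmd) : seq nat :=
  match c with
  | Skip | Store _ _ _ | Emit _ => [::]
  | Assign x _ | Read x _ => [:: x]
  | Seq c1 c2 | If _ _ c1 c2 => written_vars c1 ++ written_vars c2
  | While _ _ c => written_vars c
  end.

Fixpoint written_arrs (c : cmd) : seq nat :=
  match c with
  | Skip | Assign _ _ | Read _ _ | Emit _ => [::]
  | Store a _ _ => [:: a]
  | Seq c1 c2 | If _ _ c1 c2 => written_arrs c1 ++ written_arrs c2
  | While _ _ c => written_arrs c
  end.

Fixpoint emits (c : cmd) : bool :=
  match c with
  | Emit _ => true
  | Seq c1 c2 | If _ _ c1 c2 => emits c1 || emits c2
  | While _ _ c => emits c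
  | _ => false
  end.

(** A syntactic frame condition: postconditions mention only what changes, and the rest is recovered
    by computing the written variables and arrays. *)
Definition unchanged (c : cmd) (s s' : state) : Prop :=
  [/\ forall x, x \notin written_vars c -> vars s' x = vars s x,
      forall a, a \notin written_arrs c -> arrs s' a = arrs s a
    & ~~ emits c -> outp s' = outp s].

Lemma unchanged_trans c s1 s2 s3 : unchanged c s1 s2 -> unchanged c s2 s3 -> unchanged c s1 s3.
Proof.
move=> [v1 a1 o1] [v2 a2 o2]; split=> [x h|a h|h].
- by rewrite v2 // v1.
- by rewrite a2 // a1.
- by rewrite o2 // o1.
Qed.

Lemma unchanged_sub c c' s s' :
  {subset written_vars c <= written_vars c'} -> {subset written_arrs c <= written_arrs c'} ->
  (emits c -> emits c') -> unchanged c s s' -> unchanged c' s s'.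
Proof.
move=> sv sa so [v a o]; split=> [x h|b h|h].
- by apply: v; apply: contra h; apply: sv.
- by apply: a; apply: contra h; apply: sa.
- by apply: o; apply: contra h.
Qed.

Section Logic.
Variables (Z U : nat) (inp : nat -> nat).
Local Notation run := (run Z U inp).

Lemma run_unchanged c s s' T : run c s s' T -> unchanged c s s'.
Proof.
elim=> {c s s' T} //=.
- by move=> s x e _; split=> //= y; rewrite inE /upd => /negbTE->.
- by move=> s x e _ _; split=> //= y; rewrite inE /upd => /negbTE->.
- by move=> s a e1 e2 _; split=> //= b; rewrite inE => /negbTE->.
- move=> s s1 s2 c1 c2 T1 T2 _ u1 _ u2; apply: unchanged_trans.
    by apply: unchanged_sub u1 => [x|x|] /=; rewrite ?mem_cat => ->.
  by apply: unchanged_sub u2 => [x|x|] /=; rewrite ?mem_cat => ->; rewrite orbT.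
- by move=> s s1 e1 e2 c1 c2 T _ _ u; apply: unchanged_sub u => [x|x|] /=; rewrite ?mem_cat => ->.
- by move=> s s1 e1 e2 c1 c2 T _ _ u; apply: unchanged_sub u => [x|x|] /=; rewrite ?mem_cat => ->;
    rewrite orbT.
- by move=> s s1 s2 e1 e2 c T1 T2 _ _ u1 _ u2; apply: unchanged_trans u1 u2.
Qed.

Definition tot (c : cmd) (s : state) (B : nat) (Q : state -> Prop) : Prop :=
  exists s' T, [/\ run c s s' T, T <= B & Q s'].

Lemma tot_conseq c s B B' (Q Q' : state -> Prop) :
  tot c s B Q -> B <= B' -> (forall s', unchanged c s s' -> Q s' -> Q' s') -> tot c s B' Q'.
Proof.
move=> [s' [T [r TB q]]] BB QQ; exists s', T; split=> //; first exact: leq_trans BB.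
by apply: QQ => //; apply: run_unchanged r.
Qed.

Lemma tot_skip s (Q : state -> Prop) : Q s -> tot Skip s 0 Q.
Proof. by move=> q; exists s, 0; split=> //; apply: run_skip. Qed.

Lemma tot_assign x e s (Q : state -> Prop) :
  eval s e < U -> Q (setv s x (eval s e)) -> tot (Assign x e) s (ecost e + 2) Q.
Proof. by move=> eU q; do 2!eexists; split; [apply: run_assign|..]. Qed.

Lemma tot_read x e s v (Q : state -> Prop) :
  eval s e < Z -> inp (eval s e) = v -> v < U -> Q (setv s x v) ->
  tot (Read x e) s (ecost e + 1) Q.
Proof. by move=> eZ <- iU q; do 2!eexists; split; [apply: run_read|..]. Qed.

Lemma tot_store a e1 e2 s (Q : state -> Prop) :
  eval s e2 < U -> Q (seta s a (eval s e1) (eval s e2)) ->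
  tot (Store a e1 e2) s (ecost e1 + 5 + (ecost e2 + 1)) Q.
Proof. by move=> eU q; do 2!eexists; split; [apply: run_store|..]. Qed.

Lemma tot_emit e s (Q : state -> Prop) :
  Q (emit s (eval s e)) -> tot (Emit e) s (ecost e + 1) Q.
Proof. by move=> q; do 2!eexists; split; [apply: run_emit|..]. Qed.

Lemma tot_seq c1 c2 s B1 B2 (Q : state -> Prop) :
  tot c1 s B1 (fun s1 => tot c2 s1 B2 Q) -> tot (Seq c1 c2) s (B1 + B2) Q.
Proof.
move=> [s1 [T1 [r1 b1 [s2 [T2 [r2 b2 q]]]]]]; exists s2, (T1 + T2); split=> //.
  exact: run_seq r1 r2.
exact: leq_add.
Qed.

Lemma tot_if e1 e2 c1 c2 s B (Q : state -> Prop) :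
  (eval s e1 < eval s e2 -> tot c1 s B Q) -> (eval s e2 <= eval s e1 -> tot c2 s B Q) ->
  tot (If e1 e2 c1 c2) s (ecost e1 + ecost e2 + 2 + B) Q.
Proof.
case: (ltnP (eval s e1) (eval s e2)) => h => [/(_ isT)|_ /(_ isT)] [s' [T [r TB q]]] => [_|].
  by exists s', (ecost e1 + (ecost e2 + (1 + T))); split=> //; [apply: run_if_true|lia].
by exists s', (ecost e1 + (ecost e2 + (1 + (T + 1)))); split=> //; [apply: run_if_false|lia].
Qed.

Definition For (x y : nat) (c : cmd) : cmd :=
  Seq (Assign x (Num 0))
      (While (Var x) (Var y) (Seq c (Assign x (Op Add (Var x) (Num 1))))).

(* The second argument of the invariant is the cost accumulated so far. *)
Lemma tot_for_acc x y c s N B (I : nat -> nat -> state -> Prop) :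
  x != y -> x \notin written_vars c -> y \notin written_vars c -> vars s y = N -> N < U ->
  I 0 0 (setv s x 0) ->
  (forall i C s1, i < N -> unchanged (For x y c) s s1 -> vars s1 x = i -> I i C s1 ->
     exists D, tot c s1 D (fun s2 => I i.+1 (C + D + 12) (setv s2 x i.+1))) ->
  (forall C s', I N C s' -> C <= B) ->
  tot (For x y c) s (B + 9) (fun s' => (exists C, I N C s') /\ vars s' x = N).
Proof.
move=> xy xc yc sN NU I0 Istep IB.
pose W := While (Var x) (Var y) (Seq c (Assign x (Op Add (Var x) (Num 1)))).
(* Besides its body each turn costs 12: 5 for the test, 6 for the increment, 1 for the jump back.
   The extra 6 is the final failing test; with 3 for the initialisation it makes the 9 of the
   statement. *)
have loop k i C s1 : i + k = N -> unchanged (For x y c) s s1 -> vars s1 x = i ->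
    vars s1 y = N -> I i C s1 ->
    exists s' T C', [/\ run W s1 s' T, C + T <= C' + 6, I N C' s' & vars s' x = N].
  elim: k i C s1 => [|k IH] i C s1 ik u s1x s1y Ii.
    rewrite addn0 in ik; rewrite ik in s1x Ii.
    exists s1, (ecost (Var x) + (ecost (Var y) + 2)), C; split=> //.
    by apply: (@run_while_false Z U inp); rewrite /= s1x s1y.
  have iN : i < N by rewrite -ik -addSnnS leq_addr.
  have [D [s2 [T [r TD q]]]] := Istep i C s1 iN u s1x Ii.
  have [v2 _ _] := run_unchanged r.
  have s2x : vars s2 x = i by rewrite v2.
  have s2y : vars s2 y = N by rewrite v2.
  have e2 : eval s2 (Op Add (Var x) (Num 1)) = i.+1 by rewrite /= s2x addn1.
  have ra : run (Assign x (Op Add (Var x) (Num 1))) s2 (setv s2 x i.+1) 6.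
    by rewrite -e2; apply: run_assign; rewrite e2; apply: leq_ltn_trans NU.
  have rc := run_seq r ra.
  have [|||||s' [T' [C' [r' TB' IN xN]]]] := IH i.+1 (C + D + 12) (setv s2 x i.+1).
  - by rewrite addSnnS.
  - apply: unchanged_trans u _; apply: unchanged_sub (run_unchanged rc) => [z|z|] //=.
    by rewrite mem_cat => zc; rewrite inE mem_cat zc orbT.
  - by rewrite /= /upd eqxx.
  - by rewrite /= /upd eq_sym (negbTE xy).
  - exact: q.
  have lt : eval s1 (Var x) < eval s1 (Var y) by rewrite /= s1x s1y.
  exists s', (ecost (Var x) + (ecost (Var y) + (1 + ((T + 6) + (1 + T'))))), C'; split=> //.
    exact: run_while_true lt rc r'.
  by rewrite /ecost /=; lia.
have r0 : run (Assign x (Num 0)) s (setv s x 0) 3.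
  by apply: (@run_assign Z U inp s x (Num 0)) => /=; lia.
have [|||||s' [T [C [r TB IN xN]]]] := loop N 0 0 (setv s x 0) => //.
- apply: unchanged_sub (run_unchanged r0) => [z|z|] //=.
  by rewrite !inE => ->.
- by rewrite /= /upd eqxx.
- by rewrite /= /upd eq_sym (negbTE xy).
exists s', (3 + T); split; first exact: run_seq r0 r.
  by have := IB _ _ IN; lia.
by split=> //; exists C.
Qed.

Lemma tot_for x y c s N B (I : nat -> state -> Prop) :
  x != y -> x \notin written_vars c -> y \notin written_vars c -> vars s y = N -> N < U ->
  I 0 (setv s x 0) ->
  (forall i s1, i < N -> unchanged (For x y c) s s1 -> vars s1 x = i -> I i s1 ->
     tot c s1 B (fun s2 => I i.+1 (setv s2 x i.+1))) ->
  tot (For x y c) s ((N + 1) * (B + 12)) (fun s' => I N s' /\ vars s' x = N).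
Proof.
move=> xy xc yc sN NU I0 Istep.
apply: tot_conseq (@tot_for_acc x y c s N (N * (B + 12))
  (fun i C s1 => C = i * (B + 12) /\ I i s1) xy xc yc sN NU _ _ _) _ _ => //.
- move=> i C s1 iN u s1x [CE Ii]; exists B.
  apply: tot_conseq (Istep i s1 iN u s1x Ii) (leqnn _) _ => s2 _ I2.
  by split=> //; rewrite CE mulSn; lia.
- by move=> C s' [->].
- lia.
- by move=> s' _ [[C [_ IN]] ->].
Qed.

End Logic.

(** * The listing program *)

Definition IfEq (e1 e2 : expr) (c : cmd) : cmd := If e1 e2 Skip (If e2 e1 Skip c).

Definition plus (e1 e2 : expr) : expr := Op Add e1 e2.
Definition minus (e1 e2 : expr) : expr := Op Defs.Sub e1 e2.
Definition times (e1 e2 : expr) : expr := Op Mul e1 e2.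
(** Subtraction is truncated, so every positive value counts as true and [not_ (not_ e)] normalises
    it to 1. *)
Definition not_ (e : expr) : expr := minus (Num 1) e.

(* Registers: 0 [t]; 1 [n]; 2 the degree bound [D]; 3 the row stride [D + 2]; 4 the
   length of the queue; 6 the current vertex [v]; 7 and 8 the address and the
   length of its adjacency list; 11 the number [a] of its later neighbours; 12
   [a + 1]; 13 a level of the enumeration tree; 20 one plus the current level; 21
   the child being tried; 19, 22 and 23 truth values; the others are temporary.
   Arrays: 0 degrees; 1 the queue; 2 membership in the removed vertices; 3 number
   of later neighbours; 4 the later neighbours of [u] followed by [u] (row [u]); 5
   the adjacency matrix of the later neighbours of [v]; 6 the node of the current
   branch at level [i], as a bit sequence (row [i]); 7 its next child. *)
Definition cell (x y : expr) : expr := plus (times x (Var 3)) y.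

Definition Member (w x : nat) : cmd :=
  Seq (Assign 19 (Num 0))
  (Seq (Assign 16 (Get 3 (Var w)))
       (For 15 16 (IfEq (Get 4 (cell (Var w) (Var 15))) (Var x) (Assign 19 (Num 1))))).

(** An edge between two later neighbours of [v] is recorded only in the row of its earlier end, so
    membership is tested both ways. *)
Definition Matrix : cmd :=
  For 13 11 (For 14 11
    (Seq (Assign 17 (Get 4 (cell (Var 6) (Var 13))))
    (Seq (Assign 18 (Get 4 (cell (Var 6) (Var 14))))
    (Seq (Member 17 18)
    (Seq (Assign 22 (Var 19))
    (Seq (Member 18 17)
         (Store 5 (cell (Var 13) (Var 14)) (not_ (not_ (plus (Var 22) (Var 19))))))))))).

(** [Var 21] selects the child: with 0 the row is copied, with 1 it is restricted to the neighbours
    of the new vertex, whose own bit is the selector itself. *)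
Definition Candidate : cmd :=
  Seq (For 14 13
         (Store 6 (cell (plus (Var 13) (Num 1)) (Var 14))
            (times (Get 6 (cell (Var 13) (Var 14)))
                   (not_ (times (Var 21) (not_ (Get 5 (cell (Var 14) (Var 13)))))))))
      (Store 6 (cell (plus (Var 13) (Num 1)) (Var 13)) (Var 21)).

Definition Without_ok : cmd :=
  Seq (Assign 22 (Num 0))
      (For 14 13
         (If (Num 0) (times (Get 6 (cell (Var 13) (Var 14)))
                            (not_ (Get 5 (cell (Var 14) (Var 13)))))
             (Assign 22 (Num 1)) Skip)).

(** The product is positive exactly when [conflict] holds; the truncated difference of the two
    indices expresses [c < j]. *)
Definition With_last_ok : cmd :=
  Seq (Assign 22 (Num 1))
      (For 14 13
         (Seq (Assign 17 (Num 0))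
         (Seq (For 15 13
                 (If (Num 0)
                     (times (times (Get 6 (cell (Var 13) (Var 15)))
                                   (not_ (Get 5 (cell (Var 15) (Var 14)))))
                            (plus (Get 5 (cell (Var 15) (Var 13)))
                                  (times (minus (Var 14) (Var 15))
                                         (not_ (Get 5 (cell (Var 14) (Var 13)))))))
                     (Assign 17 (Num 1)) Skip))
              (If (plus (Get 6 (cell (Var 13) (Var 14))) (Var 17)) (Num 1)
                  (Assign 22 (Num 0)) Skip)))).

Lemma cell_eq S i j i' j' : j < S -> j' < S ->
  (i * S + j == i' * S + j') = (i == i') && (j == j').
Proof.
move=> jS jS'; apply/eqP/andP => [e|[/eqP-> /eqP->]//].
have S0 : 0 < S by lia.
have /eqP := congr1 (divn^~ S) e; rewrite !divnMDl // !divn_small // !addn0 => ii.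
by split=> //; rewrite (eqP ii) in e; apply/eqP; lia.
Qed.

Lemma cell_neq S i j i' j' : j < S -> j' < S -> i != i' ->
  (i * S + j == i' * S + j') = false.
Proof. by move=> jS jS' ii; rewrite cell_eq // (negbTE ii). Qed.

Section Logic.
Variables (Z U : nat) (inp : nat -> nat).
Local Notation tot := (tot Z U inp).

Lemma tot_le c s B B' Q : tot c s B Q -> B <= B' -> tot c s B' Q.
Proof. by move=> h BB; apply: tot_conseq h BB _. Qed.

Lemma tot_use c s B (Q1 Q : state -> Prop) :
  tot c s B Q1 -> (forall s', unchanged c s s' -> Q1 s' -> Q s') -> tot c s B Q.
Proof. by move=> h QQ; apply: tot_conseq h (leqnn _) QQ. Qed.

Lemma tot_seq_use c1 c2 s B1 B2 (Q1 Q : state -> Prop) :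
  tot c1 s B1 Q1 -> (forall s', unchanged c1 s s' -> Q1 s' -> tot c2 s' B2 Q) ->
  tot (Seq c1 c2) s (B1 + B2) Q.
Proof. by move=> h QQ; apply: tot_seq; apply: tot_use h QQ. Qed.

Lemma tot_skip_le s B (Q : state -> Prop) : Q s -> tot Skip s B Q.
Proof. by move=> q; apply: tot_le (leq0n B); apply: tot_skip. Qed.

Lemma tot_ifeq e1 e2 c s B (Q : state -> Prop) :
  (eval s e1 = eval s e2 -> tot c s B Q) -> (eval s e1 <> eval s e2 -> Q s) ->
  tot (IfEq e1 e2 c) s (ecost e1 + ecost e2 + 2 + (ecost e2 + ecost e1 + 2 + B)) Q.
Proof.
move=> heq hne; apply: tot_if => h; first by apply/tot_skip_le/hne; lia.
by apply: tot_if => h'; [apply/tot_skip_le/hne; lia|apply: heq; lia].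
Qed.

Lemma has_iotaS (b : pred nat) i : has b (iota 0 i.+1) = has b (iota 0 i) || b i.
Proof. by rewrite -addn1 iotaD has_cat /= orbF add0n. Qed.

Lemma tot_any x y r v c s N B (b : pred nat) :
  [&& x != y, x \notin written_vars c, y \notin written_vars c & r != x] ->
  vars s y = N -> N < U ->
  (forall i s1, i < N -> unchanged (For x y c) s s1 -> vars s1 x = i ->
     tot c s1 B (fun s2 => vars s2 r = if b i then v else vars s1 r)) ->
  tot (For x y c) s ((N + 1) * (B + 12))
    (fun s' => vars s' r = if has b (iota 0 N) then v else vars s r).
Proof.
move=> /and4P[xy xc yc rx] sN NU step.
apply: tot_use (@tot_for Z U inp x y c s N B
    (fun i s1 => vars s1 r = if has b (iota 0 i) then v else vars s r) xy xc yc sN NU _ _) _.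
- by rewrite /= /upd (negbTE rx).
- move=> i s1 iN u s1x Ii; apply: tot_use (step i s1 iN u s1x) _ => s2 _ e.
  by rewrite has_iotaS /= /upd (negbTE rx) e Ii; case: (b i); rewrite ?orbT ?orbF.
- by move=> s' _ [].
Qed.

Section Context.
Variables (n D S : nat) (out : nat -> seq nat).
Hypotheses (SE : S = D + 2) (outD : forall u, u < n -> size (out u) <= D)
  (out_lt : forall u w, u < n -> w \in out u -> w < n)
  (SU : S < U) (nU : n < U).

(** Each row ends with its own vertex, so that all members of a clique starting at [u] are read from
    that row. *)
Definition stores_out (s : state) : Prop :=
  [/\ vars s 3 = S, forall u, u < n -> arrs s 3 u = size (out u)
    & forall u k, u < n -> k <= size (out u) ->
        arrs s 4 (u * S + k) = nth 0 (rcons (out u) u) k].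

Lemma tot_member w x s u :
  [&& w \notin [:: 15; 16; 19] & x \notin [:: 15; 16; 19]] ->
  stores_out s -> u < n -> vars s w = u ->
  tot (Member w x) s (60 * S) (fun s' => vars s' 19 = (vars s x \in out u)).
Proof.
rewrite !inE !negb_or => /andP[/and3P[w1 w2 w3] /and3P[x1 x2 x3]] [s3 soc sol] un sw.
have su := outD un.
eapply tot_le.
  apply: tot_seq; apply: tot_assign => /=; first by lia.
  apply: tot_seq; apply: tot_assign; first by rewrite /= /upd (negbTE w3) sw soc; lia.
  rewrite [eval _ _]/= /upd (negbTE w3) sw soc //.
  set s0 := setv _ 16 _.
  apply: tot_use.
    apply: (@tot_any 15 16 19 1 _ s0 (size (out u)) _
      (fun k => nth 0 (rcons (out u) u) k == vars s x)) => //; last first.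
    - move=> k s1 ku [v a _] s1k.
      have s1w : vars s1 w = u by rewrite v ?inE ?negb_or ?w1 ?w3 //= /upd (negbTE w2) (negbTE w3).
      have s1x : vars s1 x = vars s x.
        by rewrite v ?inE ?negb_or ?x1 ?x3 //= /upd (negbTE x2) (negbTE x3).
      have s13 : vars s1 3 = S by rewrite v.
      have e1 : eval s1 (Get 4 (cell (Var w) (Var 15))) = nth 0 (rcons (out u) u) k.
        by rewrite /= s1w s13 s1k a //= sol // ltnW.
      apply: tot_ifeq; rewrite e1 [eval s1 (Var x)]/= s1x => h; last by case: eqP.
      by apply: tot_assign => /=; [lia|rewrite /upd /= h eqxx].
    - by lia.
  move=> s' _ ->; suff -> : has (fun k => nth 0 (rcons (out u) u) k == vars s x)
      (iota 0 (size (out u))) = (vars s x \in out u) by case: (_ \in _).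
  apply/hasP/(nthP 0) => -[k].
    by rewrite mem_iota add0n nth_rcons => /= ku; rewrite ku => /eqP; exists k.
  by move=> ku <-; exists k; rewrite ?mem_iota // nth_rcons ku.
rewrite /ecost /=; nia.
Qed.

Section Vertex.
Variables (v : nat) (nb : nat -> seq nat).
Hypotheses (vn : v < n) (ZU : Z < U).

Let a := size (out v).

Definition local_adj (i j : nat) : bool :=
  (nth 0 (out v) j \in out (nth 0 (out v) i)) || (nth 0 (out v) i \in out (nth 0 (out v) j)).

Let aD : a < S.
Proof. by rewrite SE; have := outD vn; rewrite /a; lia. Qed.

Lemma stores_out_unchanged c s s' :
  unchanged c s s' ->
  [&& 3 \notin written_vars c, 3 \notin written_arrs c & 4 \notin written_arrs c] ->
  stores_out s -> stores_out s'.
Proof.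
move=> [hv ha _] /and3P[h1 h2 h3] [s3 soc sol]; split; first by rewrite hv.
- by rewrite ha.
- by rewrite ha.
Qed.

Lemma stores_out_setv s x k : x != 3 -> stores_out s -> stores_out (setv s x k).
Proof. by move=> x3 [s3 soc sol]; split=> //=; rewrite /upd eq_sym (negbTE x3). Qed.

Lemma tot_matrix s : stores_out s -> vars s 6 = v -> vars s 11 = a ->
  tot Matrix s (220 * S ^ 3) (fun s' =>
    forall i j, i < a -> j < a -> arrs s' 5 (i * S + j) = local_adj i j).
Proof.
move=> so s6 s11.
have outn k : k < a -> nth 0 (out v) k < n.
  by move=> ka; apply: (out_lt vn); apply: mem_nth.
have rowE k : k < a -> nth 0 (rcons (out v) v) k = nth 0 (out v) k.
  by move=> ka; rewrite nth_rcons -/a ka.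
eapply tot_le.
  apply: tot_use.
    apply: (@tot_for Z U inp 13 11 _ s a _ (fun i s1 =>
      forall i' j, i' < i -> j < a -> arrs s1 5 (i' * S + j) = local_adj i' j)) => //; first by lia.
    move=> i s1 ia u1 s1i Ii.
    have so1 := stores_out_unchanged u1 isT so.
    have [v1 _ _] := u1.
    apply: tot_use.
      apply: (@tot_for Z U inp 14 11 _ s1 a _ (fun j s2 =>
        (forall i' j', i' < i -> j' < a -> arrs s2 5 (i' * S + j') = local_adj i' j') /\
        forall j', j' < j -> arrs s2 5 (i * S + j') = local_adj i j')) => //; first by rewrite v1.
        by lia.
      move=> j s2 ja u2 s2j [Ii2 Ij].
      have so2 := stores_out_unchanged u2 isT so1.
      have [v2 _ _] := u2.
      have s26 : vars s2 6 = v by rewrite v2 // v1.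
      have s213 : vars s2 13 = i by rewrite v2.
      have [s23 _ sol] := so2.
      have e1 : eval s2 (Get 4 (cell (Var 6) (Var 13))) = nth 0 (out v) i.
        by rewrite /= s26 s23 s213 sol ?rowE // ltnW.
      apply: tot_seq; apply: tot_assign; rewrite e1; first by have := outn i ia; lia.
      set s3 := setv _ _ _.
      have e2 : eval s3 (Get 4 (cell (Var 6) (Var 14))) = nth 0 (out v) j.
        by rewrite /= /upd /= s26 s23 s2j sol ?rowE // ltnW.
      apply: tot_seq; apply: tot_assign; rewrite e2; first by have := outn j ja; lia.
      set s4 := setv _ _ _.
      apply: tot_seq_use.
        by apply: (@tot_member 17 18 s4 (nth 0 (out v) i)); rewrite ?outn.
      move=> s5 u5 r5; have [v5 a5 _] := u5.
      apply: tot_seq; apply: tot_assign; rewrite /= r5; first by lia.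
      set s6' := setv _ _ _.
      have so6 : stores_out s6'.
        by apply: stores_out_setv => //; apply: (stores_out_unchanged u5 isT).
      apply: tot_seq_use.
        by apply: (@tot_member 18 17 s6' (nth 0 (out v) j)); rewrite ?outn //= /upd /= v5.
      move=> s7 u7 r7; have [v7 a7 _] := u7.
      have e3 : eval s7 (not_ (not_ (plus (Var 22) (Var 19)))) = local_adj i j.
        rewrite /= r7 v7 //= /upd /= v5 //= /local_adj /upd /=.
        by case: (_ \in _); case: (_ \in _).
      apply: tot_store; rewrite e3; first by lia.
      have e4 : eval s7 (cell (Var 13) (Var 14)) = i * S + j.
        by rewrite /= !v7 //= /upd /= !v5 //= /upd /= s213 s2j s23.
      rewrite e4 /= a7 //= a5 //=; split=> [i' j' i'i j'a|j'].
        rewrite /upd cell_neq ?Ii2 //; [exact: ltn_trans aD|exact: ltn_trans aD|].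
        by rewrite ltn_eqF.
      rewrite ltnS leq_eqVlt /upd => /predU1P[->|j'j]; first by rewrite eqxx.
      have j'a := ltn_trans j'j ja.
      rewrite cell_eq ?eqxx ?ltn_eqF ?Ij //; exact: ltn_trans aD.
    move=> s2 u2 [[Ii2 Ij] _] i' j; rewrite ltnS leq_eqVlt => /predU1P[->|]; first exact: Ij.
    exact: Ii2.
  by move=> s' _ [].
rewrite /ecost /= !expnS; have := aD; nia.
Qed.

Definition vertex_context (s : state) : Prop :=
  [/\ stores_out s, [/\ vars s 6 = v, vars s 11 = a & vars s 12 = a.+1],
      vars s 7 = inp v /\ vars s 8 = size (nb v)
    & forall i j, i < a -> j < a -> arrs s 5 (i * S + j) = local_adj i j].

Lemma vertex_context_unchanged c s s' : unchanged c s s' ->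
  all (fun x => x \notin written_vars c) [:: 3; 6; 7; 8; 11; 12] &&
  all (fun x => x \notin written_arrs c) [:: 3; 4; 5] ->
  vertex_context s -> vertex_context s'.
Proof.
move=> u /andP[/= /and5P[h3 h6 h7 h8 /and3P[h11 h12 _]] /and4P[a3 a4 a5 _]] [so [s6 s11 s12] [s7 s8] s5].
have [hv ha _] := u; split; rewrite ?hv ?ha //.
by apply: (stores_out_unchanged u) so; rewrite h3 a3 a4.
Qed.

Lemma vertex_context_setv s x k : x \notin [:: 3; 6; 7; 8; 11; 12] ->
  vertex_context s -> vertex_context (setv s x k).
Proof.
rewrite !inE !negb_or => /and5P[h3 h6 h7 h8 /andP[h11 h12]] [so [s6 s11 s12] [s7 s8] s5].
split=> //=; last by rewrite /upd ![_ == x]eq_sym (negbTE h7) (negbTE h8).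
  exact: stores_out_setv.
by rewrite /upd ![_ == x]eq_sym (negbTE h6) (negbTE h11) (negbTE h12).
Qed.

Definition row_is (s : state) (i : nat) (bits : bitseq) : Prop :=
  size bits = i /\ forall j, j < i -> arrs s 6 (i * S + j) = nth false bits j.

Definition child (b : bool) (i : nat) (bits : bitseq) : bitseq :=
  if b then with_last local_adj i bits else without bits.

Lemma nth_child (b : bool) i bits j : size bits = i -> j < i ->
  nth false (child b i bits) j = nth false bits j && (b ==> local_adj j i).
Proof.
move=> bi ji; rewrite /child; case: b; last by rewrite (nth_without _ bi) andbT.
by rewrite (nth_with_last _ _ bi) ltn_eqF.
Qed.

Lemma tot_candidate s i (b : bool) bits :
  vertex_context s -> i < a -> vars s 13 = i -> vars s 21 = b -> row_is s i bits ->
  tot Candidate s (100 * S) (fun s' => row_is s' i.+1 (child b i bits) /\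
    forall r k, r != i.+1 -> k < S -> arrs s' 6 (r * S + k) = arrs s 6 (r * S + k)).
Proof.
move=> ctx ia s13 s21 [bi bE]; have [[s3 _ _] _ _ s5] := ctx.
eapply tot_le.
  apply: tot_seq_use.
    apply: (@tot_for Z U inp 14 13 _ s i _ (fun j s1 =>
      (forall k, k < j -> arrs s1 6 (i.+1 * S + k) = nth false (child b i bits) k) /\
      forall r k, r != i.+1 -> k < S -> arrs s1 6 (r * S + k) = arrs s 6 (r * S + k))) => //.
      by have := aD; lia.
    move=> j s1 ji u1 s1j [Ij If]; have [v1 a1 _] := u1.
    have jS : j < S by have := aD; lia.
    have w3 : vars s1 3 = S by rewrite v1.
    have w13 : vars s1 13 = i by rewrite v1.
    have w21 : vars s1 21 = b by rewrite v1.
    have w5 : arrs s1 5 = arrs s 5 by rewrite a1.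
    have e1 : eval s1 (times (Get 6 (cell (Var 13) (Var 14)))
                   (not_ (times (Var 21) (not_ (Get 5 (cell (Var 14) (Var 13))))))) =
        nth false (child b i bits) j.
      rewrite /= w13 w3 w21 s1j w5 s5 ?(ltn_trans ji ia) // If ?bE ?nth_child //.
        by case: (nth _ _ _); case: (b); case: (local_adj _ _).
      by rewrite neq_ltn ltnSn.
    apply: tot_store; rewrite e1; first by lia.
    have e2 : eval s1 (cell (plus (Var 13) (Num 1)) (Var 14)) = i.+1 * S + j.
      by rewrite /= w13 w3 s1j addn1.
    rewrite e2; split=> [k|r k ri kS] /=; rewrite /upd; last by rewrite cell_neq // If.
    rewrite ltnS leq_eqVlt => /predU1P[->|kj]; first by rewrite eqxx.
    by rewrite cell_eq // ?(ltn_trans kj) // eqxx ltn_eqF // Ij.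
  move=> s1 u1 [[Ij If] _]; have [v1 a1 _] := u1.
  apply: tot_store; first by rewrite /= v1 // s21; case: (b); lia.
  have iS : i < S by have := aD; lia.
  have e2 : eval s1 (cell (plus (Var 13) (Num 1)) (Var 13)) = i.+1 * S + i.
    by rewrite /= !v1 // s13 s3 addn1.
  have e3 : eval s1 (Var 21) = b by rewrite /= v1.
  rewrite e2 e3; split=> [|r k ri kS] /=; last by rewrite /upd cell_neq // If.
  split; first by rewrite /child; case: (b); rewrite size_rcons ?size_mkseq ?bi.
  move=> j; rewrite ltnS leq_eqVlt /= /upd => /predU1P[->|ji].
    by rewrite eqxx /child; case: (b); rewrite nth_rcons ?size_mkseq ?bi ltnn eqxx.
  by rewrite cell_eq // ?(ltn_trans ji) // eqxx ltn_eqF // Ij.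
rewrite /ecost /=; have := aD; nia.
Qed.

Lemma tot_without_ok s i bits :
  vertex_context s -> i < a -> vars s 13 = i -> row_is s i bits ->
  tot Without_ok s (80 * S) (fun s' => vars s' 22 = without_ok local_adj i bits).
Proof.
move=> ctx ia s13 [bi bE]; have [[s3 _ _] _ _ s5] := ctx.
eapply tot_le.
  apply: tot_seq; apply: tot_assign => /=; first by lia.
  set s0 := setv _ _ _.
  apply: tot_use.
    apply: (@tot_any 14 13 22 1 _ s0 i _
       (fun c => nth false bits c && ~~ local_adj c i)) => //; first by have := aD; lia.
    move=> j s1 ji u1 s1j; have [v1 a1 _] := u1.
    have e1 : eval s1 (times (Get 6 (cell (Var 13) (Var 14)))
        (not_ (Get 5 (cell (Var 14) (Var 13))))) = nth false bits j && ~~ local_adj j i.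
      have w3 : vars s1 3 = S by rewrite v1.
      have w13 : vars s1 13 = i by rewrite v1.
      rewrite /= w3 w13 s1j !a1 //= s5 ?bE ?(ltn_trans ji ia) //.
      by case: (nth _ _ _); case: (local_adj _ _).
    apply: tot_if; rewrite e1 [eval _ (Num 0)]/=; case: (_ && _) => // _.
      by apply: tot_assign => /=; [lia|].
    exact: tot_skip_le.
  by move=> s' _ ->; rewrite /without_ok; case: (has _ _).
rewrite /ecost /=; have := aD; nia.
Qed.

Lemma tot_with_last_ok s i bits :
  vertex_context s -> i < a -> vars s 13 = i -> row_is s i bits ->
  tot With_last_ok s (200 * S ^ 2) (fun s' => vars s' 22 = with_last_ok local_adj i bits).
Proof.
move=> ctx ia s13 [bi bE]; have [[s3 _ _] _ _ s5] := ctx.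
eapply tot_le.
  apply: tot_seq; apply: tot_assign => /=; first by lia.
  set s0 := setv _ _ _.
  apply: tot_use.
    apply: (@tot_any 14 13 22 0 _ s0 i _
       (predC (fun j => nth false bits j || has (conflict local_adj i bits j) (iota 0 i)))) => //.
      by have := aD; lia.
    move=> j s1 ji u1 s1j; have [v1 a1 _] := u1.
    have w3 : vars s1 3 = S by rewrite v1.
    have w13 : vars s1 13 = i by rewrite v1.
    have w5 : arrs s1 5 = arrs s 5 by rewrite a1.
    have w6 : arrs s1 6 = arrs s 6 by rewrite a1.
    apply: tot_seq; apply: tot_assign => /=; first by lia.
    set s2 := setv s1 17 0.
    apply: tot_seq_use.
      apply: (@tot_any 15 13 17 1 _ s2 i _ (conflict local_adj i bits j)) => //=.
      by have := aD; lia.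
      move=> c s3' ci u3 s3c; have [v3 a3 _] := u3.
      have x3 : vars s3' 3 = S by rewrite v3.
      have x13 : vars s3' 13 = i by rewrite v3.
      have x14 : vars s3' 14 = j by rewrite v3.
      have x5 : arrs s3' 5 = arrs s 5 by rewrite a3.
      have x6 : arrs s3' 6 = arrs s 6 by rewrite a3.
      set e := times _ _; have e1 : (0 < eval s3' e) = conflict local_adj i bits j c.
        rewrite /= x3 x13 x14 x5 x6 s3c !s5 ?bE ?(ltn_trans ji ia) ?(ltn_trans ci ia) // /conflict.
        case: (nth _ _ _); case: (local_adj c j); case: (local_adj c i) => //=.
        by case: (local_adj j i); rewrite ?andbF ?andbT /=; lia.
      rewrite -e1; apply: tot_if => h.
        have -> : 0 < eval s3' e by exact: h.
        by apply: tot_assign => /=; [lia|].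
      by apply: tot_skip_le; rewrite ltnNge h.
    move=> s3' u3 r3; have [v3 a3 _] := u3.
    have e1 : eval s3' (plus (Get 6 (cell (Var 13) (Var 14))) (Var 17)) =
        nth false bits j + has (conflict local_adj i bits j) (iota 0 i).
      have x3 : vars s3' 3 = S by rewrite v3.
      have x13 : vars s3' 13 = i by rewrite v3.
      have x14 : vars s3' 14 = j by rewrite v3.
      rewrite /= x3 x13 x14 a3 //= w6 bE //.
      by rewrite r3 /= /upd /=; case: (has _ _).
    apply: tot_if; rewrite e1 [eval _ (Num 1)]/= => h.
      apply: tot_assign => /=; [lia|rewrite /upd /=].
      by move: h; case: (nth _ _ _) => //; case: (has _ _).
    apply: tot_skip_le; rewrite v3 //= /upd /=.
    by move: h; case: (nth _ _ _) => //; case: (has _ _).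
  by move=> s' _ ->; rewrite has_predC /with_last_ok; case: (all _ _).
rewrite /ecost /= -mulnn; have := aD; nia.
Qed.

End Vertex.

End Context.
End Logic.

(** * Depth-first enumeration at one vertex *)

Lemma mask_iota (m : bitseq) (A : seq nat) : size m = size A ->
  [seq nth 0 A j | j <- iota 0 (size A) & nth false m j] = mask m A.
Proof.
elim: m A => [|b m IH] [|x A] //= [sm].
rewrite -(addn0 1) iotaDl filter_map; case: b => /=; rewrite -(IH _ sm) -map_comp //.
Qed.

Lemma has_mask_iota (m : bitseq) (A : seq nat) (p : pred nat) : size m = size A ->
  has (fun j => nth false m j && ~~ p (nth 0 A j)) (iota 0 (size A)) = ~~ all p (mask m A).
Proof.
move=> sm; rewrite -mask_iota // -has_predC has_map; apply/hasP/hasP => -[j].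
  by move=> ji /andP[mj pj]; exists j; rewrite // mem_filter mj.
by rewrite mem_filter => /andP[mj ji] /= pj; exists j; rewrite ?mj.
Qed.

(** Two passes, since the output format puts the length before the elements. *)
Definition OutputClique : cmd :=
  Seq (Assign 24 (Num 0))
  (Seq (For 14 12 (Assign 24 (plus (Var 24) (Get 6 (cell (Var 11) (Var 14))))))
  (Seq (Emit (Var 24))
       (For 14 12 (If (Num 0) (Get 6 (cell (Var 11) (Var 14)))
                      (Emit (Get 4 (cell (Var 6) (Var 14)))) Skip)))).

(** A vertex before [v] extends the clique exactly if all members, [v] included, are among its later
    neighbours. Scanning all neighbours of [v] is safe, because a later one does not have [v] among
    its later neighbours. *)
Definition Accept : cmd :=
  Seq (Store 6 (cell (Var 11) (Var 11)) (Num 1))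
  (Seq (Assign 22 (Num 1))
  (Seq (For 9 8
    (Seq (Read 10 (plus (plus (Var 7) (Num 1)) (Var 9)))
    (Seq (Assign 23 (Num 0))
    (Seq (For 14 12
            (If (Num 0) (Get 6 (cell (Var 11) (Var 14)))
                (Seq (Assign 18 (Get 4 (cell (Var 6) (Var 14))))
                (Seq (Member 10 18)
                     (If (Var 19) (Num 1) (Assign 23 (Num 1)) Skip)))
                Skip))
         (If (Var 23) (Num 1) (Assign 22 (Num 0)) Skip)))))
  (If (Num 0) (Var 22) OutputClique Skip))).

(** Arrays 6 and 7 form the recursion stack: entry [i] of array 7 is 0, 1 or 2 for trying the child
    without [i], trying the child with [i], or leaving the node. The search is over when [Var 20] is
    0. *)
Definition DfsBody : cmd :=
  Seq (Assign 13 (minus (Var 20) (Num 1)))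
  (If (Var 13) (Var 11)
    (Seq (Assign 21 (Get 7 (Var 13)))
    (If (Var 21) (Num 2)
       (Seq (Store 7 (Var 13) (plus (Var 21) (Num 1)))
       (Seq Candidate
       (Seq (If (Var 21) (Num 1) Without_ok With_last_ok)
            (If (Num 0) (Var 22)
                (Seq (Store 7 (plus (Var 13) (Num 1)) (Num 0))
                     (Assign 20 (plus (Var 20) (Num 1))))
                Skip))))
       (Assign 20 (Var 13))))
    (Seq Accept (Assign 20 (Var 13)))).

Definition Dfs : cmd :=
  Seq (Store 7 (Num 0) (Num 0))
  (Seq (Assign 20 (Num 1))
       (While (Num 0) (Var 20) DfsBody)).

Section Enumeration.
Variables (Z U : nat) (inp : nat -> nat).
Local Notation tot := (tot Z U inp).
Variables (n D S : nat) (out : nat -> seq nat).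
Hypotheses (SE : S = D + 2) (outD : forall u, u < n -> size (out u) <= D)
  (out_lt : forall u w, u < n -> w \in out u -> w < n)
  (SU : S < U) (nU : n < U).
Variables (v : nat) (nb : nat -> seq nat).
Hypotheses (vn : v < n) (ZU : Z < U)
  (nb_lt : forall w, w \in nb v -> w < n) (nbU : size (nb v) < U)
  (nb_inp : forall j, j < size (nb v) ->
     inp v + 1 + j < Z /\ inp (inp v + 1 + j) = nth 0 (nb v) j).

Let a := size (out v).
Let A := rcons (out v) v.
Let aD : a < D.+1. Proof. by rewrite ltnS outD. Qed.

Local Notation context := (vertex_context inp n S out v nb).
Local Notation adj := (local_adj out v).

Definition members (bits : bitseq) : seq nat := mask (rcons bits true) A.

Definition accepted (bits : bitseq) : bool :=
  ~~ has (fun w => all (mem (out w)) (members bits)) (nb v).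

Definition full_row (s : state) (bits : bitseq) : Prop :=
  forall j, j < a.+1 -> arrs s 6 (a * S + j) = nth false (rcons bits true) j.

Lemma context_A s j : context s -> j < a.+1 -> arrs s 4 (v * S + j) = nth 0 A j.
Proof. by move=> [[_ _ sol] _ _ _] ja; rewrite sol. Qed.

Lemma nth_A_lt j : j < a.+1 -> nth 0 A j < n.
Proof.
rewrite ltnS leq_eqVlt => /predU1P[->|ja]; rewrite nth_rcons ?ltnn ?eqxx // -/a ja.
by apply: (out_lt vn); apply: mem_nth.
Qed.

Lemma tot_output_clique s bits : size bits = a -> context s -> full_row s bits ->
  tot OutputClique s (100 * S)
    (fun s' => outp s' = outp s ++ size (members bits) :: members bits).
Proof.
move=> sb ctx rowE; have [[s3 _ _] [s6 s11 s12] _ _] := ctx.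
set m := rcons bits true in rowE.
have sm : size m = size A by rewrite !size_rcons sb.
have sA : size A = a.+1 by rewrite size_rcons.
pose pre j := [seq nth 0 A k | k <- iota 0 j & nth false m k].
have preS j : pre j.+1 = pre j ++ (if nth false m j then [:: nth 0 A j] else [::]).
  rewrite /pre -addn1 iotaD filter_cat map_cat add0n /=.
  by case: (nth false m j).
eapply tot_le.
  apply: tot_seq; apply: tot_assign => /=; first by lia.
  apply: tot_seq_use.
    apply: (@tot_for Z U inp 14 12 _ (setv s 24 0) a.+1 _
      (fun j s1 => vars s1 24 = size (pre j))) => //.
      by lia.
    move=> j s1 ja u1 s1j Ij; have [v1 a1 _] := u1.
    have e1 : eval s1 (plus (Var 24) (Get 6 (cell (Var 11) (Var 14)))) = size (pre j.+1).
      have w3 : vars s1 3 = S by rewrite v1.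
      have w11 : vars s1 11 = a by rewrite v1.
      rewrite /= Ij w11 w3 s1j a1 //= rowE // preS size_cat.
      by case: (nth _ _ _).
    apply: tot_assign; rewrite e1 //.
    rewrite size_map size_filter (leq_ltn_trans (count_size _ _)) // size_iota; lia.
  move=> s1 u1 [I1 _]; have [v1 a1 o1] := u1.
  apply: tot_seq; apply: tot_emit; rewrite [eval _ _]/= I1.
  apply: tot_use.
    apply: (@tot_for Z U inp 14 12 _ (emit s1 (size (pre a.+1))) a.+1 _
      (fun j s2 => outp s2 = rcons (outp s) (size (pre a.+1)) ++ pre j)) => //.
    - by rewrite /= v1.
    - by lia.
    - by rewrite /= o1 // /pre /= cats0.
    move=> j s2 ja u2 s2j Ij; have [v2 a2 _] := u2.
    have w3 : vars s2 3 = S by rewrite v2 //= v1.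
    have w6 : vars s2 6 = v by rewrite v2 //= v1.
    have w11 : vars s2 11 = a by rewrite v2 //= v1.
    have e1 : eval s2 (Get 6 (cell (Var 11) (Var 14))) = nth false m j.
      by rewrite /= w11 w3 s2j a2 //= a1 //= rowE.
    apply: tot_if; rewrite e1 [eval _ (Num 0)]/= => h.
      apply: tot_emit => /=; rewrite Ij (preS j) w6 w3 s2j a2 //= a1 //= (context_A ctx) //.
      by move: h; case: (nth _ _ _) => // _; rewrite catA cats1.
    apply: tot_skip_le; rewrite /= Ij (preS j); move: h; case: (nth _ _ _) => //.
    by rewrite cats0.
  move=> s2 u2 [-> _]; rewrite -cats1 -catA /=; rewrite /members -/m -mask_iota //.
  by rewrite sA.
rewrite /ecost /=; lia.
Qed.

Lemma tot_accept s bits : context s -> row_is S s a bits ->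
  tot Accept s (200 * ((size (nb v) + 1) * S ^ 2)) (fun s' =>
    outp s' = outp s ++ (if accepted bits then size (members bits) :: members bits else [::]) /\
    forall r k, r != a -> k < S -> arrs s' 6 (r * S + k) = arrs s 6 (r * S + k)).
Proof.
move=> ctx [sb rowE]; have [[s3 _ _] [s6 s11 s12] [s7 s8] _] := ctx.
set m := rcons bits true.
have sm : size m = size A by rewrite !size_rcons sb.
have sA : size A = a.+1 by rewrite size_rcons.
eapply tot_le.
  apply: tot_seq; apply: tot_store => /=; first by lia.
  rewrite s3 s11; set s0 := seta _ _ _ _.
  have full0 : full_row s0 bits.
    move=> j; rewrite ltnS leq_eqVlt /= /upd nth_rcons sb => /predU1P[->|ja].
      by rewrite !eqxx ltnn.
    by rewrite eqn_add2l ltn_eqF // ja rowE.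
  have other0 r k : r != a -> k < S -> arrs s0 6 (r * S + k) = arrs s 6 (r * S + k).
    by move=> ra kS; rewrite /= /upd (cell_neq kS) //; lia.
  have ctx0 : context s0 by [].
  apply: tot_seq; apply: tot_assign => /=; first by lia.
  apply: tot_seq_use.
    apply: (@tot_any Z U inp 9 8 22 0 _ (setv s0 22 1) (size (nb v)) _
      (fun p => all (mem (out (nth 0 (nb v) p))) (members bits))) => //.
    move=> p s1 pd u1 s1p; have [v1 a1 _] := u1.
    have ctx1 : context s1.
      by apply: (vertex_context_unchanged u1 isT); apply: vertex_context_setv.
    have [pZ pE] := nb_inp pd; have wn : nth 0 (nb v) p < n by apply/nb_lt/mem_nth.
    have full1 : full_row s1 bits by move=> j ja; rewrite a1 // full0.
    have [_ _ [w7 _] _] := ctx1.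
    apply: tot_seq; apply: tot_read.
    - by rewrite /= w7 s1p.
    - by rewrite /= w7 s1p; apply: pE.
    - by lia.
    apply: tot_seq; apply: tot_assign => /=; first by lia.
    set s2 := setv _ 23 0.
    have ctx2 : context s2 by do 2!apply: vertex_context_setv => //.
    apply: tot_seq_use.
      apply: (@tot_any Z U inp 14 12 23 1 _ s2 a.+1 _
        (fun j => nth false m j && ~~ (nth 0 A j \in out (nth 0 (nb v) p)))) => //.
      + by have [_ []] := ctx2.
      + by lia.
      move=> j s3' ja u3 s3j; have [v3 a3 _] := u3.
      have ctx3 : context s3' := vertex_context_unchanged u3 isT ctx2.
      have [so3 [x6 x11 _] _ _] := ctx3; have [x3 _ _] := so3.
      have full3 : arrs s3' 6 (a * S + j) = nth false m j by rewrite a3 // full1.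
      have e1 : eval s3' (Get 6 (cell (Var 11) (Var 14))) = nth false m j.
        by rewrite /= x11 x3 s3j.
      apply: tot_if; rewrite e1 [eval _ (Num 0)]/= => h; last first.
        by apply: tot_skip_le; move: h; case: (nth _ _ _).
      have -> : nth false m j = true by move: h; case: (nth _ _ _).
      have e2 : eval s3' (Get 4 (cell (Var 6) (Var 14))) = nth 0 A j.
        by rewrite /= x6 x3 s3j (context_A ctx3).
      apply: tot_seq; apply: tot_assign; rewrite e2; first by have := nth_A_lt ja; lia.
      apply: tot_seq_use.
        apply: (@tot_member Z U inp n D S out SE outD SU nU 10 18 _ (nth 0 (nb v) p)) => //.
        by rewrite /= /upd /= v3.
      move=> s4 u4 r4; have [v4 a4 _] := u4.
      apply: tot_if; rewrite [eval _ (Var 19)]/= [eval _ (Num 1)]/= r4 /= /upd /= => h'.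
        apply: tot_assign => /=; first by lia.
        by move: h'; case: (_ \in _).
      apply: tot_skip_le; rewrite v4 //= /upd /=.
      by move: h'; case: (_ \in _).
    move=> s3' u3 r3; have [v3 a3 _] := u3.
    have r3' : vars s3' 23 = ~~ all (mem (out (nth 0 (nb v) p))) (members bits).
      by rewrite r3 -sA has_mask_iota //= /upd /=; case: (all _ _).
    have r22 : vars s3' 22 = vars s1 22 by rewrite v3.
    apply: tot_if; rewrite [eval _ (Var 23)]/= [eval _ (Num 1)]/= r3' => h.
      apply: tot_assign => /=; first by lia.
      by move: h; case: (all _ _).
    by apply: tot_skip_le; move: h; case: (all _ _).
  move=> s1 u1 r1; have [v1 a1 o1] := u1.
  have ctx1 : context s1.
    by apply: (vertex_context_unchanged u1 isT); apply: vertex_context_setv.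
  have r1' : vars s1 22 = accepted bits.
    rewrite r1 /= /upd /= /accepted.
    have -> : has (fun w => all (mem (out w)) (members bits)) (nb v) =
        has (fun p => all (mem (out (nth 0 (nb v) p))) (members bits)) (iota 0 (size (nb v))).
      by rewrite -{1}(mkseq_nth 0 (nb v)) /mkseq has_map.
    by case: (has _ _).
  have o1' : outp s1 = outp s by rewrite o1.
  have other1 r k : r != a -> k < S -> arrs s1 6 (r * S + k) = arrs s 6 (r * S + k).
    by move=> ra kS; rewrite a1 // other0.
  have full1 : full_row s1 bits by move=> j ja; rewrite a1 // full0.
  apply: tot_if; rewrite [eval _ (Num 0)]/= [eval _ (Var 22)]/= r1' => h.
    apply: tot_use (tot_output_clique sb ctx1 full1) _ => s2 [_ a2 _] ->.
    rewrite o1'; split; first by move: h; case: (accepted _).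
    by move=> r k ra kS; rewrite a2 // other1.
  apply: tot_skip_le; split=> //; rewrite o1'; move: h; case: (accepted _) => //.
  by rewrite cats0.
rewrite /ecost /= -mulnn; nia.
Qed.

Definition step_ok (b : bool) (i : nat) (bits : bitseq) : bool :=
  if b then with_last_ok adj i bits else without_ok adj i bits.

Let cost := 600 * ((size (nb v) + 1) * S ^ 2).

(** What survives the treatment of a node at level [i]: its subtree overwrites only rows and
    counters from [i] on. *)
Definition below (i : nat) (s s' : state) : Prop :=
  (forall r, r < i -> arrs s' 7 r = arrs s 7 r) /\
  (forall r k, r < i -> k < S -> arrs s' 6 (r * S + k) = arrs s 6 (r * S + k)).

Let S_cost c : c <= 600 * S -> c <= cost.
Proof.
have S0 : 0 < S by lia.
by move=> h; apply: leq_trans h _; rewrite /cost -mulnn; nia.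
Qed.

Lemma tot_stage s i (b : bool) bits : context s -> i < a -> vars s 20 = i.+1 ->
  arrs s 7 i = b -> row_is S s i bits ->
  tot DfsBody s cost (fun s' =>
    [/\ context s', outp s' = outp s, arrs s' 7 i = b.+1,
        (forall r, r < i -> arrs s' 7 r = arrs s 7 r) /\
        (forall r k, r < i.+1 -> k < S -> arrs s' 6 (r * S + k) = arrs s 6 (r * S + k))
      & if step_ok b i bits then
          [/\ vars s' 20 = i.+2, row_is S s' i.+1 (child out v b i bits) & arrs s' 7 i.+1 = 0]
        else vars s' 20 = i.+1]).
Proof.
move=> ctx ia s20 s7 rowi; have [[s3 _ _] [s6 s11 s12] _ _] := ctx.
eapply tot_le.
  apply: tot_seq; apply: tot_assign; rewrite /= s20 subn1 /=; first by lia.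
  set s1 := setv s 13 i.
  have ctx1 : context s1 by apply: vertex_context_setv.
  apply: tot_if => /=; rewrite /upd /= s11 => h; last by lia.
  apply: tot_seq; apply: tot_assign; rewrite /= /upd /= s7; first by case: (b); lia.
  set s2 := setv s1 21 b.
  have ctx2 : context s2 by apply: vertex_context_setv.
  apply: tot_if => /=; rewrite /upd /= => h'; last by case: (b) h'.
  apply: tot_seq; apply: tot_store; rewrite /= /upd /=; first by case: (b); lia.
  set s3' := seta _ _ _ _.
  have ctx3 : context s3' by [].
  have row3 : row_is S s3' i bits by [].
  apply: tot_seq_use.
    by apply: (@tot_candidate Z U inp n D S out SE outD SU nU v nb vn ZU s3' i b bits).
  move=> s4 u4 [row4 other4]; have [v4 a4 o4] := u4.
  have ctx4 : context s4 by apply: (vertex_context_unchanged u4).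
  have row4i : row_is S s4 i bits.
    have [bi bE] := rowi; split=> // j ji; rewrite other4; first exact: bE.
      by rewrite neq_ltn ltnSn.
    by rewrite SE; have := aD; lia.
  apply: tot_seq_use (_ : tot _ s4 _ (fun s5 => vars s5 22 = step_ok b i bits)) _.
    apply: tot_if; rewrite [eval _ (Num 1)]/= [eval _ (Var 21)]/= v4 //= /upd /=.
      case: (b) => // _; rewrite /step_ok.
      apply: tot_le (_ : _ <= 200 * S ^ 2).
        by apply: (@tot_without_ok Z U inp n D S out SE outD SU nU v nb vn ZU) => //; rewrite v4.
      by rewrite -mulnn; nia.
    case: (b) => // _; rewrite /step_ok.
    by apply: (@tot_with_last_ok Z U inp n D S out SE outD SU nU v nb vn ZU) => //; rewrite v4.
  move=> s5 u5 r5; have [v5 a5 o5] := u5.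
  have ctx5 : context s5 by apply: (vertex_context_unchanged u5).
  have w7 : arrs s5 7 = arrs s3' 7 by rewrite a5 // a4.
  have w20 : vars s5 20 = i.+1 by rewrite v5 //= v4.
  have w13 : vars s5 13 = i by rewrite v5 //= v4.
  have wo : outp s5 = outp s by rewrite o5 // o4.
  have w6 r k : r < i.+1 -> k < S -> arrs s5 6 (r * S + k) = arrs s 6 (r * S + k).
    by move=> ri kS; rewrite a5 // other4 // neq_ltn ri.
  have st_i : arrs s5 7 i = b.+1 by rewrite w7 /= /upd /= eqxx addn1.
  have st_r r : r < i -> arrs s5 7 r = arrs s 7 r.
    by move=> ri; rewrite w7 /= /upd /= ltn_eqF.
  apply: tot_if; rewrite [eval _ (Num 0)]/= [eval _ (Var 22)]/= r5.
    case E: (step_ok b i bits) => // _.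
    apply: tot_seq; apply: tot_store => /=; first by lia.
    apply: tot_assign => /=; rewrite ?w20 ?w13 ?addn1; first by lia.
    split=> //=; rewrite /upd /=.
    - by rewrite ltn_eqF.
    - split=> // r ri; rewrite ltn_eqF ?st_r //; lia.
    - split=> //; last by rewrite eqxx.
      by have [z1 z2] := row4; split=> // j ji; rewrite /= a5 // z2.
  case E: (step_ok b i bits) => // _.
  by apply: tot_skip_le.
by rewrite /ecost /= /cost -mulnn; nia.
Qed.

Lemma tot_pop s i : context s -> i < a -> vars s 20 = i.+1 -> arrs s 7 i = 2 ->
  tot DfsBody s cost (fun s' => [/\ context s', outp s' = outp s, arrs s' = arrs s & vars s' 20 = i]).
Proof.
move=> ctx ia s20 s7; have [_ [_ s11 _] _ _] := ctx.
eapply tot_le.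
  apply: tot_seq; apply: tot_assign; rewrite /= s20 subn1 /=; first by lia.
  apply: tot_if => /=; rewrite /upd /= s11 => h; last by lia.
  apply: tot_seq; apply: tot_assign; rewrite /= /upd /= s7; first by lia.
  apply: tot_if => //= _.
  apply: tot_assign; rewrite /= /upd /=; first by lia.
  by split=> //; do 3!apply: vertex_context_setv => //.
by apply: S_cost; rewrite /ecost /=; lia.
Qed.

Lemma tot_leaf s bits : context s -> vars s 20 = a.+1 -> row_is S s a bits ->
  tot DfsBody s cost (fun s' => [/\ context s', vars s' 20 = a, below a s s' &
    outp s' = outp s ++ (if accepted bits then size (members bits) :: members bits else [::])]).
Proof.
move=> ctx s20 rowa; have [_ [_ s11 _] _ _] := ctx.
eapply tot_le.
  apply: tot_seq; apply: tot_assign; rewrite /= s20 subn1 /=; first by lia.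
  set s1 := setv s 13 a.
  have ctx1 : context s1 by apply: vertex_context_setv.
  apply: tot_if => /=; rewrite /upd /= s11 => h; first by rewrite ltnn in h.
  apply: tot_seq_use.
    exact: (@tot_accept s1 bits).
  move=> s2 u2 [o2 other]; have [v2 a2 _] := u2.
  apply: tot_assign; rewrite [eval _ _]/= v2 //= /upd /=; first by lia.
  split=> //; first by apply/vertex_context_setv/(vertex_context_unchanged u2).
  split=> [r ra|r k ra kS]; first by rewrite /= a2.
  by rewrite /= other // neq_ltn ra.
by rewrite /ecost /= /cost -mulnn; nia.
Qed.

(** Segments of the loop without the exit test. Unlike runs of the whole [While] they compose, which
    allows induction over subtrees. *)
Inductive iterations : state -> state -> nat -> Prop :=
| iterations0 s : iterations s s 0
| iterationsS s s1 s2 T1 T2 : 0 < vars s 20 -> run Z U inp DfsBody s s1 T1 ->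
    iterations s1 s2 T2 -> iterations s s2 (T1 + T2 + 5).

Lemma iterations_trans s s1 s2 T1 T2 :
  iterations s s1 T1 -> iterations s1 s2 T2 -> iterations s s2 (T1 + T2).
Proof.
elim=> // {s s1 T1} s s1 s3 T1 T3 pos r _ IH it.
have -> : T1 + T3 + 5 + T2 = T1 + (T3 + T2) + 5 by lia.
by apply: iterationsS pos r _; apply: IH.
Qed.

Lemma iterations1 s c (Q : state -> Prop) : 0 < vars s 20 -> tot DfsBody s c Q ->
  exists s' T, [/\ iterations s s' T, T <= c + 6 & Q s'].
Proof.
move=> pos [s' [T [r Tc q]]]; exists s', (T + 0 + 5); split=> //; last by lia.
exact: iterationsS pos r (iterations0 s').
Qed.

Definition listing (l : seq bitseq) : seq nat :=
  flatten [seq if accepted bits then size (members bits) :: members bits else [::] | bits <- l].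

Lemma listing_cat l1 l2 : listing (l1 ++ l2) = listing l1 ++ listing l2.
Proof. by rewrite /listing map_cat flatten_cat. Qed.

(** At most three iterations work on a node itself, one per child and one to leave it, whence the
    factor 3. *)
Lemma dfs_node k i bits s : i + k = a -> context s -> vars s 20 = i.+1 ->
  row_is S s i bits -> arrs s 7 i = 0 ->
  exists s' T, [/\ iterations s s' T, T <= 3 * (cost + 6) * tree_size adj k i bits,
    context s' /\ vars s' 20 = i, outp s' = outp s ++ listing (descendants adj k i bits)
    & below i s s'].
Proof.
elim: k i bits s => [|k IH] i bits s ik ctx s20 rowi s7.
  rewrite addn0 in ik; subst i.
  have [|s' [T [it Tc [ctx' v' bel o']]]] := iterations1 _ (tot_leaf ctx s20 rowi).
    by rewrite s20.
  exists s', T; split=> //=; first by lia.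
  by rewrite o' /listing /= cats0.
have ia : i < a by lia.
(* One child is tried and, if it is accepted, its whole subtree is treated; this is used for both
   values of [b] in turn. *)
have half (b : bool) s1 : context s1 -> vars s1 20 = i.+1 -> arrs s1 7 i = b -> row_is S s1 i bits ->
    exists s' T, [/\ iterations s1 s' T,
      T <= (cost + 6) + 3 * (cost + 6) *
         (if step_ok b i bits then tree_size adj k i.+1 (child out v b i bits) else 0),
      [/\ context s', vars s' 20 = i.+1, arrs s' 7 i = b.+1 & row_is S s' i bits],
      outp s' = outp s1 ++ listing (if step_ok b i bits
         then descendants adj k i.+1 (child out v b i bits) else [::])
      & below i s1 s'].
  move=> ctx1 s120 s17 row1.
  have [|s2 [T [it Tc [ctx2 o2 st2 [r2 m2] nx]]]] := iterations1 _ (tot_stage ctx1 ia s120 s17 row1).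
    by rewrite s120.
  have row_keep s' : (forall r k, r < i.+1 -> k < S -> arrs s' 6 (r * S + k) = arrs s1 6 (r * S + k)) ->
      row_is S s' i bits.
    have [z1 z2] := row1; move=> keep; split=> // j ji; rewrite keep ?z2 //.
    by rewrite SE; have := aD; lia.
  case: (step_ok b i bits) nx => [[s220 row2 st0]|s220]; last first.
    exists s2, T; split=> //; first by lia.
    - by split=> //; apply: row_keep.
    - by rewrite o2 /listing /= cats0.
    - by split=> // r k' ri; apply: m2; apply: ltnW.
  have [|s3 [T3 [it3 T3c [ctx3 s320] o3 [st3 m3]]]] := IH i.+1 _ s2 _ ctx2 s220 row2 st0.
    by rewrite addSnnS.
  exists s3, (T + T3); split.
  - exact: iterations_trans it it3.
  - by lia.
  - split=> //; first by rewrite st3.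
    by apply: row_keep => r k' ri kS; rewrite m3 // m2.
  - by rewrite o3 o2.
  - split=> [r ri|r k' ri kS]; first by rewrite st3 ?r2 // ltnW.
    by rewrite m3 ?m2 // ltnW.
have [s1 [T1 [it1 T1c [ctx1 s120 st1 row1] o1 [b1 m1]]]] := half false s ctx s20 s7 rowi.
have [s2 [T2 [it2 T2c [ctx2 s220 st2 row2] o2 [b2 m2]]]] := half true s1 ctx1 s120 st1 row1.
have [|s3 [T3 [it3 T3c [ctx3 o3 a3 s320]]]] := iterations1 _ (tot_pop ctx2 ia s220 st2).
  by rewrite s220.
exists s3, (T1 + (T2 + T3)); split=> //.
- by apply: iterations_trans it1 _; apply: iterations_trans it2 it3.
- rewrite /= /children map_cat sumn_cat.
  move: T1c T2c; rewrite /step_ok /child.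
  case: (without_ok _ _ _); case: (with_last_ok _ _ _) => /=; lia.
- rewrite o3 o2 o1 -catA -listing_cat; congr (_ ++ listing _).
  rewrite /= /children map_cat flatten_cat /step_ok /child.
  by case: (without_ok _ _ _); case: (with_last_ok _ _ _) => /=; rewrite ?cats0.
- split=> [r ri|r k' ri kS]; first by rewrite a3 b2 ?b1.
  by rewrite a3 m2 ?m1.
Qed.

Lemma tot_dfs s : context s ->
  tot Dfs s (4 * (cost + 6) * tree_size adj a 0 [::]) (fun s' =>
    context s' /\ outp s' = outp s ++ listing (descendants adj a 0 [::])).
Proof.
move=> ctx.
pose s1 := setv (seta s 7 0 0) 20 1.
have ctx1 : context s1 by apply: vertex_context_setv.
have [||||s' [T [it Tc [ctx' s'20] o' _]]] := @dfs_node a 0 [::] s1 _ ctx1 => //.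
have loop u u' T' : iterations u u' T' -> vars u' 20 = 0 ->
    run Z U inp (While (Num 0) (Var 20) DfsBody) u u' (T' + 5).
  elim=> {u u' T'} [u z|u u1 u2 T1 T2 pos r _ IHr z].
    by apply: (@run_while_false Z U inp u (Num 0) (Var 20)); rewrite /= z.
  have -> : T1 + T2 + 5 + 5 = 1 + (2 + (1 + (T1 + (1 + (T2 + 5))))) by lia.
  exact: (run_while_true (e1 := Num 0) (e2 := Var 20) pos r (IHr z)).
have r1 : run Z U inp (Store 7 (Num 0) (Num 0)) s (seta s 7 0 0) 8.
  by apply: (@run_store Z U inp s 7 (Num 0) (Num 0)) => /=; lia.
have r2 : run Z U inp (Assign 20 (Num 1)) (seta s 7 0 0) s1 3.
  by apply: (@run_assign Z U inp (seta s 7 0 0) 20 (Num 1)) => /=; lia.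
exists s', (8 + (3 + (T + 5))); split=> //; first exact: run_seq r1 (run_seq r2 (loop _ _ _ it s'20)).
have : 0 < tree_size adj a 0 [::] by case: (a).
by move: Tc; set N := tree_size _ _ _ _; nia.
Qed.

End Enumeration.

(** * Degeneracy order by peeling *)

Definition Push (x : nat) : cmd :=
  Seq (Store 1 (Var 4) (Var x)) (Assign 4 (plus (Var 4) (Num 1))).

Definition Degrees : cmd :=
  For 5 1
    (Seq (Read 7 (Var 5))
    (Seq (Read 8 (Var 7))
    (Seq (Store 0 (Var 5) (Var 8))
         (If (Var 2) (Var 8) Skip (Push 5))))).

Definition PeelNeighbour : cmd :=
  Seq (Read 10 (plus (plus (Var 7) (Num 1)) (Var 9)))
      (If (Get 2 (Var 10)) (Num 1)
        (Seq (Store 4 (cell (Var 6) (Get 3 (Var 6))) (Var 10))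
        (Seq (Store 3 (Var 6) (plus (Get 3 (Var 6)) (Num 1)))
        (Seq (Store 0 (Var 10) (minus (Get 0 (Var 10)) (Num 1)))
             (IfEq (Get 0 (Var 10)) (Var 2) (Push 10)))))
        Skip).

Definition Peel : cmd :=
  For 5 1
    (Seq (Assign 6 (Get 1 (Var 5)))
    (Seq (Store 2 (Var 6) (Num 1))
    (Seq (Read 7 (Var 6))
    (Seq (Read 8 (Var 7))
    (Seq (For 9 8 PeelNeighbour)
         (Store 4 (cell (Var 6) (Get 3 (Var 6))) (Var 6))))))).

Section Order.
Variable nb : nat -> seq nat.

Definition live (ps : seq nat) (u : nat) : nat := count (fun w => w \notin ps) (nb u).

(** A vertex absent from [ps] has index [size ps] and counts as later, so the list of a removed
    vertex is final from the moment of its removal. *)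
Definition later (ps : seq nat) (u : nat) : seq nat :=
  [seq w <- nb u | index u ps < index w ps].

Lemma later_rcons ps v u : u \in ps -> later (rcons ps v) u = later ps u.
Proof.
move=> ups; apply: eq_filter => w; rewrite -cats1 !index_cat ups.
have ups' : index u ps < size ps by rewrite index_mem.
case: ifP => // wps; rewrite (leq_trans ups') ?leq_addr //.
by rewrite (memNindex (negbT wps)) ups'.
Qed.

Lemma later_last ps v : v \notin ps ->
  later (rcons ps v) v = [seq w <- nb v | w \notin rcons ps v].
Proof.
move=> vps; apply: eq_filter => w; rewrite -cats1 !index_cat (negbTE vps) mem_cat inE /= eqxx addn0.
case: (boolP (w \in ps)) => wps /=; first by rewrite ltnNge index_size.
by rewrite eq_sym; case: eqP => /= _; rewrite ?addn0 ?ltnn // addn1 ltnSn.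
Qed.

Section Peeling.
Variables (Z U : nat) (inp : nat -> nat).
Local Notation tot := (tot Z U inp).
Variables (n D S : nat).
Hypotheses (SE : S = D + 2) (SU : S < U) (nU : n < U) (ZU : Z < U).
Hypotheses (nb_uniq : forall v, v < n -> uniq (nb v))
  (nb_lt : forall v w, v < n -> w \in nb v -> w < n)
  (nb_sym : forall v w, v < n -> w < n -> (v \in nb w) = (w \in nb v))
  (nb_size : forall v, v < n -> size (nb v) < U)
  (inp_addr : forall v, v < n -> v < Z /\ inp v < Z)
  (inp_size : forall v, v < n -> inp (inp v) = size (nb v))
  (inp_nb : forall v j, v < n -> j < size (nb v) ->
     inp v + 1 + j < Z /\ inp (inp v + 1 + j) = nth 0 (nb v) j)
  (peelable : forall ps, uniq ps -> {in ps, forall u, u < n} -> size ps < n ->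
     exists u, [/\ u < n, u \notin ps & live ps u <= D]).

Definition queue_is (s : state) (q : seq nat) : Prop :=
  vars s 4 = size q /\ forall i, i < size q -> arrs s 1 i = nth 0 q i.

Lemma queue_size q : uniq q -> {in q, forall u, u < n} -> size q <= n.
Proof.
move=> uq qn; have := uniq_leq_size uq (s2 := iota 0 n); rewrite size_iota; apply.
by move=> x /qn xn; rewrite mem_iota.
Qed.

Lemma tot_push x s q u : x != 4 -> vars s x = u -> u < n -> queue_is s q ->
  size q < n ->
  tot (Push x) s 30 (fun s' => [/\ queue_is s' (rcons q u),
     forall y, y != 4 -> vars s' y = vars s y & forall b, b != 1 -> arrs s' b = arrs s b]).
Proof.
move=> x4 sx un [s4 qE] qn.
eapply tot_le.
  apply: tot_seq; apply: tot_store => /=; rewrite ?sx ?s4; first by lia.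
  apply: tot_assign; rewrite /= s4; first by lia.
  split=> [|y y4|b b1] /=; last by rewrite (negbTE b1).
    split; first by rewrite /= size_rcons addn1.
    move=> i; rewrite size_rcons ltnS leq_eqVlt /= /upd nth_rcons => /predU1P[->|iq].
      by rewrite !eqxx ltnn.
    by rewrite ltn_eqF // iq qE.
  by rewrite /upd (negbTE y4).
by [].
Qed.

Lemma tot_degrees s : vars s 1 = n -> vars s 2 = D -> vars s 4 = 0 ->
  tot Degrees s ((n + 1) * 100) (fun s' =>
    queue_is s' [seq u <- iota 0 n | size (nb u) <= D] /\
    forall u, u < n -> arrs s' 0 u = size (nb u)).
Proof.
move=> s1n s2D s40.
eapply tot_le.
  apply: tot_use.
    apply: (@tot_for Z U inp 5 1 _ s n _ (fun i s1 =>
      queue_is s1 [seq u <- iota 0 i | size (nb u) <= D] /\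
      forall u, u < i -> arrs s1 0 u = size (nb u))) => //.
    move=> i s1 iN u1 s1i [Iq Id]; have [v1 a1 _] := u1.
    have [iZ iiZ] := inp_addr iN.
    have fE : [seq u <- iota 0 i.+1 | size (nb u) <= D] =
        if size (nb i) <= D then rcons [seq u <- iota 0 i | size (nb u) <= D] i
        else [seq u <- iota 0 i | size (nb u) <= D].
      rewrite -addn1 iotaD filter_cat /= add0n; case: ifP => _; by rewrite ?cats1 ?cats0.
    rewrite fE.
    apply: tot_seq; apply: tot_read; [by rewrite /= s1i|by rewrite /= s1i|by lia|].
    apply: tot_seq; apply: tot_read; [by []|exact: inp_size|exact: nb_size|].
    apply: tot_seq; apply: tot_store => /=; rewrite /upd /= ?s1i; first exact: nb_size.
    set s2 := seta _ _ _ _.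
    have q2 : queue_is s2 [seq u <- iota 0 i | size (nb u) <= D] by [].
    have w2 : vars s2 2 = D by rewrite /= /upd /= v1.
    have qn : size [seq u <- iota 0 i | size (nb u) <= D] < n.
      by rewrite size_filter (leq_ltn_trans (count_size _ _)) // size_iota.
    have dE u : u < i.+1 -> arrs s2 0 u = size (nb u).
      by rewrite ltnS leq_eqVlt /= /upd => /predU1P[->|ui]; [rewrite eqxx|rewrite ltn_eqF // Id].
    apply: (tot_if (B := 30)); rewrite [eval _ (Var 2)]w2 [eval _ (Var 8)]/= /upd /= => h.
      apply: tot_skip_le; split=> //; rewrite leqNgt h /=.
      by case: q2.
    apply: tot_use (@tot_push 5 s2 _ i isT _ iN q2 qn) _; first by rewrite /= /upd.
    move=> s3 u3 [[q31 q32] v3 a3]; split=> [|u ui]; last by rewrite /= a3 // dE.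
    by rewrite h; split.
  by move=> s' _ [].
by rewrite /ecost /=; lia.
Qed.

Lemma live_rcons ps v u : v < n -> u < n -> v \notin ps ->
  live ps u = live (rcons ps v) u + (u \in nb v).
Proof.
move=> vn un vps; rewrite (nb_sym un vn) /live.
have uu := nb_uniq un; elim: (nb u) uu => //= w l IH /andP[wl ul].
rewrite (IH ul) mem_rcons !inE negb_or eq_sym.
case: (eqVneq v w) => [vw|wv] /=; last by rewrite addnA.
by rewrite -vw in wl *; rewrite vps (negbTE wl) /= addn0 addnC.
Qed.

Section Neighbours.
Variables (v : nat) (ps qs : seq nat) (s0 : state).
Hypotheses (vn : v < n) (vps : v \notin ps) (vD : live ps v <= D).
Let ps' := rcons ps v.
Hypotheses (uq : uniq (ps' ++ qs)) (qn : {in ps' ++ qs, forall u, u < n})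
  (q0 : queue_is s0 (ps' ++ qs))
  (popped0 : forall u, u < n -> arrs s0 2 u = (u \in ps'))
  (deg0 : forall u, u < n -> u \notin ps' -> arrs s0 0 u = live ps u)
  (qsE : forall u, u < n -> u \notin ps' -> (u \in qs) = (live ps u <= D))
  (oc0 : arrs s0 3 v = 0)
  (v2 : vars s0 2 = D) (v3 : vars s0 3 = S) (v6 : vars s0 6 = v) (v7 : vars s0 7 = inp v)
  (v8 : vars s0 8 = size (nb v)).

(** Removing [v] lowers the live degree of the neighbours selected here from [D + 1] to [D]. Pushing
    exactly at this moment puts no vertex into the queue twice. *)
Definition crossing (l : seq nat) : seq nat :=
  [seq u <- l | (u \notin ps') && (live ps u == D.+1)].

Definition kept (l : seq nat) : seq nat := [seq u <- l | u \notin ps'].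

Lemma kept_size l : {subset l <= nb v} -> uniq l -> size (kept l) <= D.
Proof.
move=> lv ul; apply: leq_trans vD; rewrite /live -size_filter.
apply: uniq_leq_size; first by rewrite filter_uniq.
move=> u; rewrite !mem_filter => /andP[ups' /lv->].
by rewrite andbT; apply: contra ups'; rewrite mem_rcons inE => ->; rewrite orbT.
Qed.

Lemma queue_uniq : uniq (ps' ++ (qs ++ crossing (nb v))) /\
  {in ps' ++ (qs ++ crossing (nb v)), forall u, u < n}.
Proof.
split=> [|u]; last first.
  by rewrite catA mem_cat => /orP[/qn//|]; rewrite mem_filter => /andP[_ /(nb_lt vn)].
rewrite catA cat_uniq uq filter_uniq ?nb_uniq // andbT /=.
apply/hasPn=> u; rewrite mem_filter => /andP[/andP[ups' /eqP lu] unb].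
rewrite mem_cat (negbTE ups') /= qsE //; last exact: nb_lt unb.
by rewrite lu ltnn.
Qed.

Lemma tot_neighbours :
  tot (For 9 8 PeelNeighbour) s0 ((size (nb v) + 1) * 200) (fun s =>
    [/\ queue_is s (ps' ++ (qs ++ crossing (nb v))),
        forall u, u < n -> u \notin ps' -> arrs s 0 u = live ps' u,
        forall u, arrs s 3 u = if u == v then size (kept (nb v)) else arrs s0 3 u,
        forall k, k < size (kept (nb v)) -> arrs s 4 (v * S + k) = nth 0 (kept (nb v)) k
      & forall u k, u != v -> k < S -> arrs s 4 (u * S + k) = arrs s0 4 (u * S + k)]).
Proof.
have [uqq qqn] := queue_uniq.
eapply tot_le.
  apply: tot_use.
    apply: (@tot_for Z U inp 9 8 _ s0 (size (nb v)) _ (fun j s =>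
      [/\ queue_is s (ps' ++ (qs ++ crossing (take j (nb v)))),
        forall u, u < n -> u \notin ps' -> arrs s 0 u = live ps u - (u \in take j (nb v)),
        forall u, arrs s 3 u = if u == v then size (kept (take j (nb v))) else arrs s0 3 u,
        forall k, k < size (kept (take j (nb v))) -> arrs s 4 (v * S + k) = nth 0 (kept (take j (nb v))) k
      & forall u k, u != v -> k < S -> arrs s 4 (u * S + k) = arrs s0 4 (u * S + k)])) => //.
    - exact: nb_size.
    - rewrite take0 /=; split=> //; first by rewrite !cats0.
      + by move=> u un ups; rewrite deg0 // subn0.
      + by move=> u; case: eqP => // ->.
    move=> j s jd u1 sj [Iq Id Ic Io If]; have [w1 a1 _] := u1.
    set pref := take j (nb v) in Iq Id Ic Io.
    set u := nth 0 (nb v) j; have unb : u \in nb v by apply: mem_nth.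
    have un : u < n := nb_lt vn unb.
    have prefS : take j.+1 (nb v) = rcons pref u by rewrite (take_nth 0).
    have prefv : {subset pref <= nb v} by move=> w; apply: mem_take.
    have upref : u \notin pref.
      have := take_uniq j.+1 (nb_uniq vn).
      by rewrite prefS rcons_uniq => /andP[].
    have pref_uniq : uniq pref by apply: take_uniq; apply: nb_uniq.
    have [jZ jE] := inp_nb vn jd.
    have x2 : vars s 2 = D by rewrite w1.
    have x3 : vars s 3 = S by rewrite w1.
    have x6 : vars s 6 = v by rewrite w1.
    have x7 : vars s 7 = inp v by rewrite w1.
    have b2 : arrs s 2 = arrs s0 2 by rewrite a1.
    apply: tot_seq; apply: tot_read; [by rewrite /= x7 sj|by rewrite /= x7 sj; apply: jE|by lia|].
    rewrite -/u; set s2 := setv s 10 u.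
    have e2 : eval s2 (Get 2 (Var 10)) = (u \in ps') by rewrite /= /upd /= b2 popped0.
    rewrite prefS; apply: tot_if; rewrite e2 [eval _ (Num 1)]/= => h; last first.
      have ups : u \in ps' by move: h; case: (_ \in _).
      apply: tot_skip_le.
      have -> : crossing (rcons pref u) = crossing pref by rewrite /crossing filter_rcons ups.
      have -> : kept (rcons pref u) = kept pref by rewrite /kept filter_rcons ups.
      split=> // w wn wps; rewrite /= mem_rcons inE.
      by case: eqP => [e|_]; [rewrite e ups in wps|apply: Id].
    have ups : u \notin ps' by move: h; case: (_ \in _).
    have keptS : kept (rcons pref u) = rcons (kept pref) u by rewrite /kept filter_rcons ups.
    have ks : size (kept pref) < D.
      have sub : {subset rcons pref u <= nb v}.
        by move=> w; rewrite mem_rcons inE => /predU1P[->|/prefv].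
      have := kept_size sub; rewrite keptS size_rcons rcons_uniq upref; exact.
    have e3 : arrs s 3 v = size (kept pref) by rewrite Ic eqxx.
    apply: tot_seq; apply: tot_store => /=; rewrite /upd /=; first by lia.
    rewrite x6 e3 x3; set s3 := seta _ _ _ _.
    apply: tot_seq; apply: tot_store => /=; rewrite /upd /= x6 e3; first by lia.
    set s4 := seta _ _ _ _.
    have lu : arrs s 0 u = live ps u by rewrite Id // (negbTE upref) subn0.
    have luU : live ps u - 1 < U.
      apply: leq_ltn_trans (leq_subr _ _) _; apply: leq_ltn_trans (nb_size un).
      exact: count_size.
    apply: tot_seq; apply: tot_store => /=; rewrite /upd /= lu //.
    set s5 := seta _ _ _ _.
    have q5 : queue_is s5 (ps' ++ (qs ++ crossing pref)) by [].
    have lu0 : 0 < live ps u by rewrite (live_rcons vn un vps) unb addn1.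
    have d5 w : w < n -> w \notin ps' -> arrs s5 0 w = live ps w - (w \in rcons pref u).
      move=> wn wps; rewrite /= mem_rcons inE /upd; case: eqP => [->|_] //; exact: Id.
    have c5 w : arrs s5 3 w = if w == v then size (kept (rcons pref u)) else arrs s0 3 w.
      by rewrite /= /upd keptS size_rcons addn1; case: eqP => // /eqP wv; rewrite Ic (negbTE wv).
    have o5 k : k < size (kept (rcons pref u)) -> arrs s5 4 (v * S + k) = nth 0 (kept (rcons pref u)) k.
      rewrite keptS size_rcons ltnS nth_rcons leq_eqVlt /= /upd => /predU1P[->|kk].
        by rewrite !eqxx ltnn.
      by rewrite eqn_add2l ltn_eqF // kk Io.
    have f5 w k : w != v -> k < S -> arrs s5 4 (w * S + k) = arrs s0 4 (w * S + k).
      by move=> wv kS; rewrite /= /upd (cell_neq kS) ?If //; lia.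
    have e5 : eval s5 (Get 0 (Var 10)) = live ps u - 1 by rewrite /= /upd /= eqxx.
    have crossS : crossing (rcons pref u) =
        if live ps u == D.+1 then rcons (crossing pref) u else crossing pref.
      by rewrite /crossing filter_rcons ups.
    apply: (tot_ifeq (B := 30)); rewrite e5 [eval s5 (Var 2)]/= /upd /= x2 => lD.
      have luD : live ps u == D.+1 by apply/eqP; lia.
      (* There is room for one more: the extended queue is a subsequence of a duplicate-free list of
         vertices. *)
      have qrn : size (ps' ++ (qs ++ crossing pref)) < n.
        have sub : subseq (rcons (ps' ++ (qs ++ crossing pref)) u) (ps' ++ (qs ++ crossing (nb v))).
          rewrite !rcons_cat; do 2!apply: cat_subseq => //.
          rewrite -[rcons _ _](_ : crossing (rcons pref u) = _); last by rewrite crossS luD.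
          rewrite -prefS /crossing -[X in subseq _ (filter _ X)](cat_take_drop j.+1 (nb v)).
          by rewrite filter_cat prefix_subseq.
        have := queue_size (subseq_uniq sub uqq).
        by rewrite size_rcons; apply=> w /(mem_subseq sub)/qqn.
      apply: tot_use (@tot_push 10 s5 _ u isT _ un q5 qrn) _; first by rewrite /= /upd.
      move=> s6 u6 [q6 v6' a6]; split.
      - by rewrite crossS luD -!rcons_cat.
      - by move=> w wn wps; rewrite /= a6 // d5.
      - by move=> w; rewrite /= a6 // c5.
      - by move=> k kk; rewrite /= a6 // o5.
      - by move=> w k wv kS; rewrite /= a6 // f5.
    split=> //; rewrite crossS; case: eqP => // luD; case: lD; lia.
  move=> s _ [[Iq Id Ic Io If] _]; move: Iq Id Ic Io; rewrite take_size => Iq Id Ic Io.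
  split=> // u un ups; rewrite Id // (live_rcons vn un vps) addnK //.
by rewrite /ecost /=; lia.
Qed.

End Neighbours.
(** [ps] has been removed and [qs] is pending, consisting of the live vertices of live degree at
    most [D]. The cost is charged to the degrees of removed vertices, since a uniform bound per turn
    would not give a total linear in [n]. *)
Definition peeled (h C : nat) (s : state) : Prop :=
  exists ps qs,
  [/\ uniq (ps ++ qs) /\ {in ps ++ qs, forall u, u < n}, size ps = h, queue_is s (ps ++ qs),
      [/\ forall u, u < n -> arrs s 2 u = (u \in ps),
         forall u, u < n -> u \notin ps -> arrs s 0 u = live ps u &
         forall u, u < n -> u \notin ps -> (u \in qs) = (live ps u <= D)]
    & [/\ forall u, u < n -> arrs s 3 u = if u \in ps then size (later ps u) else 0,
         forall u, u \in ps -> size (later ps u) <= D,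
         forall u k, u \in ps -> k <= size (later ps u) ->
           arrs s 4 (u * S + k) = nth 0 (rcons (later ps u) u) k
       & C <= \sum_(u <- ps) 400 * (size (nb u) + 1)]].

Lemma tot_peel s :
  vars s 1 = n -> vars s 2 = D -> vars s 3 = S ->
  queue_is s [seq u <- iota 0 n | size (nb u) <= D] ->
  (forall u, u < n -> arrs s 0 u = size (nb u)) ->
  (forall u, arrs s 2 u = 0) -> (forall u, arrs s 3 u = 0) ->
  tot Peel s (\sum_(u <- iota 0 n) 400 * (size (nb u) + 1) + 9) (fun s' =>
    exists ps, [/\ perm_eq ps (iota 0 n), forall u, u < n -> size (later ps u) <= D
      & stores_out n S (later ps) s']).
Proof.
move=> s1 s2 s3 q0 d0 p0 c0.
have perm ps : uniq ps -> {in ps, forall u, u < n} -> size ps = n -> perm_eq ps (iota 0 n).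
  move=> ups psn sps; apply: uniq_perm; rewrite ?iota_uniq // => u.
  have [] := uniq_min_size ups (s2 := iota 0 n); rewrite ?size_iota ?sps //.
  by move=> w /psn wn; rewrite mem_iota.
have live0 u : live [::] u = size (nb u) by rewrite /live count_predT.
apply: tot_use.
  apply: (@tot_for_acc Z U inp 5 1 _ s n _ peeled) => //.
  - exists [::], [seq u <- iota 0 n | size (nb u) <= D]; split=> //=.
    + by split; [rewrite filter_uniq ?iota_uniq|move=> u; rewrite mem_filter mem_iota => /andP[]].
    + split=> // u un _; first by rewrite live0 d0.
      by rewrite mem_filter mem_iota live0 /= add0n un andbT.
  - move=> h C st hn u1 sth [ps [qs [[uq qn] sps Iq [Ip Id Iqs] [Ic Is Io IC]]]].
    have [w1 a1 _] := u1.
    have [ups psn] : uniq ps /\ {in ps, forall u, u < n}.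
      by move: uq; rewrite cat_uniq => /and3P[-> _ _]; split=> // u ups; apply: qn; rewrite mem_cat ups.
    have [v qsE'] : exists v, exists qs', qs = v :: qs'.
      (* The queue cannot run dry: degeneracy provides a live vertex of live degree at most [D], and
         such a vertex is queued. *)
      have [|u [un ups' lu]] := peelable ups psn; first by rewrite sps.
      have := Iqs u un ups'; rewrite lu; case: (qs) => // v qs' _.
      by exists v, qs'.
    have [qs' qsE] := qsE'.
    have catE : ps ++ qs = rcons ps v ++ qs' by rewrite qsE cat_rcons.
    have vn : v < n by apply: qn; rewrite qsE mem_cat inE eqxx orbT.
    have vps : v \notin ps.
      move: uq; rewrite cat_uniq qsE => /and3P[_ /hasPn/(_ v) + _].
      by rewrite inE eqxx => /(_ isT).
    have vD : live ps v <= D by rewrite -Iqs // qsE inE eqxx.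
    have x2 : vars st 2 = D by rewrite w1.
    have x3 : vars st 3 = S by rewrite w1.
    have [qh qi] := Iq; have [vZ ivZ] := inp_addr vn.
    have e1 : eval st (Get 1 (Var 5)) = v.
      by rewrite /= sth qi ?nth_cat -?sps ?ltnn ?subnn ?qsE // size_cat /=; lia.
    eexists.
    apply: tot_seq; apply: tot_assign; rewrite e1; first by lia.
    apply: tot_seq; apply: tot_store => /=; rewrite /upd /=; first by lia.
    apply: tot_seq; apply: (tot_read (v := inp v)); [by []|by []|by lia|].
    apply: tot_seq; apply: (tot_read (v := size (nb v))); [by []|exact: inp_size|exact: nb_size|].
    rewrite catE in uq qn Iq.
    set st0 := setv _ 8 _.
    apply: tot_seq_use.
      apply: (@tot_neighbours v ps qs' st0 vn vps vD uq qn) => //.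
      + move=> u un; rewrite /= /upd mem_rcons inE.
        by case: eqP => // _; apply: Ip.
      + move=> u un; rewrite mem_rcons inE negb_or => /andP[_ unps].
        exact: Id.
      + move=> u un; rewrite mem_rcons inE negb_or => /andP[uv unps].
        by rewrite -Iqs // qsE inE (negbTE uv).
      + by rewrite /= Ic // (negbTE vps).
    move=> st1 u2 [Jq Jd Jc Jo Jf]; have [w2 a2 _] := u2.
    have y3 : vars st1 3 = S by rewrite w2.
    have y6 : vars st1 6 = v by rewrite w2.
    have laterE : later (rcons ps v) v = kept v ps (nb v) by apply: later_last.
    have kD : size (kept v ps (nb v)) <= D by apply: kept_size => //; apply: nb_uniq.
    have ps'n u : u \in rcons ps v -> u < n by rewrite mem_rcons inE => /predU1P[->|/psn].
    apply: tot_store; rewrite [eval _ (Var 6)]/= y6; first by lia.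
    rewrite [eval _ (cell _ _)]/= y6 y3 Jc eqxx.
    exists (rcons ps v), (qs' ++ crossing v ps (nb v)); split.
    + apply: queue_uniq => // u un; rewrite mem_rcons inE negb_or => /andP[uv unps].
      by rewrite -Iqs // qsE inE (negbTE uv).
    + by rewrite size_rcons sps.
    + by [].
    + split=> [u un|u un unps|u un unps] /=.
      * by rewrite a2 //= mem_rcons inE /upd; case: eqP => // _; apply: Ip.
      * exact: Jd.
      * rewrite mem_cat mem_filter unps /=.
        have [uv unps'] : u != v /\ u \notin ps by move: unps; rewrite mem_rcons inE negb_or => /andP.
        have -> : (u \in qs') = (live ps u <= D) by rewrite -Iqs // qsE inE (negbTE uv).
        have -> : live ps u = live (rcons ps v) u + (u \in nb v) by apply: live_rcons.
        case: (u \in nb v); last by rewrite addn0 andbF orbF.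
        by rewrite addn1 eqSS andbT [RHS]leq_eqVlt orbC.
    + split=> [u un|u|u k ups' ks|] /=.
      * rewrite Jc mem_rcons inE; case: eqP => [->|/eqP uv] /=; first by rewrite laterE.
        by rewrite /= Ic //; case: ifP => // upss; rewrite later_rcons.
      * rewrite mem_rcons inE => /predU1P[->|upss]; first by rewrite laterE.
        by rewrite later_rcons // Is.
      * have [uv|uv] := eqVneq u v.
          rewrite uv laterE /upd in ks *; move: ks; rewrite leq_eqVlt nth_rcons => /predU1P[->|kk].
            by rewrite !eqxx ltnn.
          by rewrite eqn_add2l ltn_eqF // kk Jo.
        have upss : u \in ps by move: ups'; rewrite mem_rcons inE (negbTE uv).
        rewrite later_rcons // in ks *; have ksS : k < S by rewrite SE; have := Is u upss; lia.
        have kvS : size (kept v ps (nb v)) < S by rewrite SE; lia.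
        by rewrite /upd (cell_neq ksS kvS uv) Jf //= Io.
      * rewrite -cats1 big_cat big_seq1 /ecost /=.
        by apply: leq_trans (leq_add IC (leqnn _)); lia.
  - move=> C st [ps [qs [[uq qn] sps _ _ [_ _ _ IC]]]]; apply: leq_trans IC _.
    rewrite (perm_big (iota 0 n)) //; apply: perm => //.
      by move: uq; rewrite cat_uniq => /andP[].
    by move=> u ups; apply: qn; rewrite mem_cat ups.
move=> s' u1 [[C [ps [qs [[uq qn] sps Iq [Ip Id Iqs] [Ic Is Io _]]]]] _].
have [w1 a1 _] := u1; exists ps.
have pps : perm_eq ps (iota 0 n).
  apply: perm => //; first by move: uq; rewrite cat_uniq => /andP[].
  by move=> u ups; apply: qn; rewrite mem_cat ups.
have inps u : u < n -> u \in ps by move=> un; rewrite (perm_mem pps) mem_iota.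
split=> // [u un|]; first exact/Is/inps.
split; first by rewrite w1.
- by move=> u un; rewrite Ic // inps.
- by move=> u k un; apply: Io; apply: inps.
Qed.

End Peeling.
End Order.

(** * The complete program and its running time *)

Definition ListAll : cmd :=
  For 5 1
    (Seq (Assign 6 (Var 5))
    (Seq (Assign 11 (Get 3 (Var 6)))
    (Seq (Assign 12 (plus (Var 11) (Num 1)))
    (Seq (Read 7 (Var 6))
    (Seq (Read 8 (Var 7))
    (Seq Matrix Dfs)))))).

Definition Main : cmd :=
  Seq (Assign 2 (times (times (Num 400) (Var 0)) (times (Num 400) (Var 0))))
  (Seq (Assign 3 (plus (Var 2) (Num 2)))
  (Seq Degrees
  (Seq Peel ListAll))).

Section Main.
Variable nb : nat -> seq nat.
Variables (Z U : nat) (inp : nat -> nat).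
Local Notation tot := (tot Z U inp).
Variables (t n : nat).
Let D := 400 * t * (400 * t).
Let S := D + 2.
Hypotheses (SU : S < U) (nU : n < U) (ZU : Z < U).
Hypotheses (nb_uniq : forall v, v < n -> uniq (nb v))
  (nb_lt : forall v w, v < n -> w \in nb v -> w < n)
  (nb_sym : forall v w, v < n -> w < n -> (v \in nb w) = (w \in nb v))
  (nb_size : forall v, v < n -> size (nb v) < U)
  (inp_addr : forall v, v < n -> v < Z /\ inp v < Z)
  (inp_size : forall v, v < n -> inp (inp v) = size (nb v))
  (inp_nb : forall v j, v < n -> j < size (nb v) ->
     inp v + 1 + j < Z /\ inp (inp v + 1 + j) = nth 0 (nb v) j)
  (peelable : forall ps, uniq ps -> {in ps, forall u, u < n} -> size ps < n ->
     exists u, [/\ u < n, u \notin ps & live nb ps u <= D]).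

Definition listing_at (out : nat -> seq nat) (v : nat) : seq nat :=
  listing out v nb (descendants (local_adj out v) (size (out v)) 0 [::]).

Lemma tot_list_all (out : nat -> seq nat) (M : nat) s :
  (forall u, u < n -> size (out u) <= D) ->
  (forall u w, u < n -> w \in out u -> w < n) ->
  (forall u, u < n -> tree_size (local_adj out u) (size (out u)) 0 [::] <= M) -> 0 < M ->
  stores_out n S out s -> vars s 1 = n -> outp s = [::] ->
  tot ListAll s (\sum_(v <- iota 0 n) 3000 * ((size (nb v) + 1) * (S ^ 3 * M)) + 9) (fun s' =>
    outp s' = flatten [seq listing_at out v | v <- iota 0 n]).
Proof.
move=> outD out_lt treeM M0 so s1 o0.
have S0 : 1 < S by rewrite /S; lia.
apply: tot_use.
  apply: (@tot_for_acc Z U inp 5 1 _ s n _ (fun i C st =>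
    C <= \sum_(v <- iota 0 i) 3000 * ((size (nb v) + 1) * (S ^ 3 * M)) /\
    outp st = flatten [seq listing_at out v | v <- iota 0 i])) => //.
  - move=> v C st vn u1 stv [IC Io]; have so1 := stores_out_unchanged u1 isT so.
    have [vZ ivZ] := inp_addr vn.
    have outDv := outD v vn.
    have -> : iota 0 v.+1 = iota 0 v ++ [:: v] by rewrite -addn1 iotaD.
    eexists.
    apply: tot_seq; apply: tot_assign; rewrite /= stv; first by lia.
    apply: tot_seq; apply: tot_assign; have [x3 xc _] := so1; rewrite /= /upd /= xc //; first by lia.
    apply: tot_seq; apply: tot_assign; rewrite /= /upd /=; first by lia.
    rewrite addn1.
    apply: tot_seq; apply: (tot_read (v := inp v)); [by []|by []|by lia|].
    apply: tot_seq; apply: (tot_read (v := size (nb v))); [by []|exact: inp_size|exact: nb_size|].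
    set st1 := setv _ 8 _.
    have so2 : stores_out n S out st1 by do 5!apply: stores_out_setv => //.
    apply: tot_seq_use.
      by apply: (@tot_matrix Z U inp n D S out erefl outD out_lt SU nU v vn ZU st1).
    move=> st2 u2 adjE; have [w2 a2 o2] := u2.
    have ctx : vertex_context inp n S out v nb st2.
      by split; [apply: (stores_out_unchanged u2)|rewrite !w2|rewrite !w2|].
    apply: tot_use.
      apply: (@tot_dfs Z U inp n D S out erefl outD out_lt SU nU v nb vn ZU) ctx => //.
      - by move=> w; apply: nb_lt.
      - exact: nb_size.
      - by move=> j; apply: inp_nb.
    move=> st3 u3 [_ o3]; split.
      rewrite big_cat big_seq1 -addnA; apply: leq_add IC _.
      have tv := treeM v vn.
      set T := tree_size _ _ _ _ in tv *.
      have h1 : 220 * S ^ 3 <= 220 * (S ^ 3 * ((size (nb v) + 1) * M)).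
        by rewrite leq_mul2l -[X in X <= _]muln1 leq_mul2l muln_gt0 M0 addn1 orbT.
      have h2 : 4 * (600 * ((size (nb v) + 1) * S ^ 2) + 6) * T <=
          2424 * (S ^ 3 * ((size (nb v) + 1) * M)).
        apply: leq_trans (_ : (4 * (606 * ((size (nb v) + 1) * S ^ 2))) * M <= _).
          apply: leq_mul => //; rewrite leq_mul2l /=.
          have : 0 < (size (nb v) + 1) * S ^ 2 by rewrite addn1 muln_gt0 expn_gt0 (ltnW S0).
          by lia.
        have : S ^ 2 <= S ^ 3 by rewrite leq_exp2l.
        move: (S ^ 2) (S ^ 3) => A B AB.
        have -> : 4 * (606 * ((size (nb v) + 1) * A)) * M = 2424 * (A * ((size (nb v) + 1) * M)) by nia.
        by rewrite leq_mul2l leq_mul2r AB orbT.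
      have h3 : 0 < S ^ 3 * ((size (nb v) + 1) * M).
        by rewrite muln_gt0 expn_gt0 (ltnW S0) muln_gt0 addn1 M0.
      rewrite (_ : (size (nb v) + 1) * (S ^ 3 * M) = S ^ 3 * ((size (nb v) + 1) * M)); last by rewrite mulnCA.
      rewrite /ecost /=.
      by move: h1 h2 h3; set X := S ^ 3 * _; set Y := 220 * S ^ 3; set W := 4 * _ * T; lia.
    by rewrite /= o3 o2 //= Io map_cat flatten_cat /= cats0.
  - by move=> C st [].
by move=> st u1 [[C [_ ->]] _].
Qed.

(** Linearity in [n] comes from the degree sum, bounded by [n * S]; the enumeration spends
    [S ^ 3 * M] per unit of that sum, up to a constant. *)
Lemma tot_main (M : nat) s :
  0 < n ->
  (forall ps, perm_eq ps (iota 0 n) -> (forall u, u < n -> size (later nb ps u) <= D) ->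
     forall u, u < n -> tree_size (local_adj (later nb ps) u) (size (later nb ps u)) 0 [::] <= M) ->
  0 < M -> \sum_(v <- iota 0 n) (size (nb v) + 1) <= n * S ->
  vars s 0 = t -> vars s 1 = n -> vars s 4 = 0 -> (forall a i, arrs s a i = 0) -> outp s = [::] ->
  tot Main s (4000 * (n * (S ^ 4 * M))) (fun s' => exists ps,
    [/\ perm_eq ps (iota 0 n), forall u, u < n -> size (later nb ps u) <= D
      & outp s' = flatten [seq listing_at (later nb ps) v | v <- iota 0 n]]).
Proof.
move=> n0 treeM M0 sum_nb s0 s1 s4 arr0 o0.
have S0 : 1 < S by rewrite /S; lia.
eapply tot_le.
  apply: tot_seq; apply: tot_assign; rewrite /= s0 -/D; first by apply: leq_ltn_trans SU; apply: leq_addr.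
  apply: tot_seq; apply: tot_assign; rewrite /= /upd /= -/S //.
  set st := setv _ 3 _.
  apply: tot_seq_use.
    by apply: (@tot_degrees nb Z U inp n D S erefl SU nU ZU nb_size inp_addr inp_size st).
  move=> st1 u1 [q1 d1]; have [w1 a1 o1] := u1.
  apply: tot_seq_use.
    apply: (@tot_peel nb Z U inp n D S erefl SU nU ZU nb_uniq nb_lt nb_sym nb_size
      inp_addr inp_size inp_nb peelable st1) => //; rewrite ?w1 // => u; by rewrite a1 //= arr0.
  move=> st2 u2 [ps [pps lD so2]]; have [w2 a2 o2] := u2.
  apply: tot_use.
    apply: (@tot_list_all (later nb ps) M st2) => //.
    - by move=> u w un; rewrite mem_filter => /andP[_]; apply: nb_lt.
    - exact: treeM.
    - by rewrite w2 //= w1.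
    - by rewrite o2 // o1.
  by move=> st3 _ o3; exists ps.
rewrite /ecost /=.
rewrite -!big_distrr /=.
have -> : \sum_(v <- iota 0 n) (size (nb v) + 1) * (S ^ 3 * M) =
    (\sum_(v <- iota 0 n) (size (nb v) + 1)) * (S ^ 3 * M) by rewrite big_distrl.
set sg := \sum_(_ <- _) _ in sum_nb *.
have h1 : sg * (S ^ 3 * M) <= n * (S ^ 4 * M).
  apply: leq_trans (leq_mul sum_nb (leqnn _)) _.
  by rewrite [S ^ 4]expnS -!mulnA.
have h2 : sg <= n * (S ^ 4 * M).
  apply: leq_trans sum_nb _; rewrite leq_mul2l expnS -mulnA -[X in X <= _]muln1 leq_mul2l.
  by rewrite muln_gt0 expn_gt0 M0 (ltnW S0) ?orbT.
have h3 : n <= n * (S ^ 4 * M).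
  by rewrite -{1}(muln1 n) leq_mul2l muln_gt0 expn_gt0 M0 (ltnW S0) ?orbT.
move: h1 h2 h3; set X := n * _; set Y := sg * _; lia.
Qed.

End Main.

(** * Correctness of the listing *)

Section Listing.
Variables (n : nat) (G : sgraph 'I_n) (L : 'I_n -> seq 'I_n) (r : 'I_n -> nat).
Hypotheses (GL : adjacency_lists G L) (r_inj : injective r).

Definition later_nbrs (x : 'I_n) : seq 'I_n := [seq w <- L x | r x < r w].

Variable adj : 'I_n -> nat -> nat -> bool.
Hypotheses (adj_sym : forall x i j, adj x i j = adj x j i)
  (adjE : forall x i j, i < size (later_nbrs x) -> j < size (later_nbrs x) ->
     adj x i j = G (nth x (later_nbrs x) i) (nth x (later_nbrs x) j)).

Definition candidates (x : 'I_n) : seq bitseq :=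
  descendants (adj x) (size (later_nbrs x)) 0 [::].

Definition clique_of (x : 'I_n) (bits : bitseq) : seq 'I_n :=
  rcons (mask bits (later_nbrs x)) x.

Definition extendable (x : 'I_n) (bits : bitseq) : bool :=
  has (fun w => all (mem (later_nbrs w)) (clique_of x bits)) (L x).

Lemma mem_later x w : (w \in later_nbrs x) = G x w && (r x < r w).
Proof. by rewrite mem_filter andbC; have [_ ->] := GL x. Qed.

Lemma later_uniq x : uniq (later_nbrs x).
Proof. by rewrite filter_uniq //; case: (GL x). Qed.

Lemma mem_maskP x bits i : size bits = size (later_nbrs x) -> i < size (later_nbrs x) ->
  (nth x (later_nbrs x) i \in mask bits (later_nbrs x)) = nth false bits i.
Proof.
move=> sb il; rewrite in_mask ?later_uniq //.
by rewrite mem_nth //= index_uniq ?later_uniq.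
Qed.

(** A vertex [w] extending the clique either comes after [x], against maximality among the later
    neighbours, or before it; then the whole clique lies in [later_nbrs w], against
    [~~ extendable x bits]. *)
Lemma max_clique_of x bits : bits \in candidates x -> ~~ extendable x bits ->
  [set y in clique_of x bits] \in max_cliques G.
Proof.
move=> /(descendants_max (adj_sym x))[sb bc bm] next.
set o := later_nbrs x in sb bm bc *.
have blt i : nth false bits i -> i < size o.
  by rewrite -sb ltnNge; apply: contraTN => ?; rewrite nth_default.
have inK y : y \in clique_of x bits -> y = x \/ exists2 i, nth false bits i & y = nth x o i.
  rewrite mem_rcons inE => /predU1P[->|ym]; [by left|right].
  have yo := mem_mask ym; exists (index y o); last by rewrite nth_index.
  by rewrite -(@mem_maskP x) ?index_mem // nth_index.
have Kin i : nth false bits i -> nth x o i \in clique_of x bits.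
  by move=> bi; rewrite mem_rcons inE mem_maskP ?bi ?orbT // blt.
have oG i : i < size o -> G x (nth x o i) && (r x < r (nth x o i)).
  by move=> io; rewrite -mem_later mem_nth.
rewrite inE; apply/maxsetP; split.
  apply/cliqueP=> y z; rewrite !inE => /inK[->|[i bi ->]] /inK[->|[j bj ->]] yz.
  - by rewrite eqxx in yz.
  - by have /andP[] := oG j (blt _ bj).
  - by rewrite edge_sym; have /andP[] := oG i (blt _ bi).
  - rewrite -adjE ?blt //; apply: bc => //; by apply: contraNneq yz => ->.
move=> B /cliqueP Bc KB; apply/eqP; rewrite eq_sym eqEsubset KB /=; apply/subsetP=> w wB.
rewrite inE; apply: contraT => wK.
have KinB y : y \in clique_of x bits -> G w y.
  move=> yK; apply: Bc => //; first by apply: (subsetP KB); rewrite inE.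
  by apply: contraNneq wK => ->.
have xK : x \in clique_of x bits by rewrite mem_rcons inE eqxx.
have xw : G x w by rewrite edge_sym KinB.
have wx : w != x by apply: contraTneq xw => ->; rewrite edge_irr.
have [lt|ge] := ltnP (r x) (r w).
  have wo : w \in o by rewrite mem_later xw.
  have io : index w o < size o by rewrite index_mem.
  have [|c bc' cj] := bm (index w o) io.
    apply: contra wK => bi; have := Kin _ bi; by rewrite nth_index.
  have := KinB _ (Kin _ bc'); rewrite edge_sym.
  by rewrite (adjE (blt _ bc') io) nth_index // in cj; rewrite (negbTE cj).
have lt : r w < r x.
  by rewrite ltn_neqAle ge andbT; apply: contraNneq wx => /r_inj->.
case/hasP: next; exists w; first by have [_ ->] := GL x.
apply/allP=> y yK; rewrite /= mem_later KinB //=.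
have [->//|[i bi ->]] := inK y yK.
by have /andP[_] := oG i (blt _ bi); apply: ltn_trans.
Qed.

(** [x] is the member of least rank and [bits] marks the rest of [A] among its later neighbours. A
    [w] making it extendable would be adjacent to all of [A], hence in [A], hence its own later
    neighbour. *)
Lemma max_clique_listed A : 0 < n -> A \in max_cliques G ->
  exists x bits, [/\ bits \in candidates x, ~~ extendable x bits & [set y in clique_of x bits] = A].
Proof.
move=> n0; rewrite inE => /maxsetP[/cliqueP Ac Am].
have grow w : {in A, forall y, y != w -> G w y} -> w \in A.
  move=> wA; suff <- : w |: A = A by rewrite !inE eqxx.
  apply: Am; last exact: subsetUr.
  apply/cliqueP=> y z; rewrite !inE => /predU1P[->|yA] /predU1P[->|zA] yz.
  - by rewrite eqxx in yz.
  - by apply: wA; rewrite // eq_sym.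
  - by rewrite edge_sym wA.
  - exact: Ac.
have [x0 x0A] : exists x, x \in A.
  have [A0|/set0Pn[x]] := eqVneq A set0; last by exists x.
  by exists (Ordinal n0); apply: grow => y; rewrite A0 inE.
case: (@arg_minnP _ x0 (mem A) r x0A) => x; rewrite -[mem A x]/(x \in A) => xA xmin.
set o := later_nbrs x.
have Ao y : y \in A -> y != x -> y \in o.
  move=> yA yx; rewrite mem_later Ac //=; last by rewrite eq_sym.
  by rewrite ltn_neqAle xmin // andbT; apply: contraNneq yx => /r_inj->.
pose bits := [seq y \in A | y <- o].
have sb : size bits = size o by rewrite size_map.
have bE i : i < size o -> nth false bits i = (nth x o i \in A) by move=> io; rewrite (nth_map x).
have KA : [set y in clique_of x bits] = A.
  apply/setP=> y; rewrite inE mem_rcons inE; have [->|yx] /= := eqVneq y x; first by rewrite xA.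
  have [yo|yo] := boolP (y \in o).
    by rewrite -(nth_index x yo) mem_maskP ?index_mem // bE ?index_mem.
  have -> : (y \in mask bits (later_nbrs x)) = false by apply: contraNF yo; apply: mem_mask.
  by apply/esym; apply/negP=> yA; rewrite Ao in yo.
have blt i : nth false bits i -> i < size o.
  by rewrite -sb ltnNge; apply: contraTN => ?; rewrite nth_default.
exists x, bits; split=> //.
  apply/(descendants_max (adj_sym x)); split=> //.
  - move=> c d bc bd cd; have ci := blt c bc; have di := blt d bd.
    rewrite adjE //; apply: Ac; rewrite -?bE // nth_uniq ?later_uniq //.
  - move=> j jo; rewrite bE // => jA.
    have : ~~ [forall y in A, (y != nth x o j) ==> G (nth x o j) y].
      apply: contra jA => /forall_inP h; apply: grow => y yA yj.
      by have /implyP := h y yA; apply.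
    rewrite negb_forall_in => /exists_inP[y yA]; rewrite negb_imply => /andP[yj ny].
    have xo : G x (nth x o j) by have := mem_nth x jo; rewrite mem_later => /andP[].
    have yx : y != x by apply: contraNneq ny => ->; rewrite edge_sym.
    have yo := Ao y yA yx.
    exists (index y o); first by rewrite bE ?index_mem // nth_index.
    by rewrite adjE ?index_mem // nth_index // edge_sym.
apply/hasP=> -[w wL /allP wK].
have wA : w \in A.
  apply: grow => y yA _; have : y \in clique_of x bits by rewrite -KA inE in yA.
  by move=> /wK /=; rewrite mem_later => /andP[].
have : w \in clique_of x bits by rewrite -KA inE in wA.
by move=> /wK /=; rewrite mem_later ltnn andbF.
Qed.

(** [x] is the only member of least rank of its clique, so [x] and then [bits] can be recovered from
    the set. *)
Lemma clique_of_inj x x' bits bits' :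
  bits \in candidates x -> bits' \in candidates x' ->
  [set y in clique_of x bits] = [set y in clique_of x' bits'] -> x = x' /\ bits = bits'.
Proof.
move=> /(descendants_max (adj_sym x))[sb _ _].
move=> /(descendants_max (adj_sym x'))[sb' _ _] e.
have mine y z b : y \in clique_of z b -> y = z \/ r z < r y.
  rewrite mem_rcons inE => /predU1P[->|/mem_mask]; first by left.
  by rewrite mem_later => /andP[_]; right.
have xK : x \in clique_of x' bits' by have /setP/(_ x) := e; rewrite !inE mem_rcons inE eqxx.
have xK' : x' \in clique_of x bits by have /setP/(_ x') := e; rewrite !inE [in RHS]mem_rcons inE eqxx.
have xx : x = x'.
  have [//|lt] := mine _ _ _ xK; have [//|lt'] := mine _ _ _ xK'.
  by have := ltn_trans lt lt'; rewrite ltnn.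
split=> //; subst x'; apply: (@eq_from_nth _ false); rewrite sb ?sb' // => i io.
rewrite -!(@mem_maskP x) //.
have xi : (nth x (later_nbrs x) i == x) = false.
  apply/eqP=> xi; have := mem_nth x io; by rewrite xi mem_later ltnn andbF.
by have /setP/(_ (nth x (later_nbrs x) i)) := e; rewrite !inE !mem_rcons !inE xi.
Qed.

Definition cliques_listed : seq (seq 'I_n) :=
  flatten [seq [seq clique_of x bits | bits <- candidates x & ~~ extendable x bits] | x <- enum 'I_n].

Lemma cliques_listedP : 0 < n ->
  [/\ all uniq cliques_listed, uniq [seq [set y in c] | c <- cliques_listed]
    & [seq [set y in c] | c <- cliques_listed] =i max_cliques G].
Proof.
move=> n0; split.
- apply/allP=> c /flattenP[_ /mapP[x _ ->] /mapP[bits _ ->]].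
  rewrite rcons_uniq mask_uniq ?later_uniq // andbT.
  by apply/negP=> /mem_mask; rewrite mem_later ltnn andbF.
- rewrite /cliques_listed; have := enum_uniq 'I_n; elim: (enum 'I_n) => //= x l IH /andP[xl ul].
  rewrite map_cat cat_uniq IH // andbT -map_comp map_inj_in_uniq; last first.
    move=> b b'; rewrite !mem_filter => /andP[_ bx] /andP[_ b'x] /= e.
    by have [] := clique_of_inj bx b'x e.
  rewrite filter_uniq ?(descendants_uniq (adj_sym _)) //=.
  apply/hasPn=> A /mapP[_ /flattenP[_ /mapP[x' x'l ->] /mapP[b' + ->]] ->].
  rewrite mem_filter => /andP[_ b'x']; apply/mapP=> -[b]; rewrite mem_filter => /andP[_ bx] e.
  by have [xx _] := clique_of_inj b'x' bx e; rewrite -xx x'l in xl.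
- move=> A; apply/mapP/idP => [[c /flattenP[_ /mapP[x _ ->] /mapP[b + ->]] ->]|].
    by rewrite mem_filter => /andP[nb bx]; apply: max_clique_of.
  move=> /(max_clique_listed n0)[x [b [bx nb <-]]]; exists (clique_of x b) => //.
  apply/flattenP; exists [seq clique_of x bits | bits <- candidates x & ~~ extendable x bits].
    by apply/mapP; exists x; rewrite ?mem_enum.
  by apply/mapP; exists b; rewrite // mem_filter nb.
Qed.

(** Level [l] injects into the maximal cliques of the first [l] later neighbours. Thus every level,
    not only the last, obeys the clique bound, and dead ends cannot blow up the tree. *)
Lemma size_descendants x l : l <= size (later_nbrs x) ->
  size (descendants (adj x) l 0 [::]) <= n_max_cliques G [set y in take l (later_nbrs x)].
Proof.
set o := later_nbrs x => lo; set P := [set y in _].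
have so : size (take l o) = l by rewrite size_takel.
have uo : uniq (take l o) by rewrite take_uniq ?later_uniq.
have tko i : i < l -> nth x (take l o) i = nth x o i by move=> il; rewrite nth_take.
have memb bits i : size bits = l -> i < l ->
    (nth x o i \in mask bits (take l o)) = nth false bits i.
  by move=> sb il; rewrite -tko // in_mask // mem_nth ?so //= index_uniq ?so.
pose f bits := [set y in mask bits (take l o)].
have finj : {in descendants (adj x) l 0 [::] &, injective f}.
  move=> b b' /(descendants_max (adj_sym x))[sb _ _].
  move=> /(descendants_max (adj_sym x))[sb' _ _] e.
  apply: (@eq_from_nth _ false); rewrite sb ?sb' // => i il.
  by rewrite -(memb b) // -(memb b') //; have /setP/(_ (nth x o i)) := e; rewrite !inE.
rewrite -(size_map f) -(card_uniqP _); last by rewrite map_inj_in_uniq ?(descendants_uniq (adj_sym _)).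
apply/subset_leq_card/subsetP=> A /mapP[b /(descendants_max (adj_sym x))[sb bc bm] ->].
have blt i : nth false b i -> i < l.
  by rewrite -sb ltnNge; apply: contraTN => ?; rewrite nth_default.
have inf y : y \in f b -> exists2 i, nth false b i & y = nth x o i.
  rewrite inE => ym; have yt := mem_mask ym.
  have il : index y (take l o) < l by rewrite -{2}so index_mem.
  exists (index y (take l o)); last by rewrite -tko // nth_index.
  by rewrite -memb // -tko // nth_index.
rewrite inE; apply/max_clique_inP; split.
- by apply/subsetP=> y; rewrite !inE => /mem_mask.
- move=> y z /inf[i bi ->] /inf[j bj ->] yz.
  rewrite -adjE ?(leq_trans (blt _ _)) //; apply: bc => //.
  by apply: contraNneq yz => ->.
- move=> y; rewrite inE => yt yf.
  have il : index y (take l o) < l by rewrite -{2}so index_mem.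
  have yE : y = nth x o (index y (take l o)) by rewrite -tko // nth_index.
  rewrite inE yE memb //; apply: contraT => /(bm _ il)[c bc' cy].
  have := yf (nth x o c); rewrite inE memb ?blt // bc' => /(_ isT).
  have co : c < size o := leq_trans (blt _ bc') lo.
  have yo : index y (take l o) < size o := leq_trans il lo.
  by rewrite edge_sym {1}yE -adjE // (negbTE cy).
Qed.

End Listing.

(** * Running the compiled program *)

Lemma take_enum_ord n (v : 'I_n) : take v (enum 'I_n) = [seq u : 'I_n <- enum 'I_n | u < v].
Proof.
apply: (inj_map val_inj); rewrite map_take -(filter_map val (fun u => u < v)) val_enum_ord.
have vn := ltnW (ltn_ord v).
by rewrite take_iota (minn_idPl vn) -(filter_iota_ltn 0 vn).
Qed.

Lemma flatten_if (S T : Type) (p : pred S) (f : S -> seq T) (l : seq S) :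
  flatten [seq if p b then f b else [::] | b <- l] = flatten [seq f b | b <- l & p b].
Proof. by elim: l => //= b l ->; case: (p b). Qed.

Section Instance.
Variables (n : nat) (G : sgraph 'I_n) (L : 'I_n -> seq 'I_n).
Hypothesis GL : adjacency_lists G L.

Definition nat_nbrs (v : nat) : seq nat :=
  if insub v is Some x then map val (L x) else [::].

Lemma nat_nbrsE (x : 'I_n) : nat_nbrs x = map val (L x).
Proof. by rewrite /nat_nbrs valK. Qed.

Lemma nat_nbrs_uniq v : v < n -> uniq (nat_nbrs v).
Proof.
move=> vn; rewrite -[v]/(val (Ordinal vn)) nat_nbrsE map_inj_uniq; last exact: val_inj.
by case: (GL (Ordinal vn)).
Qed.

Lemma nat_nbrs_lt v w : v < n -> w \in nat_nbrs v -> w < n.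
Proof. by move=> vn; rewrite -[v]/(val (Ordinal vn)) nat_nbrsE => /mapP[x _ ->]; apply: ltn_ord. Qed.

Lemma mem_nat_nbrs (x y : 'I_n) : (val y \in nat_nbrs x) = G x y.
Proof. by rewrite nat_nbrsE mem_map; [have [_ ->] := GL x|exact: val_inj]. Qed.

Lemma nat_nbrs_sym v w : v < n -> w < n -> (v \in nat_nbrs w) = (w \in nat_nbrs v).
Proof.
move=> vn wn; rewrite -[v]/(val (Ordinal vn)) -[w]/(val (Ordinal wn)).
by rewrite !mem_nat_nbrs edge_sym.
Qed.

Lemma size_nbrs_list x : size (L x) = #|nbrs G x|.
Proof.
have [u m] := GL x; rewrite -(card_uniqP u); apply: eq_card => y.
by rewrite m inE.
Qed.

Lemma sum_nat_nbrs : \sum_(v <- iota 0 n) (size (nat_nbrs v) + 1) = #|arcs G| + n.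
Proof.
rewrite -val_enum_ord big_map big_enum /= big_split /= sum1_card card_ord card_arcs.
by congr (_ + _); apply: eq_bigr => x _; rewrite nat_nbrsE size_map size_nbrs_list.
Qed.

Lemma size_encode_graph : size (encode_graph L) = #|arcs G| + 2 * n.
Proof.
rewrite size_cat size_map -cardE card_ord size_flatten /shape -map_comp sumnE big_map big_enum /=.
rewrite (eq_bigr (fun x => #|nbrs G x| + 1)).
  have e : \sum_(x in 'I_n) #|nbrs G x| = #|arcs G| by rewrite card_arcs; apply: eq_bigl.
  by rewrite big_split /= sum1_card card_ord e mul2n -addnn addnCA.
by move=> x _; rewrite size_map size_nbrs_list addn1.
Qed.

Lemma nth_encode_offset (x : 'I_n) :
  nth 0 (encode_graph L) x = n + \sum_(u < n | u < x) size (encode_list (L u)).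
Proof.
rewrite nth_cat size_map -cardE card_ord ltn_ord (nth_map x) -?cardE ?card_ord //.
by rewrite nth_ord_enum.
Qed.

Lemma nth_encode_list (x : 'I_n) i : i < size (encode_list (L x)) ->
  nth 0 (encode_graph L) (nth 0 (encode_graph L) x + i) = nth 0 (encode_list (L x)) i /\
  nth 0 (encode_graph L) x + i < size (encode_graph L).
Proof.
move=> ix; rewrite nth_encode_offset.
have sh : \sum_(u < n | u < x) size (encode_list (L u)) =
    size (flatten [seq encode_list (L u) | u <- take x (enum 'I_n)]).
  rewrite size_flatten /shape -map_comp sumnE big_map.
  by rewrite take_enum_ord big_filter big_enum_cond.
have fl : flatten [seq encode_list (L v) | v : 'I_n] =
    flatten [seq encode_list (L u) | u <- take x (enum 'I_n)] ++
    (encode_list (L x) ++ flatten [seq encode_list (L u) | u <- drop x.+1 (enum 'I_n)]).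
  rewrite /image_mem -{1}(cat_take_drop x (enum 'I_n)) map_cat flatten_cat.
  by rewrite (drop_nth x) -?cardE ?card_ord // nth_ord_enum.
have sz : size [seq n + \sum_(u < n | u < v) size (encode_list (L u)) | v : 'I_n] = n.
  by rewrite size_map -cardE card_ord.
rewrite /encode_graph fl size_cat sz nth_cat sz -addnA ifN -?leqNgt ?leq_addr // addKn sh; split.
  by rewrite nth_cat ifN -?leqNgt ?leq_addr // addKn nth_cat ix.
by rewrite ltn_add2l [X in _ < X]size_cat ltn_add2l size_cat ltn_addr.
Qed.

Lemma input_length v : v < n ->
  nth 0 (encode_graph L) v < size (encode_graph L) /\
  nth 0 (encode_graph L) (nth 0 (encode_graph L) v) = size (nat_nbrs v).
Proof.
move=> vn; rewrite -[v]/(val (Ordinal vn)) nat_nbrsE size_map.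
by have [] := @nth_encode_list (Ordinal vn) 0 isT; rewrite addn0.
Qed.

Lemma input_nbr v j : v < n -> j < size (nat_nbrs v) ->
  nth 0 (encode_graph L) v + 1 + j < size (encode_graph L) /\
  nth 0 (encode_graph L) (nth 0 (encode_graph L) v + 1 + j) = nth 0 (nat_nbrs v) j.
Proof.
move=> vn; rewrite -[v]/(val (Ordinal vn)) nat_nbrsE size_map => jL.
have [] := @nth_encode_list (Ordinal vn) j.+1; first by rewrite /= size_map.
by rewrite -addnA add1n.
Qed.

Section Order.
Variable ps : seq nat.
Hypothesis ps_perm : perm_eq ps (iota 0 n).

Definition rank (x : 'I_n) : nat := index (val x) ps.

Lemma mem_order (x : 'I_n) : val x \in ps.
Proof. by rewrite (perm_mem ps_perm) mem_iota add0n ltn_ord. Qed.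

Lemma rank_inj : injective rank.
Proof.
move=> x y e; apply: val_inj; rewrite -(nth_index 0 (mem_order x)) -(nth_index 0 (mem_order y)).
by rewrite -[index _ _]/(rank x) e.
Qed.

Local Notation laterE := (later_nbrs L rank).

Lemma later_val (x : 'I_n) : later nat_nbrs ps x = map val (laterE x).
Proof. by rewrite /later nat_nbrsE filter_map. Qed.

Lemma mem_later_val (x y : 'I_n) : (val y \in later nat_nbrs ps x) = (y \in laterE x).
Proof. by rewrite later_val mem_map //; exact: val_inj. Qed.

Local Notation adj := (fun x : 'I_n => local_adj (later nat_nbrs ps) x).

Lemma local_adj_sym (x : 'I_n) i j : adj x i j = adj x j i.
Proof. exact: orbC. Qed.

(** Ranks are distinct, so an edge shows up among the later neighbours of exactly one of its
    ends. *)
Lemma local_adjE (x : 'I_n) i j : i < size (laterE x) -> j < size (laterE x) ->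
  adj x i j = G (nth x (laterE x) i) (nth x (laterE x) j).
Proof.
move=> il jl; rewrite /local_adj later_val !(nth_map x) //.
move: (nth x _ i) (nth x _ j) => y z.
rewrite !mem_later_val !(mem_later _ GL) (edge_sym G z y) -andb_orr -neq_ltn.
have [/rank_inj->|_] := eqVneq (rank y) (rank z); last by rewrite andbT.
by rewrite edge_irr.
Qed.

Lemma listing_atE (x : 'I_n) :
  listing_at nat_nbrs (later nat_nbrs ps) x =
  flatten [seq encode_list (clique_of L rank x bits) |
             bits <- candidates L rank adj x & ~~ extendable L rank x bits].
Proof.
rewrite -flatten_if /listing_at /listing /candidates later_val size_map.
congr flatten; apply/eq_in_map => bits /(descendants_max (local_adj_sym x))[sb _ _].
have mE : members (later nat_nbrs ps) x bits = map val (clique_of L rank x bits).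
  rewrite /members later_val -!cats1 mask_cat ?size_map //=.
  by rewrite -map_mask /clique_of map_rcons cats1.
rewrite mE; congr (if ~~ _ then _ else _); last by rewrite size_map.
rewrite nat_nbrsE has_map; apply: eq_has => w /=.
by rewrite mE all_map; apply: eq_all => y /=; rewrite mem_later_val.
Qed.

Lemma listing_correct : 0 < n ->
  lists_max_cliques G
    (flatten [seq listing_at nat_nbrs (later nat_nbrs ps) v | v <- iota 0 n]).
Proof.
move=> n0; have [Cu Au Ai] := cliques_listedP GL rank_inj local_adj_sym local_adjE n0.
exists (cliques_listed L rank adj); split=> //.
rewrite -val_enum_ord -map_comp /cliques_listed map_flatten.
elim: (enum 'I_n) => //= x l ->; rewrite flatten_cat listing_atE.
by congr (flatten _ ++ _); rewrite -map_comp.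
Qed.

Lemma tree_size_le (D N : nat) (x : 'I_n) : size (later nat_nbrs ps x) <= D ->
  (forall P : {set 'I_n}, #|P| <= D -> n_max_cliques G P <= N) ->
  tree_size (adj x) (size (later nat_nbrs ps x)) 0 [::] <= (D + 1) * N.
Proof.
rewrite later_val size_map => lD NP; rewrite tree_size_sum.
apply: leq_trans (_ : \sum_(l < (size (laterE x)).+1) N <= _); last first.
  by rewrite sum_nat_const card_ord leq_mul // addn1.
apply: leq_sum => l _; have ls : l <= size (laterE x) by rewrite -ltnS.
apply: leq_trans (size_descendants GL local_adj_sym local_adjE ls) _.
apply: NP; apply: leq_trans lD; apply: (leq_trans _ ls).
by rewrite cardsE -{2}(size_takel ls) card_size.
Qed.

End Order.

Lemma peelable (t : nat) (ps : seq nat) : ~ has_model t G ->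
  uniq ps -> {in ps, forall u, u < n} -> size ps < n ->
  exists u, [/\ u < n, u \notin ps & live nat_nbrs ps u <= 400 * t * (400 * t)].
Proof.
move=> nm ups psn sps; pose S := [set x : 'I_n | val x \notin ps].
have S0 : S != set0.
  apply: contraTneq sps => S0; rewrite -leqNgt -[X in X <= _](size_iota 0).
  apply: uniq_leq_size; first exact: iota_uniq.
  move=> v; rewrite mem_iota add0n => /= vn; apply: contraT => vps.
  by have := in_set0 (Ordinal vn); rewrite -S0 inE vps.
have [x xS le] := sparse_vertex nm S0; exists x; split; [exact: ltn_ord|by rewrite inE in xS|].
apply: leq_trans le; rewrite /live nat_nbrsE count_map -size_filter.
have [u m] := GL x.
rewrite -(card_uniqP _) ?filter_uniq // subset_leq_card //; apply/subsetP=> y.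
by rewrite mem_filter !inE m => /andP[-> ->].
Qed.

End Instance.

(* The arrays start at [((400 * t) ^ 2 + 2) * n], beyond the input by [few_arcs]. *)
Definition prelude : program :=
  [:: Const 41 400; Arith Mul 41 41 0; Arith Mul 41 41 41; Const 42 2; Arith Add 41 41 42;
      Arith Mul nvars 41 1].

Definition linked (c : cmd) : program := prelude ++ compile (size prelude) c.

(** The factor 20 makes [U = (n + t + 2) ^ 20] exceed every stored value; [csize Main] accounts for
    intermediate values, and the successor ensures [U <= w]. *)
Definition lister_exponent : nat := 20 * (csize Main).+1.

Local Arguments exec : simpl never.

Lemma exec_prelude w P (c : config) : code_at P (pc c) prelude -> 400 < w ->
  let D := 400 * reg c 0 * (400 * reg c 0) in D + 2 < w -> (D + 2) * reg c 1 < w ->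
  exists c', [/\ exec w P 6 c = Some c', pc c' = pc c + 6,
    memory c' = memory c /\ out c' = out c, reg c' nvars = (D + 2) * reg c 1
    & forall x, x < nvars -> reg c' x = reg c x].
Proof.
move=> h1 w400 D Dw Zw.
have h2 := code_at_behead h1; have h3 := code_at_behead h2; have h4 := code_at_behead h3.
have h5 := code_at_behead h4; have h6 := code_at_behead h5.
have Dw' : D < w by apply: leq_ltn_trans Dw; apply: leq_addr.
have w2 : 2 < w by apply: leq_trans w400.
have w400t : 400 * reg c 0 < w.
  case: (reg c 0) @D Dw' {Dw Zw} => [|m] D Dw'; first by rewrite muln0; lia.
  by apply: leq_ltn_trans Dw'; rewrite /D leq_pmulr.
pose r1 := upd (reg c) 41 400; pose r2 := upd r1 41 (r1 41 * r1 0).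
pose r3 := upd r2 41 (r2 41 * r2 41); pose r4 := upd r3 42 2.
pose r5 := upd r4 41 (r4 41 + r4 42); pose r6 := upd r5 nvars (r5 41 * r5 1).
exists (Config (pc c).+2.+4 r6 (memory c) (out c)); split; [|by rewrite !addnS addn0|by []|by []|].
- rewrite (@execS w P _ _ _ (@step_const w P c _ _ _ h1 w400)) -/r1.
  rewrite (@execS w P _ _ _ (@step_arith w P (Config _ r1 _ _) _ _ _ _ _ h2 w400t)) -/r2.
  rewrite (@execS w P _ _ _ (@step_arith w P (Config _ r2 _ _) _ _ _ _ _ h3 Dw')) -/r3.
  rewrite (@execS w P _ _ _ (@step_const w P (Config _ r3 _ _) _ _ _ h4 w2)) -/r4.
  rewrite (@execS w P _ _ _ (@step_arith w P (Config _ r4 _ _) _ _ _ _ _ h5 Dw)) -/r5.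
  by rewrite (@execS w P _ _ _ (@step_arith w P (Config _ r5 _ _) _ _ _ _ _ h6 Zw)) -/r6.
- move=> x xv; have ne y : nvars <= y -> (x == y) = false.
    by move=> vy; apply: ltn_eqF; apply: leq_trans vy.
  by rewrite -[LHS]/(r6 x) /r6 /r5 /r4 /r3 /r2 /r1 /upd !ne.
Qed.

(** From [4 <= b] follow [400 * t <= b ^ 6], [D <= b ^ 12] and [D + 2 <= b ^ 13], with one more
    factor [b] for [n]; the exponent 20 leaves slack. *)
Lemma lister_bounds t n : let b := n + t + 2 in let D := 400 * t * (400 * t) in
  0 < t -> 0 < n ->
  [/\ 400 < b ^ 20, D + 2 < b ^ 20, (D + 2) * n < b ^ 20, n < b ^ 20 & t < b ^ 20].
Proof.
move=> b D t0 n0.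
have b4 : 4 <= b by rewrite /b; lia.
have b1 : 1 < b by lia.
have b5 : 400 < b ^ 5 by apply: (@leq_trans (4 ^ 5)) => //; rewrite leq_exp2r.
have tb : t <= b by rewrite /b; lia.
have nb : n <= b by rewrite /b; lia.
have D12 : D <= b ^ 12.
  rewrite (_ : b ^ 12 = b ^ 6 * b ^ 6); last by rewrite -expnD.
  have le6 : 400 * t <= b ^ 6 by rewrite (expnSr b 5) leq_mul // ltnW.
  exact: leq_mul.
have S13 : D + 2 <= b ^ 13.
  have bX m : 0 < m -> b <= b ^ m.
    by move=> m0; rewrite -[X in X <= _]expn1 leq_exp2l.
  have b12 : 2 <= b ^ 12 := leq_trans b1 (bX 12 isT).
  apply: (@leq_trans (2 * b ^ 12)); first by lia.
  by rewrite expnS leq_mul2r b1 orbT.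
have lt20 m : m < 20 -> b ^ m < b ^ 20 by move=> m20; rewrite ltn_exp2l.
split.
- exact: ltn_trans b5 (lt20 5 isT).
- exact: leq_ltn_trans S13 (lt20 13 isT).
- by apply: leq_ltn_trans (leq_mul S13 nb) _; rewrite -expnSr lt20.
- by apply: leq_ltn_trans nb _; rewrite -[X in X < _]expn1 lt20.
- by apply: leq_ltn_trans tb _; rewrite -[X in X < _]expn1 lt20.
Qed.

Lemma code_at_prefix p1 p2 : code_at (p1 ++ p2) 0 p1.
Proof. by move=> i ip; rewrite add0n nth_cat ip. Qed.

Lemma code_at_suffix p1 p2 : code_at (p1 ++ p2) (size p1) p2.
Proof. by move=> i ip; rewrite nth_cat ltnNge leq_addr /= addKn. Qed.

(** The hypothesis on [inp] makes memory zero from [Z] on, which realises the initial state with all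
    arrays zero. *)
Lemma linked_correct (c : cmd) (t n U w T : nat) (inp : nat -> nat) (s' : state) :
  let D := 400 * t * (400 * t) in let Z := (D + 2) * n in
  400 < U -> D + 2 < U -> Z < U -> n < U -> t < U -> U <= w -> U ^ csize c <= w -> wf c ->
  (forall i, Z <= i -> inp i = 0) ->
  run Z U inp c (State (nth 0 [:: t; n]) (fun _ _ => 0) [::]) s' T ->
  halts_in w (linked c) (Config 0 (nth 0 [:: t; n]) inp [::]) (6 + T) (outp s').
Proof.
move=> D Z U400 SU ZU nU tU Uw cw wc inp0 rT.
set s0 := State _ _ _ in rT; set ini := Config _ _ _ _.
have [c0 [e0 p0 [m0 o0] z0 r0]] :=
  @exec_prelude w (linked c) ini (@code_at_prefix _ _) (leq_trans U400 Uw)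
    (leq_trans SU Uw) (leq_trans ZU Uw).
have code0 : code_at (linked c) (pc c0) (compile (pc c0) c).
  by rewrite p0; apply: code_at_suffix.
have repr0 : represents Z inp s0 c0.
  split=> //; first by move=> i _; rewrite m0.
  by move=> a i _; rewrite m0; apply: inp0; apply: leq_addr.
have bnd0 : bounded U s0.
  split=> [x _|a i _]; last by apply: leq_trans U400.
  by case: x => [|[|x]] //=; rewrite nth_nil; apply: leq_trans U400.
have [c1 [e1 p1 [_ _ _ _ o1] _]] := run_correct U400 ZU Uw rT wc cw bnd0 code0 repr0.
exists c1; split=> //; first by rewrite (execD T e0).
by rewrite /current p1 p0 nth_default // size_cat.
Qed.

Lemma lister_correct (t n : nat) (G : sgraph 'I_n) (L : 'I_n -> seq 'I_n) (N : nat) :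
  let D := 400 * t * (400 * t) in
  0 < t -> 0 < n -> ~ has_model t G -> adjacency_lists G L ->
  0 < N -> (forall P : {set 'I_n}, #|P| <= D -> n_max_cliques G P <= N) ->
  exists T o, [/\ halts_in (word_bound lister_exponent t n) (linked Main) (init_config t L) T o,
    lists_max_cliques G o & T <= 6 + 4000 * (n * ((D + 2) ^ 4 * ((D + 1) * N)))].
Proof.
move=> D t0 n0 nm GL N0 NP.
have [U400 SU ZU nU tU] := lister_bounds t0 n0.
set U := (n + t + 2) ^ 20 in U400 SU ZU nU tU.
have arcsD : #|arcs G| <= D * n.
  have c0 : 0 < #|'I_n| by rewrite card_ord.
  apply: leq_trans (ltnW (few_arcs nm c0)) _; rewrite card_ord leq_mul2r; apply/orP; right.
  have -> : D = 4 * (100 * t) * (4 * (100 * t)) by rewrite /D !(mulnA 4 100).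
  by rewrite mulnACA mulnn leq_mul.
set Z := (D + 2) * n.
have sZ : size (encode_graph L) <= Z by rewrite (size_encode_graph GL) /Z mulnDl leq_add2r.
pose s0 := State (nth 0 [:: t; n]) (fun _ _ => 0) [::].
have nbU v : v < n -> size (nat_nbrs L v) < U.
  move=> vn; apply: leq_ltn_trans nU; rewrite -[X in _ <= X](size_iota 0).
  apply: uniq_leq_size; first exact: nat_nbrs_uniq.
  by move=> w wv; rewrite mem_iota (nat_nbrs_lt vn wv).
have [s' [T [rT TB [ps [pps lD outE]]]]] :
    tot Z U (nth 0 (encode_graph L)) Main s0 (4000 * (n * ((D + 2) ^ 4 * ((D + 1) * N))))
      (fun s' => exists ps, [/\ perm_eq ps (iota 0 n),
         forall u, u < n -> size (later (nat_nbrs L) ps u) <= D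
       & outp s' = flatten [seq listing_at (nat_nbrs L) (later (nat_nbrs L) ps) v | v <- iota 0 n]]).
  apply: tot_main => //.
  - exact: nat_nbrs_uniq.
  - exact: nat_nbrs_lt.
  - exact: nat_nbrs_sym.
  - move=> v vn; split; last by apply: leq_trans sZ; have [] := input_length L vn.
    by apply: (leq_trans vn); rewrite leq_pmull // addn2.
  - by move=> v vn; have [] := input_length L vn.
  - move=> v j vn jL; have [h1 h2] := input_nbr vn jL; split=> //; exact: leq_trans sZ.
  - by move=> ps; apply: peelable.
  - move=> ps pps lD u un; apply: (@tree_size_le _ _ _ GL _ pps D N (Ordinal un)) NP.
    exact: lD.
  - by rewrite muln_gt0 addn1.
  - by rewrite (sum_nat_nbrs GL) mulnDr (mulnC n) leq_add // leq_pmulr.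
have wE : word_bound lister_exponent t n = U ^ (csize Main).+1 by rewrite /word_bound expnM.
have U1 : 0 < U by apply: leq_trans U400.
exists (6 + T), (outp s'); split.
- apply: linked_correct U400 SU ZU nU tU _ _ _ _ rT.
  + by rewrite wE -{1}(expn1 U) leq_pexp2l.
  + by rewrite wE leq_pexp2l.
  + by [].
  + by move=> i Zi; apply: nth_default; apply: leq_trans sZ Zi.
- by rewrite outE; apply: listing_correct.
- by rewrite leq_add2l.
Qed.

(** * Growth of the bounds *)

(** Little-o without reals: the quotient by [t] is eventually at most [1 / j] for every [j]. *)
Definition sublinear (f : nat -> nat) : Prop :=
  forall j, exists N, forall t, N <= t -> j * f t <= t.

Lemma cube_le_exp2 m : m.+1 ^ 3 <= 16 * 2 ^ m.
Proof.
case: (leqP m 3) => [|m3]; first by case: m => [|[|[|[|]]]].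
elim: m m3 => // m IH; rewrite ltnS leq_eqVlt => /predU1P[<-//|m3].
rewrite [2 ^ _]expnS mulnCA; apply: leq_trans (_ : 2 * m.+1 ^ 3 <= _); last by rewrite leq_mul2l IH.
by rewrite !expnS !expn0 !muln1; nia.
Qed.

Lemma square_le_exp2 c m : 16 * c <= m -> c * m.+1 ^ 2 <= 2 ^ m.
Proof.
move=> cm; rewrite -(leq_pmul2l (isT : 0 < 16)); apply: leq_trans (cube_le_exp2 m).
by rewrite mulnA expnS leq_mul2r (leq_trans cm) ?orbT.
Qed.

Lemma sublinear_log : sublinear (fun t => trunc_log 2 t + 3).
Proof.
move=> j; exists (2 ^ (16 * (3 * j))) => t Nt.
have l0 := trunc_log_max (isT : 1 < 2) Nt.
have t0 : 0 < t by apply: leq_trans Nt; rewrite expn_gt0.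
have tl : 2 ^ trunc_log 2 t <= t by apply: trunc_logP.
apply: leq_trans tl; apply: leq_trans (square_le_exp2 l0).
rewrite -mulnA mulnCA; apply: leq_mul => //.
by move: (trunc_log 2 t) => l; rewrite expnS expn1; nia.
Qed.

(** The parameter [d]: within a constant factor of [t ^ (1/3)], and a power of two to ease the
    estimates. *)
Definition branching t : nat := 2 ^ (trunc_log 2 t %/ 3).

(** The threshold [M] of [n_max_cliques_large] for [L = 2 * trunc_log 2 t + 20], chosen so that the
    degree bound is below [2 ^ L]. *)
Definition core_size t : nat := 10 * (t * (4 * (2 * trunc_log 2 t + 20) + 2)).

(** The summands pay, in order, for numerical constants, the polynomial factor in the degree bound,
    the [d ^ 2] of the dense case, the medium branchings and the large branchings. *)
Definition excess t : nat :=
  let l := trunc_log 2 t in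
  8 + 5 * (l + 11) + branching t ^ 2 + (l + 6) * (core_size t %/ (branching t).+1) +
  (l + 11) * (4 * l + 40).

(** Both [d ^ 2] and [t / d] are of order [t ^ (2/3)], here [2 ^ (l - l %/ 3)]; all other factors
    are polylogarithmic. *)
Lemma excess_le t l : 0 < t -> l = trunc_log 2 t ->
  excess t <= 11 * (10 * 100) * (l.+1 ^ 2 * 2 ^ (l - l %/ 3)).
Proof.
move=> t0 lE.
have X0 : 0 < 2 ^ (l - l %/ 3) by rewrite expn_gt0.
have dX : branching t ^ 2 <= 2 ^ (l - l %/ 3).
  by rewrite /branching -lE -expnM leq_exp2l //; lia.
have cX : core_size t %/ (branching t).+1 <= 1640 * (l.+1 * 2 ^ (l - l %/ 3)).
  apply: (@leq_trans (core_size t %/ branching t)).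
    by apply: leq_div2l; rewrite ?expn_gt0.
  rewrite -(leq_pmul2r (_ : 0 < branching t)); last by rewrite expn_gt0.
  apply: leq_trans (leq_divM _ _) _.
  rewrite /branching -lE -!mulnA -expnD subnK ?leq_div // /core_size -lE.
  have : t <= 2 * 2 ^ l by rewrite -expnS lE ltnW // trunc_log_ltn.
  move: (2 ^ l) => Y tY.
  apply: (@leq_trans (10 * (2 * Y * (82 * l.+1)))); last by lia.
  by rewrite leq_mul2l leq_mul //; lia.
rewrite /excess -lE; move: dX cX X0.
move: (branching t ^ 2) (core_size t %/ _) (2 ^ (l - _)) => d c X dX cX X0.
have h1 : (l + 6) * c <= 6 * 1640 * (l.+1 ^ 2 * X).
  apply: (@leq_trans (6 * l.+1 * (1640 * (l.+1 * X)))); first by apply: leq_mul => //; lia.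
  by rewrite mulnACA (mulnA l.+1) mulnn.
have h2 : (l + 11) * (4 * l + 40) <= 440 * l.+1 ^ 2.
  apply: (@leq_trans (11 * l.+1 * (40 * l.+1))); first by apply: leq_mul; lia.
  by rewrite expnS expn1; lia.
have h3 : 8 + 5 * (l + 11) <= 63 * l.+1 ^ 2.
  by rewrite expnS expn1; nia.
set Q := l.+1 ^ 2 in h1 h2 h3 *.
have Q0 : 0 < Q by rewrite expn_gt0.
have h4 : Q <= Q * X by rewrite leq_pmulr.
have h5 : X <= Q * X by rewrite leq_pmull.
move: (Q * X) h1 h4 h5 => Y h1 h4 h5.
lia.
Qed.

Lemma sublinear_excess : sublinear excess.
Proof.
move=> j; set C := 11 * (10 * 100).
exists (2 ^ (3 * (16 * (9 * (j * C))))) => t Nt; set l := trunc_log 2 t.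
have t0 : 0 < t by apply: leq_trans Nt; rewrite expn_gt0.
have l0 : 16 * (9 * (j * C)) <= l %/ 3.
  by rewrite leq_divRL // mulnC; apply: trunc_log_max.
apply: (@leq_trans (2 ^ l)); last by apply: trunc_logP.
apply: leq_trans (leq_mul (leqnn j) (excess_le t0 erefl)) _; rewrite -/l -/C.
have -> : 2 ^ l = 2 ^ (l %/ 3) * 2 ^ (l - l %/ 3) by rewrite -expnD subnKC ?leq_div.
rewrite 2!mulnA leq_mul2r; apply/orP; right.
apply: leq_trans (square_le_exp2 l0).
(* The 9 in the threshold is the square of the 3 in [l + 1 <= 3 * (l %/ 3 + 1)]. *)
rewrite [9 * _]mulnC -(mulnA _ 9) leq_mul2l -[9 * _]/(3 ^ 2 * _) -expnMn leq_exp2r //.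
by apply/orP; right; lia.
Qed.

Lemma trunc_log2_bounds t : t < 2 * 2 ^ trunc_log 2 t.
Proof. by rewrite -expnS trunc_log_ltn. Qed.

Lemma exp4E l : 4 ^ l = 2 ^ l * 2 ^ l.
Proof. by rewrite -expnMn. Qed.

Lemma core_size_lt l t : l = trunc_log 2 t -> (core_size t).+1 <= 4 ^ (l + 6).
Proof.
move=> lE; rewrite /core_size -lE.
have tY : t < 2 * 2 ^ l by rewrite lE trunc_log2_bounds.
have lY : l < 2 ^ l by rewrite ltn_expl.
rewrite expnD exp4E; move: (2 ^ l) tY lY => Y tY lY.
have tlY : t * (4 * (2 * l + 20) + 2) <= 164 * (Y * Y).
  by apply: (@leq_trans (2 * Y * (82 * Y))); [apply: leq_mul; lia|lia].
have YY : 0 < Y * Y by case: Y lY {tY tlY}.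
by rewrite (_ : 4 ^ 6 = 64 * 64) //; lia.
Qed.

Lemma degree_bound_le l t : l = trunc_log 2 t ->
  400 * t * (400 * t) < 2 ^ (2 * l + 20) /\ 400 * t * (400 * t) + 2 <= 4 ^ (l + 11).
Proof.
move=> lE.
have tY : t < 2 * 2 ^ l by rewrite lE trunc_log2_bounds.
have lt10 : 400 * t < 2 ^ (l + 10).
  rewrite expnD (_ : 2 ^ 10 = 32 * 32) //; move: (2 ^ l) tY => Y; lia.
have lt20 : 400 * t * (400 * t) < 2 ^ (2 * l + 20).
  have -> : 2 * l + 20 = (l + 10) + (l + 10) by lia.
  by rewrite expnD ltn_mul.
split=> //; have -> : l + 11 = (l + 10).+1 by rewrite addnS.
rewrite expnS exp4E -expnD (_ : l + 10 + (l + 10) = 2 * l + 20); last by lia.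
by move: lt20; move: (400 * t * _) (2 ^ _) => x y; lia.
Qed.

Lemma exp_le4 a b k : a <= 4 ^ b -> a ^ k <= 4 ^ (b * k).
Proof. by case: k => [|k] ab; rewrite ?muln0 ?expn0 // expnM leq_exp2r. Qed.

(** [j = 4 * l + 40] fits because [#|P| < 2 ^ (2 * l + 20)]; the bases of both branching factors are
    bounded by powers of 4 to collect everything in one exponent. *)
Lemma few_max_cliques (V : finType) (G : sgraph V) (t l : nat) (P : {set V}) :
  l = trunc_log 2 t -> ~ has_model t G -> #|P| <= 400 * t * (400 * t) ->
  n_max_cliques G P <=
    4 ^ ((2 * t + branching t ^ 2) %/ 5 + 1 +
         (l + 6) * (core_size t %/ (branching t).+1) + (l + 11) * (4 * l + 40)).
Proof.
move=> lE nm PD; have [Dlt Dle] := degree_bound_le lE.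
have PL : #|P| < 2 ^ (2 * l + 20) by apply: leq_ltn_trans Dlt.
have PL2 : #|P| ^ 2 < 2 ^ (4 * l + 40).
  have -> : 4 * l + 40 = (2 * l + 20) * 2 by lia.
  by rewrite expnM ltn_exp2r.
apply: leq_trans (n_max_cliques_large nm (branching t) PL PL2) _.
have -> : 10 * (t * (4 * (2 * l + 20) + 2)) = core_size t by rewrite /core_size -lE.
rewrite addn1 [4 ^ (_ + (l + 11) * _)]expnD; apply: leq_mul; last first.
  by apply: exp_le4; apply: leq_trans Dle; rewrite addn2 ltnS leqW.
rewrite expnD; apply: leq_mul => //; apply: exp_le4.
exact: core_size_lt.
Qed.

Lemma time_bound (t n l E : nat) : 0 < n -> l = trunc_log 2 t ->
  E = (2 * t + branching t ^ 2) %/ 5 + 1 +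
         (l + 6) * (core_size t %/ (branching t).+1) + (l + 11) * (4 * l + 40) ->
  let D := 400 * t * (400 * t) in
  exists2 e, 5 * e <= 2 * t + 5 * excess t &
    6 + 4000 * (n * ((D + 2) ^ 4 * ((D + 1) * 4 ^ E))) <= n * 4 ^ e.
Proof.
move=> n0 lE EE D; have [_ Dle] := degree_bound_le lE.
exists (6 + ((l + 11) * 4 + (l + 11 + E))).
  have : 5 * ((2 * t + branching t ^ 2) %/ 5) <= 2 * t + branching t ^ 2 by rewrite mulnC leq_divM.
  rewrite EE /excess -lE; set c := core_size t %/ _; set q := (2 * t + _) %/ 5; set d := branching t ^ 2.
  by set x := (l + 6) * c; set y := (l + 11) * _; lia.
have X0 : 0 < (D + 2) ^ 4 * ((D + 1) * 4 ^ E) by rewrite !muln_gt0 !expn_gt0 addn2 addn1.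
have le : (D + 2) ^ 4 * ((D + 1) * 4 ^ E) <= 4 ^ ((l + 11) * 4 + (l + 11 + E)).
  rewrite 2!expnD; apply: leq_mul; first exact: exp_le4.
  by rewrite leq_mul2r; apply/orP; right; apply: leq_trans Dle; rewrite leq_add2l.
move: X0 le; set X := (D + 2) ^ 4 * _ => X0 le.
rewrite [4 ^ (6 + _)]expnD [leqRHS]mulnCA.
apply: (@leq_trans (64 * 64 * (n * X))).
  have : 0 < n * X by rewrite muln_gt0 n0.
  by move: (n * X) => x; lia.
by rewrite (_ : 4 ^ 6 = 64 * 64) // leq_mul2l leq_mul2l le orbT.
Qed.

Lemma lister_time (t n : nat) (G : sgraph 'I_n) (L : 'I_n -> seq 'I_n) :
  0 < t -> 0 < n -> K_minor_free t G -> adjacency_lists G L ->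
  exists T o e,
    [/\ halts_in (word_bound lister_exponent t n) (linked Main) (init_config t L) T o,
        lists_max_cliques G o, T <= n * 4 ^ e & 5 * e <= 2 * t + 5 * excess t].
Proof.
move=> t0 n0 /K_minor_freeP nm GL.
have [e le Te] := time_bound n0 (erefl (trunc_log 2 t)) erefl.
have [T [o [h1 h2 h3]]] := lister_correct t0 n0 nm GL (expn_gt0 4 _)
  (fun P => few_max_cliques (erefl _) nm).
by exists T, o, e; split=> //; apply: leq_trans h3 Te.
Qed.

(** [m] is the largest number with [5 * m < 2 * t]. As [4 * m < 8 * t / 5 <= n], a complete block
    exists and [n] is less than twice what the complete blocks cover; the factor [8 * m], linear in
    [t], goes into the power of 4. *)
Lemma blocks_many_max_cliques (t n : nat) : 3 <= t -> 8 * t <= 5 * n ->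
  exists (G : sgraph 'I_n) m,
    [/\ K_minor_free t G, 2 * t <= 5 * m.+1
      & n * 4 ^ m <= 4 ^ (trunc_log 2 t + 2) * #|max_cliques G|].
Proof.
move=> t3 tn; have [m' mE] : exists m', (2 * t - 1) %/ 5 = m'.+1.
  by exists ((2 * t - 1) %/ 5).-1; rewrite prednK // divn_gt0 //; lia.
have m5 : 5 * m'.+1 < 2 * t by lia.
have m6 : 2 * t <= 5 * m'.+2 by lia.
exists (blocks n m'), m'.+1; split=> //; first exact: blocks_minor_free.
apply: leq_trans (leq_mul (leqnn _) (card_blocks_max_cliques n m')).
rewrite mulnA leq_mul2r; apply/orP; right.
move: m5 m6; set m := m'.+1 => m5 m6.
have q0 : 0 < n %/ (4 * m) by rewrite divn_gt0; lia.
have nq : n < (n %/ (4 * m)).+1 * (4 * m) by rewrite ltn_ceil.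
have tl : t < 2 * 2 ^ trunc_log 2 t by apply: trunc_log2_bounds.
have l0 : 0 < 2 ^ trunc_log 2 t by rewrite expn_gt0.
rewrite expnD exp4E; move: (n %/ _) (2 ^ _) q0 nq tl l0 => q Y q0 nq tl l0.
apply: (@leq_trans (8 * m * q)).
  by apply: ltnW; apply: leq_trans nq _; rewrite mulSn -mulnA; nia.
rewrite leq_mul2r; apply/orP; right.
by apply: (@leq_trans (16 * Y)); [lia|nia].
Qed.

(* Passage to real exponents *)
From mathcomp Require Import all_order all_algebra ring lra.
From mathcomp Require Import all_classical all_reals all_analysis.
Import numFieldNormedType.Exports.
Import Order.TTheory GRing.Theory Num.Theory.
Local Open Scope ring_scope.

Lemma sublinear_little_o (R : realType) (f : nat -> nat) :
  sublinear f -> @little_o_id R (fun t => (f t)%:R).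
Proof.
move=> fo; apply/cvgr0Pnorm_le => e e0.
have [N Nf] := fo (Num.truncn e^-1).+1.
exists N => // t /= Nt; have := Nf t Nt; move=> jft.
rewrite ger0_norm ?divr_ge0 //.
have [->|t0] := posnP t; first by rewrite invr0 mulr0 ltW.
rewrite ler_pdivrMr ?ltr0n //.
have je : e^-1 < (Num.truncn e^-1).+1%:R by apply: truncnS_gt.
rewrite -ler_pdivrMl //; apply: (@le_trans _ _ ((Num.truncn e^-1).+1%:R * (f t)%:R)).
  by rewrite ler_wpM2r // ltW.
by rewrite -natrM ler_nat.
Qed.

Lemma powR4_natX (R : realType) (m : nat) : (4 ^ m)%:R = 4 `^ m%:R :> R.
Proof. by rewrite powR_mulrn // natrX. Qed.

Theorem theorem1p2 (R : realType) :
  (exists (P : program) (k : nat) (f : nat -> R),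
     little_o_id f /\
     forall (t n : nat) (G : sgraph 'I_n) (L : 'I_n -> seq 'I_n),
       (0 < t)%N -> (0 < n)%N ->
       K_minor_free t G -> adjacency_lists G L ->
       exists (T : nat) (o : seq nat),
         [/\ halts_in (word_bound k t n) P (init_config t L) T o,
             lists_max_cliques G o
           & T%:R <= n%:R * 4 `^ (2 * t%:R / 5 + f t)])
  /\
  (exists g : nat -> R,
     little_o_id g /\
     exists t0 : nat, forall t n : nat,
       (t0 <= t)%N -> 8 * t%:R / 5 <= n%:R :> R ->
       exists G : sgraph 'I_n,
         K_minor_free t G /\
         n%:R * 4 `^ (2 * t%:R / 5 - g t) <= #|max_cliques G|%:R :> R).
Proof.
split.
- exists (linked Main), lister_exponent, (fun t => (excess t)%:R).
  split; first exact/sublinear_little_o/sublinear_excess.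
  move=> t n G L t0 n0 Gt GL.
  have [T [w [e [halt lists Te ele]]]] := lister_time t0 n0 Gt GL.
  exists T, w; split=> //.
  apply: (@le_trans _ _ (n * 4 ^ e)%:R); first by rewrite ler_nat.
  rewrite natrM powR4_natX ler_wpM2l // ler_powR // ?ler1n //.
  move: (excess t) ele => x.
  by rewrite -(ler_nat R) natrM natrD !natrM; lra.
(* [trunc_log 2 t + 2] absorbs the factor linear in [t], and one more unit the rounding
   [2 * t / 5 <= m + 1]. *)
- exists (fun t => (trunc_log 2 t + 3)%N%:R); split; first exact/sublinear_little_o/sublinear_log.
  exists 3%N => t n t3 tn.
  have tn' : (8 * t <= 5 * n)%N.
    by rewrite -(ler_nat R) !natrM; lra.
  have [G [m [Gt tm nm]]] := blocks_many_max_cliques t3 tn'.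
  exists G; split=> //; set c := #|_| in nm *; set l := trunc_log 2 t in nm *.
  have l4 : 0 < (4 ^ (l + 2))%:R :> R by rewrite ltr0n expn_gt0.
  rewrite -(ler_pM2l l4); apply: (@le_trans _ _ (n * 4 ^ m)%:R); last by rewrite -natrM ler_nat.
  rewrite mulrCA natrM ler_wpM2l // !powR4_natX -powRD; last by rewrite pnatr_eq0 implybT.
  rewrite ler_powR ?ler1n //.
  by move: tm; rewrite -(ler_nat R) !natrM -natr1 !natrD; lra.
Qed.
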